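(* Consider the fully observed system and the multi-step and rolled-out single-step least-squares predictors $\hat G^{MS}_N$, $\hat G^{SS}_N$ of horizon $H\ge1$ defined in the context. Let $M_{MS},M_{SS}\in\mathbb{R}^{H\times H}$ be the matrices with entries $$M_{MS}^{ij}=\operatorname{tr}(A^{|i-j|}),\qquad M_{SS}^{ij}=\operatorname{tr}\left(\Big(I-\Sigma_x^{-1}\sum_{\ell=0}^{\min\{i,j\}-2}A^\ell B_wB_w^\top(A^\ell)^\top\Big)(A^{|j-i|})^\top\right).$$ Then $M_{MS}-M_{SS}$ is positive semidefinite, and $$\lim_{N\to\infty}N\,\mathbf{E}\left\|(\hat G^{MS}_N-G^\star)\Sigma_z^{1/2}\right\|_F^2=\lim_{N\to\infty}N\,\mathbf{E}\left\|(\hat G^{SS}_N-G^\star)\Sigma_z^{1/2}\right\|_F^2+\operatorname{tr}\left(\Gamma_w\big((M_{MS}-M_{SS}+(H-1)d_uI_H)\otimes I_{d_x}\big)\Gamma_w^\top\right).$$ Consequently the asymptotic error of the multi-step predictor is at least that of the single-step predictor: $$\lim_{N\to\infty}N\,\mathbf{E}\left\|(\hat G^{MS}_N-G^\star)\Sigma_z^{1/2}\right\|_F^2\ \ge\ \lim_{N\to\infty}N\,\mathbf{E}\left\|(\hat G^{SS}_N-G^\star)\Sigma_z^{1/2}\right\|_F^2.$$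
   Context: System: $x_{t+1}=Ax_t+Bu_t+B_ww_t$ with $x_t\in\mathbb{R}^{d_x}$, $u_t\in\mathbb{R}^{d_u}$, $x_0=0$, $A\in\mathbb{R}^{d_x\times d_x}$, $B\in\mathbb{R}^{d_x\times d_u}$, $B_w\in\mathbb{R}^{d_x\times d_x}$. The state is fully observed ($y_t=x_t$). The noises $w_t\sim\mathcal N(0,I_{d_x})$ are i.i.d., the inputs $u_t\sim\mathcal N(0,I_{d_u})$ are i.i.d., and the two sequences are independent. Standing assumptions: the spectral radius satisfies $\rho(A)<1$ and the pair $(A,[B\ \ B_w])$ is controllable. Dataset: $\{(x_t,u_t)\}_{t=1}^N$ from one rollout of the system. For a sequence $a$, $a_{s:r}$ denotes the stacked vector of $a_s,\dots,a_r$. Put $z_t=\begin{bmatrix} x_t \\ u_{t:t+H-1} \end{bmatrix}\in\mathbb{R}^{d_x+Hd_u}$. Multi-step predictor: $\hat G^{MS}_N=\arg\min_{G\in\mathbb{R}^{Hd_x\times(d_x+Hd_u)}}\sum_{t=1}^{N-H}\|x_{t+1:t+H}-Gz_t\|^2$. Single-step predictor: $[\hat G_y\ \ \hat G_u]=\arg\min_{G_y\in\mathbb{R}^{d_x\times d_x},\,G_u\in\mathbb{R}^{d_x\times d_u}}\sum_{t=1}^{N-1}\left\|x_{t+1}-[G_y\ \ G_u]\begin{bmatrix} x_t \\ u_t \end{bmatrix}\right\|^2$; its rollout $\hat G^{SS}_N\in\mathbb{R}^{Hd_x\times(d_x+Hd_u)}$ has $i$-th block row ($1\le i\le H$) equal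 to $[\hat G_y^i\ \ \hat G_y^{i-1}\hat G_u\ \ \hat G_y^{i-2}\hat G_u\ \cdots\ \hat G_u\ \ 0\ \cdots\ 0]$. ($N$ is large enough that both least-squares solutions are almost surely unique.) $\Sigma_z=\lim_{T\to\infty}\mathbf{E}\frac1T\sum_{t=0}^{T}z_tz_t^\top$ is the stationary covariance of $z_t$, and $\Sigma_x$ is the stationary covariance of $x_t$ (the solution of $\Sigma_x=A\Sigma_xA^\top+BB^\top+B_wB_w^\top$). $G^\star\in\mathbb{R}^{Hd_x\times(d_x+Hd_u)}$ has $i$-th block row equal to $[A^i\ \ A^{i-1}B\ \ A^{i-2}B\ \cdots\ B\ \ 0\ \cdots\ 0]$. $\Gamma_w\in\mathbb{R}^{Hd_x\times Hd_x}$ is block lower triangular with $(i,j)$ block $A^{i-j}B_w$ for $i\ge j$ and $0$ for $i<j$. Empty sums are $0$. $\|\cdot\|_F$ is the Frobenius norm, $\otimes$ the Kronecker product, and $\mathbf{E}$ is over the dataset. *)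

(* Defs.v *)
From HB Require Import structures.
From mathcomp Require Import all_boot all_order all_algebra.
From mathcomp Require Import finmap.
From mathcomp Require Import all_classical all_reals all_analysis.
From mathcomp Require Export mxtens.
From mathcomp Require Import complex.

Set Implicit Arguments.
Unset Strict Implicit.
Unset Printing Implicit Defensive.

Import Order.TTheory GRing.Theory Num.Theory.
Import numFieldNormedType.Exports.

Local Open Scope classical_set_scope.
Local Open Scope ring_scope.

Section Matrices.
Variable R : realType.

(* Frobenius norm; on column vectors this is the Euclidean norm. The norm
   [`| M |] that the library puts on matrices is the max norm. *)
Definition fnorm (m n : nat) (M : 'M[R]_(m, n)) : R :=
  Num.sqrt (\sum_i \sum_j M i j ^+ 2).

Definition psd (n : nat) (M : 'M[R]_n) : Prop :=
  M^T = M /\ forall v : 'cV[R]_n, 0 <= (v^T *m M *m v) 0 0.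

Definition is_psd_sqrt (n : nat) (S M : 'M[R]_n) : Prop :=
  psd S /\ S *m S = M.

Definition spectral_radius (n : nat) (A : 'M[R]_n) : R :=
  sup [set complex.Re `|l| | l in
        [set l : R[i] | eigenvalue (map_mx (real_complex R) A) l]].

Fixpoint steer (n m : nat) (A : 'M[R]_n) (C : 'M[R]_(n, m)) (x0 : 'cV[R]_n)
    (v : nat -> 'cV[R]_m) (t : nat) : 'cV[R]_n :=
  if t is s.+1 then A *m steer A C x0 v s + C *m v s else x0.

(* Any state can be driven to any other state in finite time. *)
Definition controllable (n m : nat) (A : 'M[R]_n) (C : 'M[R]_(n, m)) : Prop :=
  forall x0 x1 : 'cV[R]_n, exists (v : nat -> 'cV[R]_m) (t : nat),
    steer A C x0 v t = x1.

(* Entry k of block i sits at position i * p + k, the same indexing as in the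
   Kronecker product [*t]. *)
Definition stack (H p q : nat) (F : 'I_H -> 'M[R]_(p, q)) : 'M[R]_(H * p, q) :=
  \matrix_(r, c) F (mxtens_unindex r).1 (mxtens_unindex r).2 c.

Definition blocks (H K p q : nat) (F : 'I_H -> 'I_K -> 'M[R]_(p, q)) :
    'M[R]_(H * p, K * q) :=
  \matrix_(r, c) F (mxtens_unindex r).1 (mxtens_unindex c).1
                   (mxtens_unindex r).2 (mxtens_unindex c).2.

(* Block (i, j) is A^(i-j) C for i >= j, and 0 above the diagonal. *)
Definition toeplitz (H n m : nat) (A : 'M[R]_n) (C : 'M[R]_(n, m)) :
    'M[R]_(H * n, H * m) :=
  blocks (fun i j : 'I_H => if (j <= i)%N then A ^+ (i - j) *m C else 0).

(* Blocks are indexed from 0 here, so block row i starts with A^(i+1). *)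
Definition rollout (H n m : nat) (A : 'M[R]_n) (B : 'M[R]_(n, m)) :
    'M[R]_(H * n, n + H * m) :=
  row_mx (stack (fun i : 'I_H => A ^+ i.+1)) (toeplitz H A B).

Definition M_MS (H n : nat) (A : 'M[R]_n) : 'M[R]_H :=
  \matrix_(i, j) \tr (A ^+ `|i%:Z - j%:Z|%N).

(* With i, j indexed from 1, the sum over l = 0, ..., min(i, j) - 2 has
   min(i, j) - 1 terms; with the indexing from 0 it has min(i, j) terms. *)
Definition M_SS (H n : nat) (A Bw Sx : 'M[R]_n) : 'M[R]_H :=
  \matrix_(i, j)
    \tr ((1%:M - invmx Sx *m
            (\sum_(l < minn i j) A ^+ l *m Bw *m Bw^T *m (A ^+ l)^T))
         *m (A ^+ `|j%:Z - i%:Z|%N)^T).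

End Matrices.

Definition is_argmin (X : Type) (R : realType) (f : X -> R) (x : X) : Prop :=
  forall y, f x <= f y.

Section Probability.
Context (d : measure_display) (T : measurableType d) (R : realType).
Variable P : probability T R.

Definition measurable_mx (m n : nat) (X : T -> 'M[R]_(m, n)) : Prop :=
  forall i j, measurable_fun [set: T] (fun o => X o i j).

(* sigma-algebra generated by a random vector *)
Definition sigma_vec (n : nat) (X : T -> 'cV[R]_n) : set (set T) :=
  <<s \bigcup_(i in [set: 'I_n])
        preimage_set_system [set: T] (fun o => X o i 0) measurable >>.

(* sigma-algebra generated by a sequence of random vectors *)
Definition sigma_seq (n : nat) (X : nat -> T -> 'cV[R]_n) : set (set T) :=
  <<s \bigcup_(t in [set: nat]) sigma_vec (X t) >>.

Definition mutually_independent (n : nat) (X : nat -> T -> 'cV[R]_n) : Prop :=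
  forall (J : {fset nat}) (E : nat -> set T),
    (forall t, t \in J -> sigma_vec (X t) (E t)) ->
    P (\bigcap_(t in [set` J]) E t) = (\prod_(t <- J) P (E t))%E.

Definition independent_seqs (m n : nat) (X : nat -> T -> 'cV[R]_m)
    (Y : nat -> T -> 'cV[R]_n) : Prop :=
  forall E F, sigma_seq X E -> sigma_seq Y F -> P (E `&` F) = (P E * P F)%E.

(* X ~ N(0, I_n): the law of X agrees with the n-fold product of N(0, 1) on
   measurable rectangles. *)
Definition std_gaussian (n : nat) (X : T -> 'cV[R]_n) : Prop :=
  measurable_mx X /\
  forall B : 'I_n -> set R, (forall i, measurable (B i)) ->
    P [set o | forall i, B i (X o i 0)] = (\prod_(i < n) normal_prob 0 1 (B i))%E.

Definition iid_std_gaussian (n : nat) (X : nat -> T -> 'cV[R]_n) : Prop :=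
  (forall t, std_gaussian (X t)) /\ mutually_independent X.

End Probability.

Section System.
Context (d : measure_display) (T : measurableType d) (R : realType).
Variable P : probability T R.
Variables (dx du H : nat).
Variables (A : 'M[R]_dx) (B : 'M[R]_(dx, du)) (Bw : 'M[R]_dx).
Variables (w : nat -> T -> 'cV[R]_dx) (u : nat -> T -> 'cV[R]_du).

Fixpoint state (t : nat) (o : T) : 'cV[R]_dx :=
  if t is s.+1 then A *m state s o + B *m u s o + Bw *m w s o else 0.

(* z_t = (x_t, u_{t:t+H-1}) *)
Definition zvec (t : nat) (o : T) : 'cV[R]_(dx + H * du) :=
  col_mx (state t o) (stack (fun i : 'I_H => u (t + i)%N o)).

(* x_{t+1:t+H} *)
Definition future (t : nat) (o : T) : 'cV[R]_(H * dx) :=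
  stack (fun i : 'I_H => state (t + i).+1 o).

Definition Sigma_z : 'M[R]_(dx + H * du) :=
  \matrix_(i, j) lim ((fun S : nat => S%:R^-1 *
    \sum_(0 <= t < S.+1) fine 'E_P[fun o => (zvec t o *m (zvec t o)^T) i j])
    @ \oo).

Definition ms_cost (N : nat) (o : T) (G : 'M[R]_(H * dx, dx + H * du)) : R :=
  \sum_(1 <= t < (N - H).+1) fnorm (future t o - G *m zvec t o) ^+ 2.

Definition ss_cost (N : nat) (o : T) (G : 'M[R]_dx * 'M[R]_(dx, du)) : R :=
  \sum_(1 <= t < N)
    fnorm (state t.+1 o - row_mx G.1 G.2 *m col_mx (state t o) (u t o)) ^+ 2.

(* The minimizers are only almost surely unique, and only for large N: an
   estimator is any random variable that is almost surely a minimizer. *)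
Definition ms_estimator (N : nat) (G : T -> 'M[R]_(H * dx, dx + H * du)) :
    Prop :=
  measurable_mx G /\ {ae P, forall o, is_argmin (ms_cost N o) (G o)}.

Definition ss_estimator (N : nat) (Gy : T -> 'M[R]_dx)
    (Gu : T -> 'M[R]_(dx, du)) : Prop :=
  [/\ measurable_mx Gy, measurable_mx Gu
    & {ae P, forall o, is_argmin (ss_cost N o) (Gy o, Gu o)}].

(* N * E || (G - Gstar) S ||_F^2, in the extended reals since the expectation
   may be infinite for small N *)
Definition scaled_error (S : 'M[R]_(dx + H * du)) (N : nat)
    (G : T -> 'M[R]_(H * dx, dx + H * du)) : \bar R :=
  (N%:R%:E * 'E_P[fun o => (fnorm ((G o - rollout H A B) *m S) ^+ 2)%R])%E.

End System.

(* Main.v *)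
Require Import Defs.
From HB Require Import structures.
From mathcomp Require Import all_boot all_order all_algebra.
From mathcomp Require Import finmap.
From mathcomp Require Import all_classical all_reals all_analysis.
From mathcomp Require Import measurable_realfun.
From mathcomp Require Import complex.
From mathcomp Require Import ring lra zify.

Set Implicit Arguments.
Unset Strict Implicit.
Unset Printing Implicit Defensive.

Import Order.TTheory GRing.Theory Num.Theory.
Import numFieldNormedType.Exports.

Local Open Scope classical_set_scope.
Local Open Scope ring_scope.

(**
  Write x_(t+1:t+H) = Gstar z_t + Gamma omega_t, where omega_t stacks
  w_t, ..., w_(t+H-1). The normal equations for n samples are Theta S = W, where
  Theta is the estimation error, S the empirical covariance sum of the regressors
  and W the noise-regressor sum. Since sqrt n (S / n - Sigma) and W / sqrt n have
  bounded moments of every order,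
    sqrt n Theta = n^(-1/2) W Sigma^-1 + O(n^(-1/2)),
  provided that the moments of sqrt n Theta are bounded as well. As the error is
  measured in expectation, this needs negative moments of the smallest eigenvalue
  of S: n / lambda_min(S) is bounded in every L^p for n large, because det(Z) for a
  block Z of regressors is, up to an invertible change of coordinates, a polynomial
  of degree one in each of several fresh Gaussians, and E |a g + b|^(-1/2) is at
  most a constant times |a|^(-1/2).

  The limits are then second moments of the main terms. For the multi-step
  predictor they involve n^-1 E (W Q W^T) with Q = Sigma_z^-1, where the block (i, j)
  only sees E z_(t+|i-j|)^T Q z_t, that is tr A^|i-j| plus, for i = j, the H du input
  coordinates. For the rolled-out predictor, the first-order term of the rollout in
  the single-step error gives in the same way the matrix M_SS plus du on the
  diagonal. Finally M_MS - M_SS is a Gram matrix for the scalar product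
  tr(Sigma_x^-1 F G^T), the i-th vector being the family of the A^(i-1-m) Bw, m < i.
*)

(** * Families with bounded moments *)

(** Bounding every L^p norm, rather than the few that are used, makes the families an algebra:
    products need no Hölder exponents, and n^(-1/2) times a member vanishes in the limit of
    expectations. Two versions are needed since a negative moment of order p is controlled only once
    the sample is long enough for p. The exponent -1/2 is chosen because |x|^(-1/2) is locally
    integrable while |x|^(-1) is not; an order p is then reached by pooling a number of blocks
    proportional to p. The state starts at 0 rather than in its stationary law, so the law of large
    numbers for x x^T comes from a Lyapunov recursion forced by martingale sums, not from
    ergodicity. Independence is used one scalar noise at a time: each is N(0, 1) and independent of
    the sigma-algebra of all the others, and not depending on a noise means being measurable for
    that sigma-algebra. Expectations are then computed by integrating out the latest noise. *)

Section ubd.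
Context d (T : measurableType d) (R : realType).
Variable P : probability T R.

(* The L^p norms of [F] are bounded, for every p: uniformly if [b], and
   otherwise only for indices [i] with [h i] large, depending on p. *)
Definition mbd (b : bool) (I : Type) (h : I -> nat) (F : I -> T -> R) : Prop :=
  (forall i, measurable_fun [set: T] (F i)) /\
  forall p : nat, exists (C : R) (n0 : nat), forall i, b || (n0 <= h i)%N ->
    (\int[P]_o (`|F i o| ^+ p)%:E <= C%:E)%E.

Definition ubd (I : Type) (F : I -> T -> R) : Prop := mbd true (fun=> 0%N) F.

Definition lbd (F : nat -> T -> R) : Prop := mbd false id F.

(** A single variable is a family indexed by [unit], so that the closure lemmas for families apply
    to it directly. *)
Definition moms (X : T -> R) : Prop := mbd true (fun=> 0%N) (fun _ : unit => X).

Lemma ubdI (I : Type) (F : I -> T -> R) :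
  (forall i, measurable_fun [set: T] (F i)) ->
  (forall p : nat, exists C : R, forall i,
    (\int[P]_o (`|F i o| ^+ p)%:E <= C%:E)%E) -> ubd F.
Proof.
by move=> mF bF; split=> [|p]; [exact: mF|have [C hC] := bF p; exists C, 0%N].
Qed.

Lemma ubdE (I : Type) (F : I -> T -> R) : ubd F -> forall p : nat, exists C : R,
  forall i, (\int[P]_o (`|F i o| ^+ p)%:E <= C%:E)%E.
Proof. by move=> [_ bF] p; have [C [n0 hC]] := bF p; exists C => i; exact: hC. Qed.

Lemma ubd_mbd b I (h : I -> nat) (F : I -> T -> R) : ubd F -> mbd b h F.
Proof.
move=> bF; split=> [i|p]; first by case: bF.
by have [C hC] := ubdE bF p; exists C, 0%N.
Qed.

Lemma integral_prob_cst (c : R) : (\int[P]_o (c%:E))%E = c%:E.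
Proof.
have := integral_cst P measurableT c%:E.
by rewrite [X in (_ * X)%E]probability_setT mule1.
Qed.

Section mbd.
Variables (b : bool) (I : Type) (h : I -> nat).
Local Notation ubd := (@mbd b I h).
Implicit Types F G : I -> T -> R.

Lemma ubd_meas F i : ubd F -> measurable_fun [set: T] (F i).
Proof. by case. Qed.

Lemma ubd_comp J (f : J -> I) F : ubd F -> mbd b (h \o f) (fun j => F (f j)).
Proof.
move=> [mF bF]; split=> [j|p]; first exact: mF.
by have [C [n0 hC]] := bF p; exists C, n0 => i; exact: hC.
Qed.

Lemma ubd_ae_le F G : (forall i, measurable_fun setT (F i)) ->
  ubd G -> (forall i, {ae P, forall o, `|F i o| <= `|G i o|}) -> ubd F.
Proof.
move=> mF [mG bG] FG; split=> [|p]; first exact: mF.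
have [C [n0 hC]] := bG p; exists C, n0 => i ni.
apply: le_trans (hC i ni); apply: ae_ge0_le_integral => //.
- by apply/measurable_EFinP/measurable_funX; exact: measurableT_comp.
- by apply/measurable_EFinP/measurable_funX; exact: measurableT_comp.
have := FG i; apply: filterS => x h' _; rewrite lee_fin.
by rewrite lerXn2r// nnegrE.
Qed.

Lemma ubd_le F G : (forall i, measurable_fun setT (F i)) ->
  ubd G -> (forall i o, `|F i o| <= `|G i o|) -> ubd F.
Proof.
by move=> mF bG FG; apply: ubd_ae_le mF bG _ => i; apply: aeW => o; exact: FG.
Qed.

Lemma ubd_ext F G : ubd F -> (forall i o, F i o = G i o) -> ubd G.
Proof. by move=> bF FG; have -> : G = F by apply/funext => i; apply/funext. Qed.

Lemma ubd_cst (c : I -> R) M : (forall i, `|c i| <= M) ->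
  ubd (fun i _ => c i).
Proof.
move=> cM; split=> // p; exists (M ^+ p), 0%N => i _.
rewrite integral_prob_cst lee_fin lerXn2r// nnegrE//.
exact: le_trans (cM i).
Qed.

Lemma ubd_cst1 (c : R) : ubd (fun (_ : I) _ => c).
Proof. exact: (@ubd_cst (fun=> c) `|c|). Qed.

Lemma ubdN F : ubd F -> ubd (fun i o => - F i o).
Proof.
move=> bF; apply: (ubd_le _ bF) => [i|i o]; last by rewrite normrN.
by apply: measurableT_comp => //; exact: (ubd_meas i bF).
Qed.

Lemma ubdD F G : ubd F -> ubd G -> ubd (fun i o => F i o + G i o).
Proof.
move=> [mF bF] [mG bG]; split=> [i|p]; first exact: measurable_funD.
have [C [n0 hC']] := bF p; have [D [n1 hD']] := bG p.
exists (2 ^+ p * C + 2 ^+ p * D), (maxn n0 n1) => i ni.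
have hC : (\int[P]_o (`|F i o| ^+ p)%:E <= C%:E)%E.
  by apply: hC'; move: ni; rewrite geq_max; case: (b) => //= /andP[].
have hD : (\int[P]_o (`|G i o| ^+ p)%:E <= D%:E)%E.
  by apply: hD'; move: ni; rewrite geq_max; case: (b) => //= /andP[].
have mFp : measurable_fun setT (fun o => (`|F i o| ^+ p)%:E).
  by apply/measurable_EFinP/measurable_funX; exact: measurableT_comp.
have mGp : measurable_fun setT (fun o => (`|G i o| ^+ p)%:E).
  by apply/measurable_EFinP/measurable_funX; exact: measurableT_comp.
have le2 : ((2 ^+ p)%:E * (\int[P]_o (`|F i o| ^+ p)%:E) +
   (2 ^+ p)%:E * (\int[P]_o (`|G i o| ^+ p)%:E) <= (2 ^+ p * C + 2 ^+ p * D)%:E)%E.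
  by rewrite EFinD; apply: leeD; rewrite EFinM; apply: lee_wpmul2l => //;
   rewrite lee_fin exprn_ge0.
apply: le_trans le2.
rewrite -!ge0_integralZl//=.
rewrite -ge0_integralD//=; try exact: measurable_funeM;
  try by move=> x _; rewrite -EFinM lee_fin mulr_ge0// exprn_ge0.
apply: ge0_le_integral => //=.
- by apply/measurable_EFinP/measurable_funX; apply: measurableT_comp => //;
    exact: measurable_funD.
- by apply: emeasurable_funD; apply: measurable_funeM.
move=> o _; rewrite -!EFinM -EFinD lee_fin.
(* Pointwise |F + G| is at most twice the larger of |F| and |G|, whence the factor 2^p. *)
wlog FG : F G {mF bF mG bG hC hD mFp mGp hC' hD'} / `|F i o| <= `|G i o|.
  move=> hw; have [/hw//|/ltW/hw] := leP `|F i o| `|G i o|.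
  by rewrite addrC [X in _ <= X]addrC.
apply: (@le_trans _ _ (2 ^+ p * `|G i o| ^+ p)).
  rewrite -exprMn lerXn2r ?nnegrE ?mulr_ge0//.
  rewrite mulr_natl mulr2n; apply: le_trans (ler_normD _ _) _; exact: lerD.
by rewrite lerDr mulr_ge0// exprn_ge0.
Qed.

(** Since |F G| <= F^2 + G^2, only squares matter, and the moment of order p of a square is a moment
    of order 2p: this is why all orders are bounded together. *)
Lemma ubdM F G : ubd F -> ubd G -> ubd (fun i o => F i o * G i o).
Proof.
move=> bF bG.
suff sq H : ubd H -> ubd (fun (i : I) o => H i o ^+ 2 + 0).
  apply: (ubd_le _ (ubdD (sq _ bF) (sq _ bG))) => [i|i o].
    by apply: measurable_funM; [exact: (ubd_meas i bF)|exact: (ubd_meas i bG)].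
  rewrite !addr0 [leRHS]ger0_norm ?addr_ge0 ?sqr_ge0//.
  rewrite normrM -!(real_normK (num_real (_ i o))).
  have := sqr_ge0 (`|F i o| - `|G i o|); have := sqr_ge0 (`|F i o|); have := sqr_ge0 (`|G i o|).
  nra.
move=> [mH bH]; apply: (ubd_ext (F := fun i o => H i o ^+ 2)); last first.
  by move=> i o; rewrite addr0.
split=> [i|p]; first exact: measurable_funX.
have [C [n0 hC]] := bH (2 * p)%N; exists C, n0 => i ni; have {}hC := hC i ni; move: hC.
by under [X in _ -> (X <= _)%E]eq_integral do rewrite normrX -exprM.
Qed.

Lemma ubdB F G : ubd F -> ubd G -> ubd (fun i o => F i o - G i o).
Proof. by move=> bF bG; apply: ubdD => //; exact: ubdN. Qed.

Lemma ubdZ (c : R) F : ubd F -> ubd (fun i o => c * F i o).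
Proof. by move=> bF; apply: ubdM => //; exact: ubd_cst1. Qed.

Lemma ubdX F k : ubd F -> ubd (fun i o => F i o ^+ k).
Proof.
move=> bF; elim: k => [|k IH].
  by apply: (ubd_ext (ubd_cst1 1)) => i o; rewrite expr0.
by apply: (ubd_ext (ubdM bF IH)) => i o; rewrite exprS.
Qed.

Lemma ubd_norm F : ubd F -> ubd (fun i o => `|F i o|).
Proof.
move=> bF; apply: (ubd_le _ bF) => [i|i o]; last by rewrite normr_id.
by apply: measurableT_comp => //; exact: (ubd_meas i bF).
Qed.

Lemma ubd_sum J (r : seq J) (Q : pred J) (F : J -> I -> T -> R) :
  (forall j, Q j -> ubd (F j)) -> ubd (fun i o => \sum_(j <- r | Q j) F j i o).
Proof.
move=> bF; elim: r => [|j r IH].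
  by apply: (ubd_ext (ubd_cst1 0)) => i o; rewrite big_nil.
have [Qj|Qj] := boolP (Q j); last first.
  by apply: (ubd_ext IH) => i o; rewrite big_cons (negbTE Qj).
by apply: (ubd_ext (ubdD (bF _ Qj) IH)) => i o; rewrite big_cons Qj.
Qed.

Lemma ubd_prod J (r : seq J) (Q : pred J) (F : J -> I -> T -> R) :
  (forall j, Q j -> ubd (F j)) -> ubd (fun i o => \prod_(j <- r | Q j) F j i o).
Proof.
move=> bF; elim: r => [|j r IH].
  by apply: (ubd_ext (ubd_cst1 1)) => i o; rewrite big_nil.
have [Qj|Qj] := boolP (Q j); last first.
  by apply: (ubd_ext IH) => i o; rewrite big_cons (negbTE Qj).
by apply: (ubd_ext (ubdM (bF _ Qj) IH)) => i o; rewrite big_cons Qj.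
Qed.

Lemma ubd_int F : ubd F -> exists n0, forall i, b || (n0 <= h i)%N ->
  P.-integrable [set: T] (EFin \o F i).
Proof.
move=> [mF bF]; have [C [n0 hC]] := bF 1%N; exists n0 => i ni.
apply/integrableP; split; first exact/measurable_EFinP.
have := hC i ni; under eq_integral do rewrite expr1.
by move=> hle; apply: le_lt_trans hle _; rewrite ltry.
Qed.

End mbd.

Lemma ubd_moms I (F : I -> T -> R) i : ubd F -> moms (F i).
Proof. exact: (@ubd_comp true I (fun=> 0%N) unit (fun _ => i)). Qed.

Lemma moms_int X : moms X -> P.-integrable [set: T] (EFin \o X).
Proof. by move=> /ubd_int[n0 /(_ tt isT)]. Qed.

(* Meaningful on integrable functions only: [fine] sends infinities to 0. *)
Definition ex (X : T -> R) : R := fine (\int[P]_o (X o)%:E)%E.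

Lemma exE X : moms X -> (\int[P]_o (X o)%:E)%E = (ex X)%:E.
Proof.
move=> /moms_int iX; rewrite /ex fineK//.
exact: (integrable_fin_num _ iX).
Qed.

Lemma ex_cst c : ex (fun=> c) = c.
Proof. by rewrite /ex integral_prob_cst. Qed.

Lemma exD X Y : moms X -> moms Y -> ex (fun o => X o + Y o) = ex X + ex Y.
Proof.
move=> mX mY; apply: EFin_inj; rewrite EFinD -!exE//; last exact: ubdD.
by under eq_integral do rewrite EFinD; rewrite integralD//; exact: moms_int.
Qed.

Lemma exZ c X : moms X -> ex (fun o => c * X o) = c * ex X.
Proof.
move=> mX; apply: EFin_inj; rewrite EFinM -!exE//; last exact: ubdZ.
by under eq_integral do rewrite EFinM; rewrite integralZl//; exact: moms_int.
Qed.

Lemma exN X : moms X -> ex (fun o => - X o) = - ex X.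
Proof.
move=> mX; rewrite -mulN1r -exZ//; congr ex; apply/funext => o.
by rewrite mulN1r.
Qed.

Lemma exB X Y : moms X -> moms Y -> ex (fun o => X o - Y o) = ex X - ex Y.
Proof. by move=> mX mY; rewrite exD ?exN//; exact: ubdN. Qed.

Lemma moms_sum J (r : seq J) (Q : pred J) (F : J -> T -> R) :
  (forall j, Q j -> moms (F j)) -> moms (fun o => \sum_(j <- r | Q j) F j o).
Proof. by move=> h; exact: (@ubd_sum true unit (fun=> 0%N) _ r Q (fun j _ => F j)). Qed.

Lemma ex_sum J (r : seq J) (Q : pred J) (F : J -> T -> R) :
  (forall j, Q j -> moms (F j)) ->
  ex (fun o => \sum_(j <- r | Q j) F j o) = \sum_(j <- r | Q j) ex (F j).
Proof.
move=> mF; elim: r => [|j r IH].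
  by rewrite big_nil -[RHS](ex_cst 0); congr ex; apply/funext => o; rewrite big_nil.
rewrite big_cons -IH; have [Qj|Qj] := boolP (Q j).
  rewrite -exD; [|exact: mF|exact: moms_sum].
  by congr ex; apply/funext => o; rewrite big_cons Qj.
by congr ex; apply/funext => o; rewrite big_cons (negbTE Qj).
Qed.

Lemma ex_ge0 X : (forall o, 0 <= X o) -> 0 <= ex X.
Proof.
by move=> X0; rewrite /ex fine_ge0// integral_ge0// => o _; rewrite lee_fin.
Qed.

Lemma ex_le X Y : moms X -> moms Y -> (forall o, X o <= Y o) -> ex X <= ex Y.
Proof.
move=> mX mY XY; rewrite -subr_ge0 -exB//; apply: ex_ge0 => o.
by rewrite subr_ge0.
Qed.

Lemma ex_le_norm X : moms X -> `|ex X| <= ex (fun o => `|X o|).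
Proof.
move=> mX; have mnX : moms (fun o => `|X o|) by exact: ubd_norm.
rewrite ler_norml -exN//; apply/andP; split; apply: ex_le => //.
- exact: ubdN.
- by move=> o; rewrite lerNl -normrN ler_norm.
- by move=> o; rewrite ler_norm.
Qed.

Lemma ubd_ex I (F : I -> T -> R) : ubd F -> exists C, forall i, `|ex (F i)| <= C.
Proof.
move=> bF; have [C hC] := ubdE bF 1; exists C => i.
have mF := ubd_moms i bF.
apply: le_trans (ex_le_norm mF) _; rewrite -lee_fin -exE; last exact: ubd_norm.
by have := hC i; under eq_integral do rewrite expr1.
Qed.

Lemma ubd_ex1 I (F : I -> T -> R) : (forall i, measurable_fun setT (F i)) ->
  (forall p, exists C, forall i, moms (F i) /\ ex (fun o => `|F i o| ^+ p) <= C) ->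
  ubd F.
Proof.
move=> mF h; apply: ubdI => [|p]; first exact: mF.
have [C hC] := h p; exists C => i.
have [mFi le] := hC i; rewrite exE ?lee_fin//.
by apply: ubdX; exact: ubd_norm.
Qed.

End ubd.

(** * Integrating out a Gaussian variable independent of a sub-sigma-algebra *)

Section subsigma.
Context d (T : measurableType d) (R : realType).
Variable P : probability T R.
Local Notation N := (@normal_prob R 0 1).
Variables (G : set (set T)) (g : T -> R).
Local Notation TG := (g_sigma_algebraType G).
Hypothesis Gm : forall E, <<s G >> E -> measurable E.
Hypothesis mg : measurable_fun [set: T] g.
Hypothesis ind : forall E (B : set R), <<s G >> E -> measurable B ->
  P (E `&` g @^-1` B) = (P E * N B)%E.

Definition gmeas (X : T -> R) := measurable_fun [set: TG] (X : TG -> R).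

Lemma id_subsigma_measurable : measurable_fun [set: T] (id : T -> TG).
Proof. by move=> _ B mB; rewrite setTI; exact: Gm. Qed.

Lemma gmeasW X : gmeas X -> measurable_fun [set: T] X.
Proof.
by move=> mX; apply: (measurableT_comp mX); exact: id_subsigma_measurable.
Qed.

(* The pair (identity to the sub-sigma-algebra [G], [g]) has law P x N(0, 1). *)
Lemma fubini_subsigma (phi : TG * measurableTypeR R -> \bar R) :
  measurable_fun [set: TG * measurableTypeR R] phi -> (forall z, 0 <= phi z)%E ->
  (\int[P]_o phi (o : TG, g o) = \int[P]_o \int[N]_s phi (o : TG, s))%E.
Proof.
move=> mphi phi0.
have @X : {mfun T >-> TG}.
  by apply: (HB.pack (id : T -> TG)
    (isMeasurableFun.Build _ _ _ _ _ id_subsigma_measurable)).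
pose j (o : T) : TG * measurableTypeR R := (o, g o).
have mj : measurable_fun setT j.
  by apply: measurable_fun_pair => //; exact: id_subsigma_measurable.
pose PG := distribution P X.
transitivity (\int[pushforward P j]_z phi z)%E.
  by rewrite ge0_integral_pushforward.
have @Y : {mfun T >-> (TG * measurableTypeR R)%type}.
  by apply: (HB.pack j (isMeasurableFun.Build _ _ _ _ _ mj)).
transitivity (\int[PG \x N]_z phi z)%E.
  apply: eq_measure_integral => A mA _.
  apply/esym/(@product_measure_unique _ _ _ _ _ PG N (distribution P Y)) => // B C mB mC; exact: ind.
rewrite fubini_tonelli1//= /fubini_F /PG.
rewrite ge0_integral_pushforward//.
- exact: measurable_fun_fubini_tonelli_F.
- by move=> o _; apply: integral_ge0.
Qed.

Lemma indep_ge0 (Y : T -> R) (f : R -> R) : gmeas Y -> (forall o, 0 <= Y o) ->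
  measurable_fun [set: R] f -> (forall s, 0 <= f s) ->
  (\int[P]_o (Y o * f (g o))%:E = (\int[P]_o (Y o)%:E) * \int[N]_s (f s)%:E)%E.
Proof.
move=> mY Y0 mf f0.
have := @fubini_subsigma (fun z => (Y z.1 * f z.2)%:E); move=> /= ->.
- under eq_integral => o _.
    under eq_integral do rewrite EFinM.
    rewrite ge0_integralZl//=; first over.
    - by apply/measurable_EFinP.
    - by move=> s _; rewrite lee_fin.
    - by rewrite lee_fin.
  rewrite ge0_integralZr//.
  - by apply/measurable_EFinP; exact: gmeasW.
  - by move=> s _; rewrite lee_fin.
  - by apply: integral_ge0 => s _; rewrite lee_fin.
- apply/measurable_EFinP; apply: measurable_funM.
    exact: measurableT_comp mY measurable_fst.
  exact: measurableT_comp mf measurable_snd.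
- by move=> z; rewrite lee_fin mulr_ge0.
Qed.

(** Both factors are split into positive and negative parts, [pp] and [nn], to which the
    non-negative case applies. *)
Lemma indep_ex (Y : T -> R) (f : R -> R) : gmeas Y -> moms P Y ->
  moms N f -> moms P (fun o => f (g o)) ->
  ex P (fun o => Y o * f (g o)) = ex P Y * ex N f.
Proof.
move=> gY mY mf mfg.
pose pp (x : R) := (`|x| + x) / 2; pose nn (x : R) := (`|x| - x) / 2.
have pnE x : x = pp x - nn x by rewrite /pp /nn; lra.
have pp0 x : 0 <= pp x by rewrite /pp; have := ler_norm (- x); rewrite normrN; lra.
have nn0 x : 0 <= nn x by rewrite /nn; have := ler_norm x; lra.
have gpp X : gmeas X -> gmeas (fun o => pp (X o)).
  by move=> mX; apply: measurable_funM => //; apply: measurable_funD => //; exact: measurableT_comp.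
have gnn X : gmeas X -> gmeas (fun o => nn (X o)).
  by move=> mX; apply: measurable_funM => //; apply: measurable_funB => //; exact: measurableT_comp.
have dec d' (T' : measurableType d') (Q : probability T' R) (X : T' -> R) : moms Q X ->
    [/\ moms Q (fun o => pp (X o)), moms Q (fun o => nn (X o)) &
        ex Q X = ex Q (fun o => pp (X o)) - ex Q (fun o => nn (X o))].
  move=> mX; have m1 : moms Q (fun o => pp (X o)).
    by apply: ubdM; [apply: ubdD => //; exact: ubd_norm|exact: ubd_cst1].
  have m2 : moms Q (fun o => nn (X o)).
    by apply: ubdM; [apply: ubdB => //; exact: ubd_norm|exact: ubd_cst1].
  by split=> //; rewrite -exB//; congr ex; apply/funext => o; exact: pnE.
have key (Z : T -> R) (h : R -> R) : gmeas Z -> moms P Z -> (forall o, 0 <= Z o) ->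
    moms N h -> moms P (fun o => h (g o)) -> (forall s, 0 <= h s) ->
    ex P (fun o => Z o * h (g o)) = ex P Z * ex N h.
  move=> gZ mZ Z0 mh mhg h0; apply: EFin_inj.
  rewrite EFinM -!exE//; last exact: ubdM.
  by rewrite indep_ge0//; exact: (ubd_meas tt mh).
have [mp mn ->] := dec _ _ _ _ mf; have [mgp mgn _] := dec _ _ _ _ mfg.
have key1 (h : R -> R) : moms N h -> moms P (fun o => h (g o)) -> (forall s, 0 <= h s) ->
    ex P (fun o => Y o * h (g o)) = ex P Y * ex N h.
  move=> mh mhg h0; have [mYp mYn ->] := dec _ _ _ _ mY.
  rewrite (_ : (fun o => _) = (fun o => pp (Y o) * h (g o) - nn (Y o) * h (g o))).
    rewrite exB; [|exact: ubdM|exact: ubdM].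
    rewrite (key _ _ (gpp _ gY))// (key _ _ (gnn _ gY))//; ring.
  by apply/funext => o; rewrite -mulrBl -pnE.
rewrite (_ : (fun o => _) = (fun o => Y o * pp (f (g o)) - Y o * nn (f (g o)))).
  rewrite exB; [|exact: ubdM|exact: ubdM].
  rewrite (key1 (fun s => pp (f s)))// (key1 (fun s => nn (f s)))//; ring.
by apply/funext => o; rewrite -mulrBr -pnE.
Qed.

End subsigma.

(** * Gaussian coordinates *)

Section gauss1.
Context (R : realType).
Local Notation N := (@normal_prob R 0 1).
Local Notation mu := (@lebesgue_measure R).

(** The Radon-Nikodym derivative of the law and [normal_pdf] have the same integral over every
    measurable set, hence agree almost everywhere. *)
Lemma ge0_integral_normal (m : R) (f : R -> R) :
  measurable_fun [set: R] f -> (forall s, 0 <= f s) ->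
  (\int[normal_prob m 1]_s (f s)%:E = \int[mu]_s (f s * normal_pdf m 1 s)%:E)%E.
Proof.
move=> mf f0.
have dom := @normal_prob_dominates R m 1.
rewrite -(@Radon_Nikodym_SigmaFinite.change_of_variables _ _ _ (normal_prob m 1) mu)//; first last.
  exact/measurable_EFinP.
have intf := @Radon_Nikodym_SigmaFinite.f_integrable _ _ _ (normal_prob m 1) mu dom.
apply: ae_eq_integral => //.
- apply: emeasurable_funM; first exact/measurable_EFinP.
  exact: (measurable_int _ intf).
- apply/measurable_EFinP; apply: measurable_funM => //.
  exact: measurable_normal_pdf.
under [X in ae_eq _ _ _ X]eq_fun do rewrite EFinM.
apply: ae_eqe_mul2l; apply: integral_ae_eq => //.
- apply/measurable_EFinP; exact: measurable_normal_pdf.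
move=> A _ mA.
by rewrite -Radon_Nikodym_SigmaFinite.f_integral.
Qed.

Lemma normal_pdf01E m (s : R) :
  normal_pdf m 1 s = normal_peak 1 * expR (- (s - m) ^+ 2 / 2).
Proof. by rewrite normal_pdfE ?oner_eq0// /normal_fun expr1n. Qed.

Lemma normal_mgf (l : R) : (\int[N]_s (expR (l * s))%:E = (expR (l ^+ 2 / 2))%:E)%E.
Proof.
have mexp : measurable_fun [set: R] (fun s => expR (l * s)).
  by apply: measurableT_comp => //; exact: measurable_funM.
rewrite ge0_integral_normal//.
(* Completing the square: e^(l s) times the density centred at 0 is e^(l^2 / 2) times the density
   centred at l. *)
transitivity (\int[mu]_s ((expR (l ^+ 2 / 2))%:E * (normal_pdf l 1 s)%:E))%E.
  apply: eq_integral => s _; rewrite -EFinM; congr EFin.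
  rewrite !normal_pdf01E mulrCA [RHS]mulrCA -!expRD; congr (_ * expR _).
  by field.
rewrite ge0_integralZl//; first by rewrite integral_normal_pdf mule1.
- by apply/measurable_EFinP; exact: measurable_normal_pdf.
- by move=> s _; rewrite lee_fin normal_pdf_ge0.
Qed.

Lemma expR_abs_le (x : R) : expR `|x| <= expR x + expR (- x).
Proof.
have [x0|x0] := leP 0 x.
  by rewrite ger0_norm// lerDl expR_ge0.
by rewrite ltr0_norm// lerDr expR_ge0.
Qed.

Lemma moms_expR (l : R) : moms N (fun s => expR (l * s)).
Proof.
apply: ubdI => [_|p].
  by apply: measurableT_comp => //; exact: measurable_funM.
exists (expR ((p%:R * l) ^+ 2 / 2)) => _.
rewrite -normal_mgf; apply: ge0_le_integral => //=.
- by apply/measurable_EFinP/measurable_funX; apply: measurableT_comp => //;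
    apply: measurableT_comp => //; exact: measurable_funM.
- by apply/measurable_EFinP; apply: measurableT_comp => //; exact: measurable_funM.
by move=> s _; rewrite lee_fin ger0_norm ?expR_ge0// -expRM_natl mulrA.
Qed.

Lemma moms_id : moms N (fun s => s).
Proof.
have b : moms N (fun s => expR (1 * s) + expR (- 1 * s)).
  by apply: ubdD; exact: moms_expR.
apply: (ubd_le _ b) => // _ s.
rewrite [leRHS]ger0_norm ?addr_ge0 ?expR_ge0// mul1r mulN1r.
apply: le_trans (expR_abs_le _); apply: le_trans (expR_ge1Dx _).
by rewrite lerDr.
Qed.

Lemma ex_expR (l : R) : ex N (fun s => expR (l * s)) = expR (l ^+ 2 / 2).
Proof. by apply: EFin_inj; rewrite -exE ?normal_mgf//; exact: moms_expR. Qed.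

Lemma expR_sqr_sub1_le (l : R) : `|l| <= 1 -> expR (l ^+ 2 / 2) - 1 <= l ^+ 2.
Proof.
move=> l1.
have h : 1 - l ^+ 2 / 2 <= expR (- (l ^+ 2 / 2)) by apply: le_trans (expR_ge1Dx _); lra.
have l2 : l ^+ 2 <= 1 by rewrite -real_normK ?num_real// expr_le1.
have l20 := sqr_ge0 l.
have e : expR (- (l ^+ 2 / 2)) * expR (l ^+ 2 / 2) = 1 by rewrite -expRD addNr expR0.
have := expR_gt0 (l ^+ 2 / 2); nra.
Qed.

(** Integrating l s <= e^(l s) - 1 gives l m <= e^(l^2 / 2) - 1 <= l^2 for |l| <= 1; small l of both
    signs force m = 0. *)
Lemma normal_mean : ex N (fun s => s) = 0.
Proof.
set m := ex _ _.
have h (l : R) : `|l| <= 1 -> l * m <= l ^+ 2.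
  move=> l1; apply: le_trans (expR_sqr_sub1_le l1).
  rewrite -exZ; last exact: moms_id.
  have -> : expR (l ^+ 2 / 2) - 1 = ex N (fun s => expR (l * s) - 1).
    by rewrite exB ?ex_cst ?ex_expR//; [exact: moms_expR|exact: ubd_cst1].
  apply: ex_le.
  - by apply: ubdZ; exact: moms_id.
  - by apply: ubdB; [exact: moms_expR|exact: ubd_cst1].
  - by move=> s; have := expR_ge1Dx (l * s); lra.
apply/eqP; rewrite -normr_eq0 eq_le normr_ge0 andbT.
apply/ler_addgt0Pl => e e0; rewrite addr0.
pose t := Num.min e 1.
have t0 : 0 < t by rewrite lt_min e0 ltr01.
have t1 : t <= 1 by rewrite ge_min lexx orbT.
have te : t <= e by rewrite ge_min lexx.
have ht := h t; have hNt := h (- t).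
rewrite normrN !gtr0_norm// in ht hNt.
have {}ht := ht t1; have {}hNt := hNt t1.
have : m <= t by rewrite -(ler_pM2l t0) -expr2.
have : - m <= t by rewrite -(ler_pM2l t0) mulrN -mulNr -expr2 -sqrrN.
by rewrite ler_norml => a b; lra.
Qed.

(** This bound and the next control 2 sinh y, for use in 2 cosh x - 2 = (2 sinh (x / 2))^2. *)
Lemma sinh_le (y : R) : 0 <= y -> expR y - expR (- y) <= 2 * y * expR y.
Proof.
move=> y0; have h := expR_ge1Dx (- (2 * y)).
have e : expR (- y) = expR y * expR (- (2 * y)) by rewrite -expRD; congr expR; lra.
by rewrite e; have := expR_gt0 y; nra.
Qed.

Lemma sinh_ge (y : R) : 0 <= y -> 2 * y - y ^+ 2 <= expR y - expR (- y).
Proof.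
move=> y0; have h := expR_ge1Dx y; have h2 := expR_ge0 (- y).
have e : expR (- y) * expR y = 1 by rewrite -expRD addNr expR0.
have h3 : expR (- y) * (1 + y) <= expR (- y) * expR y by apply: ler_wpM2l.
rewrite e in h3.
nra.
Qed.

(* Second-order expansion of the moment generating function at 0 gives the
   variance of N(0, 1). *)
Lemma cosh_expansion (x : R) :
  `|expR x + expR (- x) - 2 - x ^+ 2| <= `|x| ^+ 3 * expR `|x|.
Proof.
wlog x0 : x / 0 <= x.
  move=> h; have [/h//|x0] := leP 0 x.
  by have := h (- x); rewrite opprK sqrrN normrN [expR (- x) + _]addrC; apply; lra.
rewrite (ger0_norm x0); pose t := x / 2.
have t0 : 0 <= t by rewrite divr_ge0.
have xt : x = 2 * t by rewrite /t; field.
have eq1 : expR x + expR (- x) = 2 + (expR t - expR (- t)) ^+ 2.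
  rewrite sqrrB -mulr_natl -!expRM_natl -expRD addrN expR0 xt mulrN; lra.
have sh := sinh_le t0; have lo := sinh_ge t0.
have g0 := sqr_ge0 (expR t - expR (- t)).
have e1 : expR t ^+ 2 = expR x by rewrite -expRM_natl xt.
have ex1 : 1 <= expR x by apply: le_trans (expR_ge1Dx _); rewrite lerDl.
have e2 : expR x - 1 <= x * expR x.
  have h1 := expR_ge1Dx (- x).
  have h2 : expR (- x) * expR x = 1 by rewrite -expRD addNr expR0.
  by have := expR_gt0 x; nra.
have tt0 : 0 <= expR t - expR (- t).
  by rewrite subr_ge0 ler_expR; lra.
have up : (expR t - expR (- t)) ^+ 2 <= x ^+ 2 * expR x.
  by rewrite -e1 -exprMn lerXn2r// ?nnegrE ?mulr_ge0 ?expR_ge0// xt.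
have dn : x ^+ 2 - x ^+ 3 <= (expR t - expR (- t)) ^+ 2.
  have [t2|t2] := leP t 2.
    apply: (@le_trans _ _ ((2 * t - t ^+ 2) ^+ 2)).
      rewrite xt; have := exprn_ge0 3 t0; have := exprn_ge0 4 t0.
      by rewrite !exprS expr0; nra.
    by rewrite lerXn2r// nnegrE expr2; nra.
  by apply: le_trans g0; rewrite subr_le0 exprS ler_peMl ?sqr_ge0//; lra.
rewrite eq1 ler_norml; apply/andP; split.
  have : x ^+ 3 <= x ^+ 3 * expR x by rewrite ler_peMr// exprn_ge0.
  lra.
have : x ^+ 2 * (expR x - 1) <= x ^+ 2 * (x * expR x).
  by apply: ler_wpM2l => //; exact: sqr_ge0.
lra.
Qed.

Lemma le_small_eq0 (a K : R) : (forall t, 0 < t -> t <= 1 -> `|a| <= t * K) -> a = 0.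
Proof.
move=> h; apply/eqP; rewrite -normr_eq0 eq_le normr_ge0 andbT.
apply/ler_addgt0Pl => e e0; rewrite addr0.
have K1 : 0 < `|K| + 1 by rewrite ltr_wpDl.
pose t := Num.min (e / (`|K| + 1)) 1.
have t0 : 0 < t by rewrite lt_min ltr01 divr_gt0.
apply: (le_trans (h t t0 _)); first by rewrite ge_min lexx orbT.
apply: (@le_trans _ _ (t * (`|K| + 1))).
  rewrite ler_pM2l//; have := ler_norm K; lra.
by rewrite -ler_pdivlMr// ge_min lexx.
Qed.

(** Integrated at l s, [cosh_expansion] gives 2 e^(l^2 / 2) - 2 - l^2 v = O(l^3), while 2 e^(l^2 /
    2) - 2 = l^2 + O(l^4); divide by l^2 and let l tend to 0. *)
Lemma normal_var : ex N (fun s => s ^+ 2) = 1.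
Proof.
set v := ex _ _.
pose h (s : R) := `|s| ^+ 3 * (expR (1 * s) + expR (-1 * s)).
have mh : moms N h.
  apply: ubdM; first by apply: ubdX; apply: ubd_norm; exact: moms_id.
  by apply: ubdD; exact: moms_expR.
have m2 : moms N (fun s => s ^+ 2) by apply: ubdX; exact: moms_id.
suff : 1 - v = 0 by lra.
apply: (@le_small_eq0 _ (ex N h + 1)) => l l0 l1.
have mf : moms N (fun s => expR (l * s) + expR (- l * s) - 2 - l ^+ 2 * s ^+ 2).
  apply: ubdB; last exact: ubdZ.
  apply: ubdB; last exact: ubd_cst1.
  by apply: ubdD; exact: moms_expR.
have E : ex N (fun s => expR (l * s) + expR (- l * s) - 2 - l ^+ 2 * s ^+ 2) =
    2 * expR (l ^+ 2 / 2) - 2 - l ^+ 2 * v.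
  rewrite exB; first last.
  - exact: ubdZ.
  - by apply: ubdB; [apply: ubdD; exact: moms_expR|exact: ubd_cst1].
  rewrite exB; first last.
  - exact: ubd_cst1.
  - by apply: ubdD; exact: moms_expR.
  rewrite exD; [|exact: moms_expR|exact: moms_expR].
  rewrite ex_cst (exZ (l ^+ 2) m2) !ex_expR sqrrN -/v; lra.
have b : `|2 * expR (l ^+ 2 / 2) - 2 - l ^+ 2 * v| <= l ^+ 3 * ex N h.
  rewrite -E; apply: le_trans (ex_le_norm mf) _.
  rewrite -exZ//; apply: ex_le; [exact: ubd_norm|exact: ubdZ|].
  move=> s /=; have := cosh_expansion (l * s).
  rewrite -mulNr exprMn => hh; apply: le_trans hh _.
  rewrite /h normrM exprMn (gtr0_norm l0) -mulrA ler_wpM2l ?exprn_ge0 ?(ltW l0)//.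
  rewrite ler_wpM2l ?exprn_ge0// mul1r mulN1r.
  apply: le_trans (expR_abs_le s).
  by rewrite ler_expR ler_piMl.
have l20 : 0 < l ^+ 2 by rewrite exprn_gt0.
have up : expR (l ^+ 2 / 2) <= 1 + l ^+ 2 / 2 + l ^+ 4 / 2.
  have k1 := expR_ge1Dx (- (l ^+ 2 / 2)).
  have k2 : expR (- (l ^+ 2 / 2)) * expR (l ^+ 2 / 2) = 1 by rewrite -expRD addNr expR0.
  have k3 := expR_gt0 (l ^+ 2 / 2).
  have l21 : l ^+ 2 <= 1 by rewrite expr_le1// ltW.
  have -> : l ^+ 4 = l ^+ 2 * l ^+ 2 by rewrite -exprD.
  move: k1 k2 k3 l21 l20; set q := l ^+ 2; set E1 := expR (q / 2); set E2 := expR _.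
  move=> k1 k2 k3 l21 l20.
  have : (1 - q / 2) * E1 <= E2 * E1 by apply: ler_wpM2r => //; exact: ltW.
  rewrite k2.
  have : 1 <= (1 - q / 2) * (1 + q / 2 + q * q / 2) by nra.
  move=> a1 a2; have a3 : 0 < 1 - q / 2 by lra.
  by rewrite -(ler_pM2l a3); lra.
have dn := expR_ge1Dx (l ^+ 2 / 2).
have l43 : l ^+ 4 <= l ^+ 3 by rewrite exprS ler_piMl ?exprn_ge0// ltW.
have c : l ^+ 2 * `|1 - v| <= l ^+ 2 * (l * (ex N h + 1)).
  rewrite -{1}(gtr0_norm l20) -normrM mulrBr mulr1.
  have -> : l ^+ 2 * (l * (ex N h + 1)) = l ^+ 3 * ex N h + l ^+ 3 by ring.
  move: b; rewrite !ler_norml => /andP[b1 b2]; apply/andP; split; lra.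
by rewrite ler_pM2l in c.
Qed.

Lemma normal_var1 : ex N (fun s => s ^+ 2 - 1) = 0.
Proof.
rewrite exB ?normal_var ?ex_cst ?subrr//; last exact: ubd_cst1.
by apply: ubdX; exact: moms_id.
Qed.

(* A regularization of [|x| ^ (-1/2)]. *)
Definition Jf (e x : R) : R := Num.sqrt ((`|x| + e)^-1).

Lemma Jf_ge0 e x : 0 <= Jf e x. Proof. exact: sqrtr_ge0. Qed.

Lemma measurable_sqrt : measurable_fun [set: R] (@Num.sqrt R).
Proof. apply: continuous_measurable_fun; exact: sqrt_continuous. Qed.

Lemma measurable_Jf d (T : measurableType d) e (X : T -> R) : 0 < e ->
  measurable_fun setT X -> measurable_fun setT (fun o => Jf e (X o)).
Proof.
move=> e0 mX; apply: (@measurableT_comp _ _ _ _ _ _ (Jf e)) => //.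
apply: continuous_measurable_fun => x; rewrite /Jf.
apply: (@continuous_comp _ _ _ (fun x => (`|x| + e)^-1) Num.sqrt); last exact: sqrt_continuous.
apply: cvgV; first by rewrite gt_eqF// ltr_wpDl.
by apply: cvgD; [exact: norm_continuous|exact: cvg_cst].
Qed.

(** The sign b = 1 or b = -1 selects the side of the pole c. As b is its own inverse, 2 b sqrt (b (s
    - c) + e) is an antiderivative. *)
Lemma integral_sqrt_inv (b c e x y : R) : b ^+ 2 = 1 -> x < y -> 0 < e ->
  (forall s, x <= s <= y -> 0 <= b * (s - c)) ->
  (\int[mu]_(s in `[x, y]) ((Num.sqrt (b * (s - c) + e))^-1)%:E =
   (2 * b * Num.sqrt (b * (y - c) + e))%:E - (2 * b * Num.sqrt (b * (x - c) + e))%:E)%E.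
Proof.
move=> b2 xy e0 h.
pose F (s : R) := 2 * b * Num.sqrt (b * (s - c) + e).
have cA : continuous (fun s : R => b * (s - c) + e).
  move=> s; apply: cvgD; last exact: cvg_cst.
  by apply: cvgM; [exact: cvg_cst|apply: cvgB; [exact: cvg_id|exact: cvg_cst]].
have cS : continuous (fun s : R => Num.sqrt (b * (s - c) + e)).
  by move=> s; apply: continuous_comp; [exact: cA|exact: sqrt_continuous].
have cF : continuous F by move=> s; apply: cvgM; [exact: cvg_cst|exact: cS].
have dF (s : R) : 0 < b * (s - c) + e -> is_derive s 1 F (Num.sqrt (b * (s - c) + e))^-1.
  move=> s0; have s1 : Num.sqrt (b * (s - c) + e) != 0 by rewrite gt_eqF// sqrtr_gt0.
  have dA : is_derive s 1 (fun s : R => b * (s - c) + e) b.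
    by apply: is_derive_eq; rewrite /GRing.scale/=; ring.
  have dS := @is_derive1_comp _ Num.sqrt (fun s : R => b * (s - c) + e) _ _ _ (is_derive1_sqrt s0) dA.
  have := @is_deriveZ _ _ _ _ (2 * b) _ _ _ dS.
  move=> dS2; apply: (@is_derive_eq _ _ _ _ _ _ _ _ dS2).
  rewrite /GRing.scale/=; transitivity (b ^+ 2 * (Num.sqrt (b * (s - c) + e))^-1); first by field.
  by rewrite b2 mul1r.
have pos s : x <= s <= y -> 0 < b * (s - c) + e by move=> /h; lra.
apply: (@continuous_FTC2 _ _ F) => //.
- apply: continuous_in_subspaceT => s; rewrite inE/= in_itv/= => xsy.
  by apply: cvgV; [rewrite gt_eqF// sqrtr_gt0 pos|exact: cS].
- split; [move=> s|exact/cvg_at_right_filter/cF|exact/cvg_at_left_filter/cF].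
  rewrite in_itv/= => /andP[xs sy].
  by have [] := dF s; rewrite // pos// !ltW.
- move=> s; rewrite in_itv/= => /andP[xs sy]; rewrite derive1E.
  by apply: (@derive_val _ _ _ _ _ _ _ (dF s _)); rewrite pos// !ltW.
Qed.

Lemma Jf_sub c e s : 0 < e -> Jf e (s - c) = (Num.sqrt (`|s - c| + e))^-1.
Proof. by move=> e0; rewrite /Jf sqrtrV// ?addr_ge0// ltW. Qed.

(** The integral equals 2 (sqrt (1 + e) - sqrt e), which is at most 2 whatever e is: the local
    integrability of |x|^(-1/2), uniformly in the regularization. *)
Lemma integral_Jf_half (b c e : R) : b ^+ 2 = 1 -> 0 < e ->
  let A := (if b == 1 then `[c, c + 1] else `[c - 1, c])%classic in
  (\int[mu]_(s in A) (Jf e (s - c))%:E <= 2%:E)%E.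
Proof.
move=> b2 e0 /=.
have sq : Num.sqrt (1 + e) <= 1 + Num.sqrt e.
  rewrite -[leRHS]ger0_norm ?addr_ge0 ?sqrtr_ge0// -sqrtr_sqr ler_wsqrtr//.
  have s2 : Num.sqrt e ^+ 2 = e by rewrite sqr_sqrtr// ltW.
  have := sqrtr_ge0 e; nra.
case: ifPn => b1.
- have -> : (\int[mu]_(s in `[c, (c + 1)%R]) (Jf e (s - c))%:E = \int[mu]_(s in `[c, (c + 1)%R]) ((Num.sqrt (1 * (s - c) + e))^-1)%R%:E)%E.
    apply: eq_integral => s; rewrite inE/= in_itv/= => /andP[cs _].
    by rewrite Jf_sub// mul1r ger0_norm// subr_ge0.
  rewrite (@integral_sqrt_inv 1 c e c (c + 1))//; first last.
  - by move=> s /andP[cs _]; rewrite mul1r subr_ge0.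
  - by rewrite ltrDl.
  - by rewrite expr1n.
  have -> : 1 * (c + 1 - c) + e = 1 + e by ring.
  have -> : 1 * (c - c) + e = e by ring.
  by rewrite -EFinB lee_fin; lra.
- have -> : (\int[mu]_(s in `[(c - 1)%R, c]) (Jf e (s - c))%:E = \int[mu]_(s in `[(c - 1)%R, c]) ((Num.sqrt (-1 * (s - c) + e))^-1)%R%:E)%E.
    apply: eq_integral => s; rewrite inE/= in_itv/= => /andP[_ cs].
    by rewrite Jf_sub// mulN1r ler0_norm// subr_le0.
  rewrite (@integral_sqrt_inv (-1) c e (c - 1) c)//; first last.
  - by move=> s /andP[_ cs]; rewrite mulN1r oppr_ge0 subr_le0.
  - by rewrite ltrBlDr ltrDl.
  - by rewrite sqrrN expr1n.
  have -> : -1 * (c - 1 - c) + e = 1 + e by ring.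
  have -> : -1 * (c - c) + e = e by ring.
  by rewrite -EFinB lee_fin; lra.
Qed.

(** Within distance 1 of the pole c the Gaussian density is bounded by its peak, and farther away
    [Jf] is at most 1; neither bound sees c or e. *)
Lemma normal_Jf_shift : exists2 C : R, 0 < C & forall c e, 0 < e ->
  (\int[N]_s (Jf e (s - c))%:E <= C%:E)%E.
Proof.
pose pk : R := normal_peak 1.
have pk0 : 0 <= pk by exact: normal_peak_ge0.
exists (1 + pk * 2 + pk * 2) => [|c e e0]; first by lra.
pose h s := Jf e (s - c).
have mh : measurable_fun [set: R] h by apply: measurable_Jf => //; exact: measurable_funB.
pose A1 := `[c, c + 1]%classic; pose A2 := `[c - 1, c]%classic.
have mA1 : measurable A1 by exact: measurable_itv.
have mA2 : measurable A2 by exact: measurable_itv.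
pose h1 := h \_ A1; pose h2 := h \_ A2.
have mr A : measurable A -> measurable_fun [set: R] (h \_ A).
  by move=> mA; apply/measurable_restrict => //; rewrite setTI; exact: measurable_funS mh.
have r0 A s : 0 <= (h \_ A) s by rewrite patchE; case: ifP => // _; exact: Jf_ge0.
have bnd A : measurable A -> (\int[mu]_(s in A) (h s)%:E <= 2%:E)%E ->
    (\int[N]_s ((h \_ A) s)%:E <= (pk * 2)%:E)%E.
  move=> mA hA; rewrite ge0_integral_normal//; last exact: mr.
  apply: (@le_trans _ _ (\int[mu]_s (pk%:E * ((h \_ A) s)%:E))%E).
    apply: ge0_le_integral => //.
    - by move=> s _; rewrite lee_fin mulr_ge0// normal_pdf_ge0.
    - apply/measurable_EFinP; apply: measurable_funM; first exact: mr.
      exact: measurable_normal_pdf.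
    - by apply: measurable_funeM; apply/measurable_EFinP; exact: mr.
    - move=> s _; rewrite -EFinM lee_fin mulrC ler_wpM2r// normal_pdf_ub//.
  rewrite ge0_integralZl//; first last.
  - by move=> s _; rewrite lee_fin.
  - by apply/measurable_EFinP; exact: mr.
  rewrite EFinM lee_wpmul2l ?lee_fin//.
  rewrite [leLHS](_ : _ = \int[mu]_(s in A) (h s)%:E)%E// [RHS]integral_mkcond.
  by apply: eq_integral => s _; rewrite !patchE; case: ifP.
apply: (@le_trans _ _ (\int[N]_s ((1 : R)%:E + (h1 s)%:E + (h2 s)%:E))%E).
  apply: ge0_le_integral => //.
  - by move=> s _; rewrite lee_fin Jf_ge0.
  - exact/measurable_EFinP.
  - apply: emeasurable_funD; last by apply/measurable_EFinP; exact: mr.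
    by apply: emeasurable_funD => //; apply/measurable_EFinP; exact: mr.
  move=> s _; rewrite -!EFinD lee_fin.
  have h10 : 0 <= h1 s by exact: r0.
  have h20 : 0 <= h2 s by exact: r0.
  have [s1|s1] := boolP (s \in A1).
    by rewrite {1}/h1 patchE s1 -/(h s); lra.
  have [s2|s2] := boolP (s \in A2).
    by rewrite {1}/h2 patchE s2 -/(h s); lra.
  suff : Jf e (s - c) <= 1 by lra.
  rewrite -(sqrtr1 R) ler_wsqrtr// invf_le1 ?ltr_wpDl//.
  suff : 1 <= `|s - c| by lra.
  move: s1 s2; rewrite !mem_setE !in_itv/= !negb_and -!ltNge => /orP s1 /orP s2.
  by have [sc|sc] := leP c s; [rewrite ger0_norm ?subr_ge0|rewrite ltr0_norm ?subr_lt0];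
    case: s1 => ?; case: s2 => ?; lra.
have h1_0 s : 0 <= h1 s by exact: r0.
have h2_0 s : 0 <= h2 s by exact: r0.
have mh1 : measurable_fun [set: R] (EFin \o h1) by apply/measurable_EFinP; exact: mr.
have mh2 : measurable_fun [set: R] (EFin \o h2) by apply/measurable_EFinP; exact: mr.
rewrite ge0_integralD//; try by move=> s _; rewrite ?lee_fin ?addr_ge0.
  rewrite ge0_integralD//; try by move=> s _; rewrite lee_fin.
  rewrite integral_prob_cst 2!EFinD; apply: leeD; [apply: leeD => //|]; apply: bnd => //.
  - by have := @integral_Jf_half 1 c e (expr1n _ _) e0; rewrite eqxx.
  - have := @integral_Jf_half (-1) c e _ e0; rewrite ifF; last by apply/negbTE; rewrite eq_sym -subr_eq0 opprK; lra.
    by apply; rewrite sqrrN expr1n.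
by apply: emeasurable_funD.
Qed.

(** If |a| <= e, then [Jf e a] is at least half of e^(-1/2), the maximum of [Jf e]. If |a| > e,
    dividing by a turns the integrand into |a|^(-1/2) times a shifted [Jf] with parameter e / |a|.
    The regularization keeps the bound meaningful at a = 0. *)
Lemma normal_Jf : exists2 C : R, 0 < C & forall a b e, 0 < e ->
  (\int[N]_s (Jf e (a * s + b))%:E <= (C * Jf e a)%:E)%E.
Proof.
have [C C0 hC] := normal_Jf_shift.
exists (2 + 2 * C) => [|a b e e0]; first by lra.
have ae0 : 0 < `|a| + e by rewrite ltr_wpDl.
have J0 := Jf_ge0 e a.
have two (u y : R) : 0 < u -> 0 < y -> y <= 4 * u -> Num.sqrt u^-1 <= 2 * Num.sqrt y^-1.
  move=> u0 y0 yu; rewrite -[X in X * _](@ger0_norm R 2)// -sqrtr_sqr -sqrtrM ?sqr_ge0// ler_wsqrtr//.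
  have -> : (2 : R) ^+ 2 = 4 by rewrite expr2; lra.
  by rewrite ler_pdivlMr// mulrC ler_pdivrMr.
have [ae|ae] := leP `|a| e.
  apply: (@le_trans _ _ (\int[N]_s (2 * Jf e a)%:E)%E); last first.
    by rewrite integral_prob_cst lee_fin ler_wpM2r//; lra.
  apply: ge0_le_integral => //.
  - by move=> s _; rewrite lee_fin Jf_ge0.
  - by apply/measurable_EFinP; apply: measurable_Jf => //; apply: measurable_funD => //; exact: measurable_funM.
  move=> s _; rewrite lee_fin; apply: (@le_trans _ _ (Num.sqrt e^-1)); last first.
    by apply: two => //; lra.
  by rewrite ler_wsqrtr// lef_pV2 ?posrE// ?lerDr// ltr_wpDl.
have a0 : 0 < `|a| by exact: lt_trans ae.
have an0 : a != 0 by rewrite -normr_gt0.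
pose c := - b / a.
have E s : Jf e (a * s + b) = Num.sqrt `|a|^-1 * Jf (e / `|a|) (s - c).
  rewrite /Jf -sqrtrM ?invr_ge0// -invfM; congr (Num.sqrt (_^-1)).
  rewrite mulrDr -normrM mulrCA divff ?gt_eqF// mulr1; congr (`|_| + _).
  by rewrite /c; field.
under eq_integral do rewrite E EFinM.
have e'0 : 0 < e / `|a| by rewrite divr_gt0.
rewrite ge0_integralZl//; first last.
- by move=> s _; rewrite lee_fin Jf_ge0.
- by apply/measurable_EFinP; apply: measurable_Jf => //; exact: measurable_funB.
apply: (@le_trans _ _ ((Num.sqrt `|a|^-1)%:E * C%:E)%E).
  by apply: lee_wpmul2l; [rewrite lee_fin|exact: hC].
rewrite -EFinM lee_fin; have := two `|a| (`|a| + e) a0 ae0 _.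
rewrite -/(Jf e a) => /(_ _) h; have {}h := h ltac:(lra).
nra.
Qed.
End gauss1.

(** * Families of independent standard Gaussian coordinates *)

Section gauss_family.
Context d (T : measurableType d) (R : realType).
Variable P : probability T R.
Context (K : eqType).
Variable g : K -> T -> R.
Local Notation N := (@normal_prob R 0 1).

Definition gens (k : K) : set (set T) :=
  \bigcup_(l in [set l | l != k]) preimage_set_system [set: T] (g l) measurable.

(** Independence is stated as one coordinate against the sigma-algebra of all the others, the form
    in which Fubini's theorem is applied. *)
Definition gauss_family := (forall k, measurable_fun [set: T] (g k)) /\
  forall k E (B : set R), <<s gens k >> E -> measurable B ->
    P (E `&` g k @^-1` B) = (P E * N B)%E.

(* [X] does not depend on the coordinate [g k]. *)
Definition free (k : K) (X : T -> R) := gmeas (gens k) X.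

Hypothesis gf : gauss_family.

Lemma gauss_meas k : measurable_fun [set: T] (g k). Proof. by case: gf. Qed.

Lemma gens_measurable k E : <<s gens k >> E -> measurable E.
Proof.
apply: smallest_sub; first exact: sigma_algebra_measurable.
move=> _ [l _ [B mB <-]]; exact: (gauss_meas l).
Qed.

Lemma free_meas k X : free k X -> measurable_fun [set: T] X.
Proof. by apply: gmeasW; exact: gens_measurable. Qed.

Lemma free_gauss k l : l != k -> free k (g l).
Proof.
move=> lk _ B mB; apply: sub_sigma_algebra; exists l => //.
by exists B.
Qed.

Lemma free_cst k c : free k (fun=> c).
Proof. exact: measurable_cst. Qed.

Lemma freeD k X Y : free k X -> free k Y -> free k (fun o => X o + Y o).
Proof. by move=> fX fY; apply: measurable_funD. Qed.

Lemma freeM k X Y : free k X -> free k Y -> free k (fun o => X o * Y o).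
Proof. by move=> fX fY; apply: measurable_funM. Qed.

Lemma freeX k X n : free k X -> free k (fun o => X o ^+ n).
Proof. by move=> fX; apply: measurable_funX. Qed.

Lemma free_ext k X Y : free k X -> (forall o, X o = Y o) -> free k Y.
Proof. by move=> fX XY; have <- : X = Y by apply/funext. Qed.

Lemma free_sum k J (r : seq J) (Q : pred J) (F : J -> T -> R) :
  (forall j, Q j -> free k (F j)) -> free k (fun o => \sum_(j <- r | Q j) F j o).
Proof.
move=> fF; elim: r => [|j r IH].
  by apply: (free_ext (@free_cst k 0)) => o; rewrite big_nil.
have [Qj|Qj] := boolP (Q j).
  by apply: (free_ext (freeD (fF _ Qj) IH)) => o; rewrite big_cons Qj.
by apply: (free_ext IH) => o; rewrite big_cons (negbTE Qj).
Qed.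

Lemma free_prod k J (r : seq J) (Q : pred J) (F : J -> T -> R) :
  (forall j, Q j -> free k (F j)) -> free k (fun o => \prod_(j <- r | Q j) F j o).
Proof.
move=> fF; elim: r => [|j r IH].
  by apply: (free_ext (@free_cst k 1)) => o; rewrite big_nil.
have [Qj|Qj] := boolP (Q j).
  by apply: (free_ext (freeM (fF _ Qj) IH)) => o; rewrite big_cons Qj.
by apply: (free_ext IH) => o; rewrite big_cons (negbTE Qj).
Qed.

Lemma free_Jf k e X : 0 < e -> free k X -> free k (fun o => Jf e (X o)).
Proof. by move=> e0; apply: measurable_Jf. Qed.

Lemma gauss_ge0 k (Y : T -> R) (f : R -> R) : free k Y -> (forall o, 0 <= Y o) ->
  measurable_fun [set: R] f -> (forall s, 0 <= f s) ->
  (\int[P]_o (Y o * f (g k o))%:E = (\int[P]_o (Y o)%:E) * \int[N]_s (f s)%:E)%E.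
Proof.
move=> fY Y0 mf f0; apply: (indep_ge0 (G := gens k)) => //.
- exact: gens_measurable.
- exact: gauss_meas.
- by case: gf => _; exact.
Qed.

Lemma ubd_gauss (I : Type) (h : I -> K) (f : R -> R) : moms N f ->
  ubd P (fun i o => f (g (h i) o)).
Proof.
move=> bf'; have bf := ubdE bf'; have mf := fun i => ubd_meas i bf'.
apply: ubdI => [i|p].
  by apply: measurableT_comp; [exact: mf tt|exact: gauss_meas].
have [C hC] := bf p; exists C => i.
have := @gauss_ge0 (h i) (fun=> 1) (fun s => `|f s| ^+ p) (@free_cst _ _).
move=> /(_ (fun=> ler01)) e.
under eq_integral do rewrite -[_ ^+ p]mul1r.
rewrite e//.
- by rewrite integral_prob_cst mul1e; exact: hC tt.
- by apply: measurable_funX; apply: measurableT_comp => //; exact: mf tt.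
Qed.

Lemma ubd_gauss1 : ubd P g.
Proof. exact: (@ubd_gauss K id id (moms_id R)). Qed.

Lemma moms_gauss k (f : R -> R) : moms N f -> moms P (fun o => f (g k o)).
Proof. exact: (@ubd_gauss unit (fun=> k)). Qed.

Lemma ex_gauss k (Y : T -> R) (f : R -> R) : free k Y -> moms P Y -> moms N f ->
  ex P (fun o => Y o * f (g k o)) = ex P Y * ex N f.
Proof.
move=> fY mY mf; apply: (indep_ex (G := gens k)) => //.
- exact: gens_measurable.
- exact: gauss_meas.
- by case: gf => _; exact.
- exact: moms_gauss.
Qed.

(* Integrating out the coordinate [g k] replaces an affine function of it by its
   slope; iterated on [Dm_recr], this bounds the singular moments of determinants. *)
Lemma peel : exists2 C : R, 0 < C & forall k e (Y a b : T -> R), 0 < e ->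
  free k Y -> free k a -> free k b -> (forall o, 0 <= Y o) ->
  (\int[P]_o (Y o * Jf e (a o * g k o + b o))%:E <=
   C%:E * \int[P]_o (Y o * Jf e (a o))%:E)%E.
Proof.
have [C C0 hC] := normal_Jf R; exists C => // k e Y a b e0 fY fa fb Y0.
pose phi (z : g_sigma_algebraType (gens k) * measurableTypeR R) : \bar R :=
  (Y z.1 * Jf e (a z.1 * z.2 + b z.1))%:E.
have := @fubini_subsigma _ T R P (gens k) (g k) (@gens_measurable k) (gauss_meas k) _ phi.
rewrite /phi/= => ->; first last.
- by move=> z; rewrite lee_fin mulr_ge0// Jf_ge0.
- apply/measurable_EFinP; apply: measurable_funM.
    exact: (measurableT_comp fY measurable_fst).
  apply: measurable_Jf => //; apply: measurable_funD.
    apply: measurable_funM; last exact: measurable_snd.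
    exact: (measurableT_comp fa measurable_fst).
  exact: (measurableT_comp fb measurable_fst).
- by case: gf => _; exact.
have mJa : measurable_fun setT (fun o => (Y o * Jf e (a o))%:E).
  by apply/measurable_EFinP; apply: measurable_funM; [exact: free_meas fY|
    apply: measurable_Jf => //; exact: free_meas fa].
rewrite -ge0_integralZl//; first last.
- by rewrite lee_fin ltW.
- by move=> o _; rewrite lee_fin mulr_ge0// Jf_ge0.
apply: ge0_le_integral => //.
- by move=> o _; apply: integral_ge0 => s _; rewrite lee_fin mulr_ge0// Jf_ge0.
- have mphi : measurable_fun setT phi.
    apply/measurable_EFinP; apply: measurable_funM.
      exact: (measurableT_comp fY measurable_fst).
    apply: measurable_Jf => //; apply: measurable_funD.
      apply: measurable_funM; last exact: measurable_snd.
      exact: (measurableT_comp fa measurable_fst).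
    exact: (measurableT_comp fb measurable_fst).
  have phi0 z : (0 <= phi z)%E by rewrite lee_fin mulr_ge0// Jf_ge0.
  have := @measurable_fun_fubini_tonelli_F _ _ _ _ _ N phi mphi phi0.
  move=> h; have := measurableT_comp h (id_subsigma_measurable (@gens_measurable k)).
  exact.
- exact: measurable_funeM.
move=> o _.
under eq_integral do rewrite EFinM.
rewrite ge0_integralZl//=.
- apply: (@le_trans _ _ ((Y o)%:E * (C * Jf e (a o))%:E)%E).
    by apply: lee_wpmul2l; [rewrite lee_fin|exact: hC].
  by rewrite -!EFinM lee_fin mulrCA.
- by apply/measurable_EFinP; apply: measurable_Jf => //; apply: measurable_funD => //;
    exact: measurable_funM.
- by move=> s _; rewrite lee_fin Jf_ge0.
- by rewrite lee_fin.
Qed.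

End gauss_family.

(** * Moments of normalized martingale sums *)

Section martingale.
Context (R : realType).

(** If |x| <= r |y| the second term dominates, as r >= 1 and j >= 2; otherwise the first one does.
    The weights are such that for r^2 = n the power of x has coefficient 1 / n. *)
Lemma young_term (x y r : R) k j : 1 <= r -> (2 <= j)%N -> (j <= 2 * k)%N ->
  `|x| ^+ (2 * k - j) * `|y| ^+ j <=
  r ^- 2 * x ^+ (2 * k) + r ^+ (2 * k - 2) * y ^+ (2 * k).
Proof.
move=> r1 j2 jk.
have r0 : 0 < r by apply: lt_le_trans r1.
have ev (z : R) : z ^+ (2 * k) = `|z| ^+ (2 * k).
  by rewrite !exprM real_normK ?num_real.
rewrite (ev x) (ev y); move: (normr_ge0 x) (normr_ge0 y).
move: `|x| `|y| => X Y X0 Y0.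
have [xy|xy] := leP X (r * Y).
  apply: (@le_trans _ _ (r ^+ (2 * k - 2) * Y ^+ (2 * k))); last first.
    by rewrite lerDr mulr_ge0 ?invr_ge0 ?exprn_ge0// ltW.
  apply: (@le_trans _ _ ((r * Y) ^+ (2 * k - j) * Y ^+ j)).
    by rewrite ler_wpM2r ?exprn_ge0// lerXn2r// nnegrE// mulr_ge0// ltW.
  rewrite exprMn -mulrA -exprD subnK// ler_wpM2r ?exprn_ge0//.
  by apply: ler_weXn2l => //; lia.
apply: (@le_trans _ _ (r ^- 2 * X ^+ (2 * k))); last first.
  by rewrite lerDl mulr_ge0 ?exprn_ge0// ltW.
rewrite ler_pdivlMl ?exprn_gt0// mulrCA -{2}(subnK jk) exprD.
rewrite ler_wpM2l ?exprn_ge0//.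
apply: (@le_trans _ _ ((r * Y) ^+ j)); last first.
  by apply: lerXn2r; rewrite ?nnegrE ?mulr_ge0// ltW.
by rewrite exprMn ler_wpM2r ?exprn_ge0//; apply: ler_weXn2l.
Qed.

(** The term linear in y is kept apart because its expectation will vanish; the others obey
    [young_term], and 2^(2k) is the sum of all binomial coefficients. *)
Lemma binomial_even (x y r : R) k : 1 <= r -> (0 < k)%N ->
  (x + y) ^+ (2 * k) <= x ^+ (2 * k) + (2 * k)%:R * (x ^+ (2 * k - 1) * y) +
   (2 ^+ (2 * k)) * (r ^- 2 * x ^+ (2 * k) + r ^+ (2 * k - 2) * y ^+ (2 * k)).
Proof.
move=> r1 k0; set Z := (_ * _ + _ * _ in X in _ <= X).
have r0 : 0 < r by apply: lt_le_trans r1.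
have Z0 : 0 <= Z.
  have k2 : ~~ odd (2 * k) by rewrite mul2n odd_double.
  by apply: addr_ge0; apply: mulr_ge0; rewrite ?invr_ge0; first
    [by apply: exprn_even_ge0|by apply: exprn_ge0; exact: ltW].
rewrite exprDn.
have E : (2 * k).+1 = (2 * k - 2 + 1 + 1).+1 by lia.
rewrite (eq_bigr (fun i : 'I_(2 * k).+1 => (fun i => x ^+ (2 * k - i) * y ^+ i *+ 'C(2 * k, i)) (i : nat)))//.
rewrite -(big_mkord xpredT (fun i => x ^+ (2 * k - i) * y ^+ i *+ 'C(2 * k, i))).
rewrite big_ltn// big_ltn; last by lia.
rewrite subn0 expr0 mulr1 bin0 mulr1n expr1 bin1 addrA lerD//.
  by rewrite mulr_natl.
apply: (@le_trans _ _ (\sum_(2 <= i < (2 * k).+1) Z *+ 'C(2 * k, i))).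
  rewrite !big_nat; apply: ler_sum => i /andP[i2 ik].
  rewrite lerMn2r; apply/orP; right.
  apply: le_trans (young_term x y r1 i2 _); last by lia.
  by rewrite -!normrX -normrM ler_norm.
have -> : (2 ^+ (2 * k) : R) = \sum_(0 <= i < (2 * k).+1) ('C(2 * k, i))%:R.
  have -> : (2 : R) = 1 + 1 by [].
  by rewrite exprDn big_mkord; apply: eq_bigr => i _; rewrite !expr1n mul1r.
rewrite mulr_suml [leRHS]big_ltn// [in leRHS]big_ltn; last by lia.
rewrite addrA; apply: (@le_trans _ _ (\sum_(2 <= i < (2 * k).+1) 'C(2 * k, i)%:R * Z)).
  by apply: ler_sum => i _; rewrite mulr_natl.
by rewrite lerDr addr_ge0// mulr_ge0.
Qed.

Context d (T : measurableType d).
Variable P : probability T R.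
Context (K : eqType) (g : K -> T -> R).
Local Notation N := (@normal_prob R 0 1).
Hypothesis gf : gauss_family P g.

(* With S_t the partial sums and r^2 = n, [binomial_even] gives
   E S_(t+1)^(2k) <= (1 + D / n) E S_t^(2k) + O(n^(k - 1)) for t < n, since the
   term linear in the increment has mean zero. *)
Lemma martingale_ubd (c : nat -> T -> R) (f : R -> R) (kap : nat -> K) :
  moms N f -> ex N f = 0 -> ubd P c ->
  (forall t s, (s <= t)%N -> free g (kap t) (c s)) ->
  (forall t s, (s < t)%N -> kap s != kap t) ->
  ubd P (fun n o => (Num.sqrt n%:R)^-1 * \sum_(0 <= t < n) c t o * f (g (kap t) o)).
Proof.
move=> mf f0 bc fc inj.
pose X t o := c t o * f (g (kap t) o).
have bX : ubd P X by apply: ubdM => //; exact: (ubd_gauss gf).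
pose S t o := \sum_(0 <= s < t) X s o.
have mS t : moms P (S t) by apply: moms_sum => s _; exact: ubd_moms bX.
have mSc t : moms P (fun o => (Num.sqrt t%:R)^-1 * S t o) by apply: ubdZ; exact: mS.
have mSj t j : moms P (fun o => S t o ^+ j) by apply: ubdX; exact: mS.
have fS t : free g (kap t) (S t).
  apply: (@free_ext _ _ _ _ _ _ (fun o => \sum_(0 <= s < t | (s < t)%N) X s o)).
    apply: free_sum => s st; apply: freeM; first by apply: fc; exact: ltnW.
    by apply: (measurableT_comp (ubd_meas tt mf)); apply: free_gauss; exact: inj.
  by move=> o; rewrite /S big_nat_cond [RHS]big_nat_cond; apply: eq_bigl => s; rewrite leq0n andbb andbT.
apply: ubd_ex1 => [n|p]; first exact: (ubd_meas tt (mSc n)).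
have [M hM] := ubd_ex (ubdX (2 * p.+1) bX).
have M0 : 0 <= M by exact: le_trans (hM 0%N).
(* The moment of order p is controlled through the even order 2k, by |y|^p <= 1 + y^(2k); k = p + 1
   is positive even for p = 0. *)
set k := p.+1 in hM; pose D : R := 2 ^+ (2 * k).
have D0 : 0 <= D by rewrite exprn_ge0.
exists (1 + D * M * expR D) => n; split; first exact: mSc.
have [->|n0] := posnP n.
  rewrite (_ : (fun o => _) = fun=> (0 : R) ^+ p).
    rewrite ex_cst; apply: (@le_trans _ _ 1).
      by rewrite expr0n; case: (p == 0%N).
    by rewrite lerDl !mulr_ge0// expR_ge0.
  by apply/funext => o; rewrite big_geq// mulr0 normr0.
pose r := Num.sqrt (n%:R : R).
have r1 : 1 <= r by rewrite -(sqrtr1 R) ler_wsqrtr// ler1n.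
have r0 : 0 < r by apply: lt_le_trans r1.
have r2 : r ^+ 2 = n%:R by rewrite sqr_sqrtr.
pose a t := ex P (fun o => S t o ^+ (2 * k)).
have step t : a t.+1 <= (1 + D / n%:R) * a t + D * r ^+ (2 * k - 2) * M.
  have ecross : ex P (fun o => S t o ^+ (2 * k - 1) * X t o) = 0.
    rewrite (_ : (fun o => _) = (fun o => (S t o ^+ (2 * k - 1) * c t o) * f (g (kap t) o))).
      rewrite (ex_gauss gf)//; first by rewrite f0 mulr0.
        by apply: freeM; [exact: freeX|exact: fc].
      by apply: ubdM; [apply: ubdX; exact: mS|exact: (ubd_moms t bc)].
    by apply/funext => o; rewrite mulrA.
  have mXt := ubd_moms t bX.
  have m1 := mSj t (2 * k)%N.
  have m2 : moms P (fun o => S t o ^+ (2 * k - 1) * X t o) by apply: ubdM => //; exact: mSj.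
  have m3 : moms P (fun o => X t o ^+ (2 * k)) by exact: ubdX.
  apply: (@le_trans _ _ (ex P (fun o => (1 + D / n%:R) * S t o ^+ (2 * k) +
     (2 * k)%:R * (S t o ^+ (2 * k - 1) * X t o) + (D * r ^+ (2 * k - 2)) * X t o ^+ (2 * k)))).
    apply: ex_le => [||o].
    - exact: mSj.
    - by apply: ubdD; [apply: ubdD|]; exact: ubdZ.
    rewrite /S big_nat_recr//= -/(S t o).
    apply: le_trans (binomial_even (S t o) (X t o) r1 (ltn0Sn p)) _.
    rewrite -/k -/D r2 le_eqVlt; apply/orP; left; apply/eqP; ring.
  rewrite exD; [|by apply: ubdD; exact: ubdZ|exact: ubdZ].
  rewrite exD; [|exact: ubdZ|exact: ubdZ].
  rewrite !exZ// ecross mulr0 addr0 lerD2l ler_wpM2l ?mulr_ge0 ?exprn_ge0 ?(ltW r0)//.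
  by apply: le_trans (hM t); exact: ler_norm.
have q1 : 1 <= 1 + D / n%:R by rewrite lerDl divr_ge0.
have bnd t : a t <= t%:R * (1 + D / n%:R) ^+ t * (D * r ^+ (2 * k - 2) * M).
  elim: t => [|t IH].
    rewrite !mul0r /a (_ : (fun o => _) = fun=> 0) ?ex_cst//.
    by apply/funext => o; rewrite /S big_geq// expr0n.
  apply: le_trans (step t) _.
  have B0 : 0 <= D * r ^+ (2 * k - 2) * M by rewrite !mulr_ge0// exprn_ge0// ltW.
  apply: (@le_trans _ _ ((1 + D / n%:R) * (t%:R * (1 + D / n%:R) ^+ t * (D * r ^+ (2 * k - 2) * M)) +
     (1 + D / n%:R) ^+ t.+1 * (D * r ^+ (2 * k - 2) * M))).
    apply: lerD; first by rewrite ler_wpM2l//; lra.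
    by rewrite ler_peMl// exprn_ege1.
  rewrite le_eqVlt; apply/orP; left; apply/eqP.
  by rewrite -natr1 exprS; ring.
have an : a n <= r ^+ (2 * k) * (D * M * expR D).
  apply: le_trans (bnd n) _.
  have e1 : (1 + D / n%:R) ^+ n <= expR D.
    apply: (@le_trans _ _ (expR (D / n%:R) ^+ n)).
      by rewrite lerXn2r ?nnegrE ?expR_ge0 ?expR_ge1Dx//; lra.
    by rewrite -expRM_natr divfK// pnatr_eq0 -lt0n.
  have -> : r ^+ (2 * k) = n%:R * r ^+ (2 * k - 2).
    by rewrite -r2 -exprD; congr (_ ^+ _); lia.
  rewrite -!mulrA ler_wpM2l//.
  rewrite [leRHS](_ : _ = expR D * (D * (r ^+ (2 * k - 2) * M))); last by ring.
  by rewrite ler_wpM2r// !mulr_ge0// exprn_ge0// ltW.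
apply: (@le_trans _ _ (ex P (fun o => 1 + r ^- (2 * k) * S n o ^+ (2 * k)))).
  apply: ex_le.
  - by apply: ubdX; apply: ubd_norm; exact: mSc.
  - apply: ubdD; first exact: ubd_cst1.
    by apply: ubdZ; exact: mSj.
  move=> o; rewrite -/(S n o) -/r -exprVn -exprMn; set y := _ * _.
  have -> : y ^+ (2 * k) = `|y| ^+ (2 * k) by rewrite !exprM real_normK ?num_real.
  have [y1|y1] := leP `|y| 1.
    by apply: (@le_trans _ _ 1); [rewrite exprn_ile1|rewrite lerDl exprn_ge0].
  apply: (@le_trans _ _ (`|y| ^+ (2 * k))); last by rewrite lerDr.
  by apply: ler_weXn2l; [exact: ltW|rewrite /k; lia].
rewrite exD; [|exact: ubd_cst1|by apply: ubdZ; exact: mSj].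
rewrite ex_cst exZ; last exact: mSj.
by rewrite lerD2l ler_pdivrMl ?exprn_gt0.
Qed.

End martingale.

(** * A small-ball estimate for determinants *)

Section smallball.
Context (R : realType).

(** The inverse is discontinuous at 0, where it takes the default value 0. The continuous functions
    x / (x^2 + 1 / (n + 1)) vanish there too and converge to it pointwise. *)
Lemma measurable_invR : measurable_fun [set: R] (fun x : R => x^-1).
Proof.
apply: (@measurable_fun_cvg _ (measurableTypeR R) R setT (fun n x => x * (x ^+ 2 + n.+1%:R^-1)^-1) (fun x => x^-1)).
  move=> n; apply: continuous_measurable_fun => x.
  have x0 : 0 < x ^+ 2 + n.+1%:R^-1 by rewrite ltr_wpDl ?sqr_ge0 ?invr_gt0.
  apply: cvgM; first exact: cvg_id.
  apply: cvgV; first by rewrite gt_eqF.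
  by apply: cvgD; [exact: exprn_continuous|exact: cvg_cst].
move=> x _; have [->|x0] := eqVneq x 0.
  rewrite invr0; apply: cvg_near_cst; apply: nearW => n; by rewrite mul0r.
have -> : x^-1 = x * (x ^+ 2 + 0)^-1 by rewrite addr0; field.
apply: cvgM; first exact: cvg_cst.
apply: cvgV; first by rewrite addr0 expf_eq0.
by apply: cvgD; [exact: cvg_cst|exact: cvg_harmonic].
Qed.

Lemma measurable_fun_inv d (T : measurableType d) (X : T -> R) :
  measurable_fun setT X -> measurable_fun setT (fun o => (X o)^-1).
Proof. exact: (measurableT_comp measurable_invR). Qed.

Lemma measurable_fun_sqrt d (T : measurableType d) (X : T -> R) :
  measurable_fun setT X -> measurable_fun setT (fun o => Num.sqrt (X o)).
Proof.
move=> mX; apply: (@measurableT_comp _ _ _ _ _ _ (@Num.sqrt R)) => //.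
exact: measurable_sqrt.
Qed.

Lemma prodr_ge1 (F : nat -> R) m : (forall r, 1 <= F r) -> 1 <= \prod_(0 <= r < m) F r.
Proof.
move=> F1; elim: m => [|m IH]; first by rewrite big_geq.
rewrite big_nat_recr//=; apply: (le_trans IH).
by rewrite ler_peMr// (le_trans _ IH).
Qed.

Lemma inv_pow_ge1D (x : R) p : 0 < x -> 1 + p%:R * (1 - x) <= x^-1 ^+ p.
Proof.
move=> x0; have y0 : 0 < x^-1 by rewrite invr_gt0.
have h1 : 1 - x <= x^-1 - 1.
  have e : x * x^-1 = 1 by rewrite divff// gt_eqF.
  have := sqr_ge0 (x - 1); rewrite -(pmulr_rge0 _ y0) => h; nra.
suff bern (y : R) : 0 < y -> 1 + p%:R * (y - 1) <= y ^+ p.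
  by apply: le_trans (bern _ y0); rewrite lerD2l ler_wpM2l.
move=> {x0 y0 h1} y0; elim: p => [|p IH]; first by rewrite mul0r addr0 expr0.
rewrite exprS; apply: (@le_trans _ _ (y * (1 + p%:R * (y - 1)))).
  by rewrite -natr1; have := sqr_ge0 (y - 1); have : 0 <= p%:R :> R by []; nra.
by rewrite ler_wpM2l// ltW.
Qed.

(* Jensen's inequality for [x ^- p], from the tangent lines of [inv_pow_ge1D] *)
Lemma mean_inv_pow (n p : nat) (s : nat -> R) : (0 < n)%N -> (forall b, 0 < s b) ->
  (n%:R / \sum_(0 <= b < n) s b) ^+ p <= n%:R^-1 * \sum_(0 <= b < n) (s b)^-1 ^+ p.
Proof.
move=> n0 s0; have n0R : 0 < n%:R :> R by rewrite ltr0n.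
set sg := \sum_(0 <= b < n) s b.
have sg0 : 0 < sg.
  rewrite /sg; case: n n0 {n0R sg} => // n _; rewrite big_nat_recl//.
  by rewrite ltr_pwDl// sumr_ge0// => i _; exact: ltW.
pose m := sg / n%:R; have m0 : 0 < m by rewrite divr_gt0.
have -> : n%:R / sg = m^-1 by rewrite /m invf_div.
rewrite ler_pdivlMl//.
apply: (@le_trans _ _ (\sum_(0 <= b < n) (m^-1 ^+ p * (1 + p%:R * (1 - s b / m))))).
  rewrite -mulr_sumr big_split/= -mulr_sumr big_split/= sumrN -mulr_suml.
  rewrite !sumr_const_nat subn0 -/sg.
  have -> : sg / m = n%:R by rewrite /m invf_div mulrC divfK// gt_eqF.
  by rewrite subrr mulr0 addr0 mulrC.
apply: ler_sum => b _; clearbody m.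
have := @inv_pow_ge1D (s b / m) p (divr_gt0 (s0 b) m0).
rewrite invf_div exprMn => h.
apply: (@le_trans _ _ (m^-1 ^+ p * (m ^+ p * (s b)^-1 ^+ p))).
  by rewrite ler_wpM2l// exprn_ge0// invr_ge0 ltW.
by rewrite mulrA -exprMn mulVf ?gt_eqF// expr1n mul1r.
Qed.

Context d (T : measurableType d) (P : probability T R).

Lemma fatou_bound (F : T -> R) (G : nat -> T -> R) (C : R) :
  measurable_fun setT F -> (forall k, measurable_fun setT (G k)) ->
  (forall k o, 0 <= G k o) -> {ae P, forall o, G k o @[k --> \oo] --> F o} ->
  (forall k, (\int[P]_o (G k o)%:E <= C%:E)%E) -> (\int[P]_o (F o)%:E <= C%:E)%E.
Proof.
move=> mF mG G0 GF hC.
have mf k : measurable_fun setT (EFin \o G k) by apply/measurable_EFinP.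
have := @fatou _ _ _ P setT measurableT (fun k o => (G k o)%:E) mf.
have -> : (\int[P]_x limn_einf (fun k => (G k x)%:E) = \int[P]_o (F o)%:E)%E.
  apply: ae_eq_integral => //.
  - have -> : (fun x => limn_einf (fun k => (G k x)%:E)) =
        (fun x => - limn_esup (fun n => - (G n x)%:E))%E.
      apply/funext => x; rewrite -limn_einfN; congr limn_einf.
      by apply/funext => n; exact: (esym (oppeK _)).
    apply: measurableT_comp => //.
    by apply: measurable_fun_limn_esup => n; apply: measurableT_comp => //; exact: mf.
  - by apply/measurable_EFinP.
  have := GF; apply: filterS => o Go _.
  have : (G k o)%:E @[k --> \oo] --> (F o)%:E.
    by apply: cvg_EFin => //; exact: nearW.
  by move=> /cvg_limn_einf_sup[].
move=> h; apply: le_trans (h _) _; first by move=> n x _; rewrite lee_fin.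
rewrite limn_einf_lim; apply: lime_le; first exact: is_cvg_einfs.
apply: nearW => n; apply: ge_ereal_inf.
by exists (\int[P]_x (G n x)%:E)%E; [exists n => /=|exact: hC].
Qed.

Context (K : eqType) (g : K -> T -> R).
Hypothesis gf : gauss_family P g.
Variables (q : nat) (zt : nat -> nat -> T -> R) (kp : nat -> nat -> K).
Hypothesis zt1 : forall j i, (i < q)%N -> free g (kp j i) (fun o => zt j i o - g (kp j i) o).
Hypothesis zt2 : forall j i i', (i < q)%N -> (i' < q)%N -> i' != i -> free g (kp j i) (zt j i').
Hypothesis zt3 : forall j j' i i', (j' < j)%N -> (i < q)%N -> (i' < q)%N -> free g (kp j i) (zt j' i').
Hypothesis bz : ubd P (fun (ji : nat * nat) => zt ji.1 ji.2).

(** [zt j i] is coordinate i of the j-th vector: it contains its own Gaussian [kp j i] with slope 1,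
    and neither the other coordinates of that vector nor earlier vectors depend on it. The columns
    of block r are the vectors r q, ..., r q + q - 1, and the leading k x k corner is taken. *)
Definition minor_mx r k o : 'M[R]_k := \matrix_(i, c) zt (r * q + c) i o.
Definition Dm r k o : R := \det (minor_mx r k o).

Lemma free_det ka k (M : T -> 'M[R]_k) : (forall i j, free g ka (fun o => M o i j)) ->
  free g ka (fun o => \det (M o)).
Proof.
move=> fM; apply: free_sum => s _; apply: freeM; first exact: free_cst.
by apply: free_prod => i _.
Qed.

Lemma ubd_det I (f : I -> nat) b k (M : I -> T -> 'M[R]_k) :
  (forall i j, mbd P b f (fun n o => M n o i j)) -> mbd P b f (fun n o => \det (M n o)).
Proof.
move=> fM; apply: ubd_sum => s _; apply: ubdM; first exact: ubd_cst1.
by apply: ubd_prod => i _.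
Qed.

(** Laplace expansion along the last column: the corner entry carries the fresh Gaussian, with
    cofactor the smaller minor. The other entries of the column are other coordinates of the same
    vector and all cofactors come from earlier vectors, so none depends on it. *)
Lemma Dm_recr r k : (k < q)%N -> exists b : T -> R,
  free g (kp (r * q + k) k) b /\
  forall o, Dm r k.+1 o = Dm r k o * g (kp (r * q + k) k) o + b o.
Proof.
move=> kq; pose ka := kp (r * q + k) k.
exists (fun o => Dm r k.+1 o - Dm r k o * g ka o); split=> [|o]; last by rewrite addrCA subrr addr0.
have E o : Dm r k.+1 o - Dm r k o * g ka o =
   \sum_(i < k) minor_mx r k.+1 o (widen_ord (leqnSn k) i) ord_max *
      cofactor (minor_mx r k.+1 o) (widen_ord (leqnSn k) i) ord_max +
   (zt (r * q + k) k o - g ka o) * Dm r k o.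
  rewrite {1}/Dm (expand_det_col _ ord_max) big_ord_recr/= mulrBl -addrA; congr (_ + _); rewrite ?[g _ _ * _]mulrC.
  have -> : minor_mx r k.+1 o ord_max ord_max = zt (r * q + k) k o by rewrite mxE.
  have -> : cofactor (minor_mx r k.+1 o) ord_max ord_max = Dm r k o.
    rewrite /cofactor/= addnn -signr_odd odd_double mul1r; congr (\det _).
    by apply/matrixP => i j; rewrite !mxE !lift_max.
  by [].
apply: (@free_ext _ _ _ _ _ _ _ _ _ (fun o => esym (E o))).
have lt c : (c < k)%N -> (c < q)%N by move=> ck; exact: ltn_trans ck kq.
have fD : free g ka (Dm r k).
  apply: free_det => i j; apply: (@free_ext _ _ _ _ _ _ (zt (r * q + j) i)).
    by apply: zt3 => //; [rewrite ltn_add2l|exact: lt].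
  by move=> o; rewrite mxE.
apply: freeD; last by apply: freeM => //; exact: zt1.
apply: free_sum => i _; apply: freeM.
  apply: (@free_ext _ _ _ _ _ _ (zt (r * q + k) i)).
    by apply: zt2 => //; [exact: lt|rewrite ltn_eqF].
  by move=> o; rewrite mxE.
apply: freeM; first exact: free_cst.
apply: free_det => a b.
apply: (@free_ext _ _ _ _ _ _ (zt (r * q + b) (lift (widen_ord (leqnSn k) i) a))).
  apply: zt3 => //; first by rewrite ltn_add2l.
  by have := ltn_ord (lift (widen_ord (leqnSn k) i) a); rewrite ltnS => h; exact: leq_ltn_trans h kq.
by move=> o; rewrite !mxE lift_max.
Qed.

Lemma ubd_Dm k : (k <= q)%N -> ubd P (fun r => Dm r k).
Proof.
move=> kq; apply: ubd_det => i j.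
apply: (ubd_ext (ubd_comp (fun r => (r * q + j, i : nat)%N) bz)).
by move=> r o; rewrite mxE.
Qed.

Lemma measurable_Dm r : measurable_fun setT (Dm r q).
Proof. exact: (ubd_meas r (ubd_Dm (leqnn q))). Qed.

(** Blocks are peeled from the last one and, in a block, minors from size q down to 0, each of the q
    m steps costing one factor C. The product [Y] over the earlier blocks does not depend on the
    coordinate being integrated out. *)
Lemma Jf_prod_bound : exists2 C : R, 1 <= C & forall e r0 m, 0 < e ->
  (\int[P]_o (\prod_(0 <= r < m) Jf e (Dm (r0 + r) q o))%:E <= (C ^+ (q * m))%:E)%E.
Proof.
have [C0 C00 hC0] := peel gf; pose C := C0 + 1; exists C; first by rewrite /C lerDr ltW.
move=> e r0 m e0; have C1 : 1 <= C by rewrite /C lerDr ltW.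
have Cg : 0 <= C by exact: le_trans C1.
elim: m => [|m IH].
  under eq_integral do rewrite big_geq//.
  by rewrite muln0 expr0 integral_prob_cst.
pose Y o := \prod_(0 <= r < m) Jf e (Dm (r0 + r) q o).
have Y0 o : 0 <= Y o by rewrite prodr_ge0// => i _; exact: Jf_ge0.
have mJ r k : (k <= q)%N -> measurable_fun setT (fun o => Jf e (Dm r k o)).
  by move=> kq; apply: measurable_Jf => //; exact: (ubd_meas r (ubd_Dm kq)).
have mY : measurable_fun setT Y by apply: measurable_prod => r _; exact: mJ.
have fD ka r k : (k <= q)%N -> (forall j i, (j < r * q + k)%N -> (i < q)%N -> free g ka (zt j i)) ->
    free g ka (Dm r k).
  move=> kq h; apply: free_det => i j; apply: (@free_ext _ _ _ _ _ _ (zt (r * q + j) i)).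
    by apply: h; [rewrite ltn_add2l|exact: leq_trans kq].
  by move=> o; rewrite mxE.
have claim k : (k <= q)%N ->
    (\int[P]_o (Y o * Jf e (Dm (r0 + m) k o))%:E <= (C ^+ (q * m + k))%:E)%E.
  elim: k => [|k IHk] kq.
    rewrite addn0; apply: le_trans IH; apply: ge0_le_integral => //.
    - by move=> o _; rewrite lee_fin mulr_ge0// Jf_ge0.
    - by apply/measurable_EFinP; apply: measurable_funM => //; exact: mJ.
    - by apply/measurable_EFinP.
    move=> o _; rewrite lee_fin ler_piMr// /Jf /Dm det_mx00 -[leRHS](sqrtr1 R).
    by rewrite ler_wsqrtr// invf_le1 normr1 ?lerDl ?(ltW e0)// ltr_wpDr// ltW.
  have [b [fb Db]] := Dm_recr (r0 + m) kq.
  under eq_integral do rewrite Db.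
  have fY : free g (kp ((r0 + m) * q + k) k) Y.
    apply: (@free_ext _ _ _ _ _ _ (fun o => \prod_(0 <= r < m | (r < m)%N) Jf e (Dm (r0 + r) q o))).
      apply: free_prod => r rm; apply: free_Jf => //; apply: fD => // j i jr iq.
      apply: zt3 => //; apply: leq_trans jr _; apply: leq_trans (leq_addr _ _).
      by rewrite addnC -mulSn leq_mul2r; apply/orP; right; lia.
    by move=> o; rewrite /Y big_nat_cond [RHS]big_nat_cond; apply: eq_bigl => r; rewrite leq0n andbb andbT.
  have fDk : free g (kp ((r0 + m) * q + k) k) (Dm (r0 + m) k).
    by apply: fD; [exact: ltnW|move=> j i jk iq; exact: zt3].
  apply: le_trans (hC0 _ _ Y _ _ e0 fY fDk fb Y0) _.
  apply: (@le_trans _ _ (C0%:E * (C ^+ (q * m + k))%:E)%E).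
    by apply: lee_wpmul2l; [rewrite lee_fin ltW|exact/IHk/ltnW].
  by rewrite -EFinM lee_fin addnS exprS ler_wpM2r ?exprn_ge0// /C lerDl.
have := claim q (leqnn q); rewrite mulnS [(q + q * m)%N]addnC => h.
by under eq_integral do rewrite big_nat_recr//=.
Qed.

(** On the event that the determinant vanishes, [Jf e] equals e^(-1/2), so its probability is at
    most sqrt e times C^q, for every e. *)
Lemma Dm_neq0 r : {ae P, forall o, Dm r q o != 0}.
Proof.
have [C C1 hC] := Jf_prod_bound.
pose E := [set o | Dm r q o == 0].
have mE : measurable E.
  have -> : E = Dm r q @^-1` [set 0].
    by apply/seteqP; split=> o; rewrite /E/=; [move/eqP|move=> h; apply/eqP].
  by rewrite -[_ @^-1` _]setTI; exact: measurable_Dm.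
suff PE : P E = 0.
  exists E; split => // o /= h; apply: contrapT => Eo; apply: h.
  by apply/negP => De; exact: Eo.
have bnd (e : R) : 0 < e -> (P E <= (Num.sqrt e * C ^+ q)%:E)%E.
  move=> e0; have := hC e r 1%N e0; rewrite muln1 => h.
  have h1 : ((Num.sqrt e^-1)%:E * P E <= (C ^+ q)%:E)%E.
    apply: le_trans h.
    rewrite -(setIT E) -integral_indic// -ge0_integralZl//; last by apply/measurable_EFinP; exact: measurable_indic.
    apply: ge0_le_integral => //.
    - by apply: measurable_funeM; apply/measurable_EFinP; exact: measurable_indic.
    - apply/measurable_EFinP; apply: measurable_prod => i _; apply: measurable_Jf => //.
      exact: measurable_Dm.
    move=> o _; rewrite -EFinM lee_fin big_nat1 addn0 indicE.
    case: (boolP (o \in E)) => oE; last by rewrite mulr0 Jf_ge0.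
    by move: oE; rewrite inE /E/= => /eqP De; rewrite mulr1 /Jf De normr0 add0r.
  have s0 : 0 < Num.sqrt e by rewrite sqrtr_gt0.
  rewrite EFinM -lee_pdivrMl//; rewrite sqrtrV in h1; last exact: ltW.
  exact: h1.
apply/eqP; rewrite eq_le measure_ge0 andbT.
apply/lee_addgt0Pr => e e0; rewrite add0e.
have C0 : 0 < C ^+ q by rewrite exprn_gt0//; exact: lt_le_trans C1.
have d0 : 0 < e / C ^+ q by rewrite divr_gt0.
have := bnd ((e / C ^+ q) ^+ 2) (exprn_gt0 _ d0).
by rewrite sqrtr_sqr gtr0_norm// divfK// gt_eqF.
Qed.

Lemma Dm_neq0_all : {ae P, forall o, forall r, Dm r q o != 0}.
Proof. by apply: ae_foralln => r; exact: Dm_neq0. Qed.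

(** Fatou's lemma with e = 1 / (k + 1); the pointwise convergence uses that almost surely no
    determinant vanishes. *)
Lemma J_prod_bound : exists2 C : R, 1 <= C & forall r0 m,
  (\int[P]_o (\prod_(0 <= r < m) Num.sqrt (`|Dm (r0 + r) q o|^-1))%:E <= (C ^+ (q * m))%:E)%E.
Proof.
have [C C1 hC] := Jf_prod_bound; exists C => // r0 m.
have e0 k : 0 < k.+1%:R^-1 :> R by rewrite invr_gt0.
apply: (@fatou_bound _ (fun k o => \prod_(0 <= r < m) Jf k.+1%:R^-1 (Dm (r0 + r) q o))).
- apply: measurable_prod => r _; apply: measurable_fun_sqrt.
  by apply: measurable_fun_inv; apply: measurableT_comp => //; exact: measurable_Dm.
- by move=> k; apply: measurable_prod => r _; apply: measurable_Jf => //; exact: measurable_Dm.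
- by move=> k o; rewrite prodr_ge0// => r _; exact: Jf_ge0.
- have := Dm_neq0_all; apply: filterS => o D0.
  apply: cvg_big => [|r _]; first exact: mul_continuous.
  rewrite /Jf; apply: (@cvg_comp _ _ _ (fun k => (`|Dm (r0 + r) q o| + k.+1%:R^-1)^-1) Num.sqrt _
     (nbhs (`|Dm (r0 + r) q o|^-1))); last exact: sqrt_continuous.
  apply: cvgV; first by rewrite normr_eq0.
  rewrite -[X in _ --> X]addr0; apply: cvgD; [exact: cvg_cst|exact: cvg_harmonic].
- by move=> k; exact: hC.
Qed.

(* By Cramer's rule D^2 |v|^2 <= |v Z|^2 |adj Z|^2 for D = det Z, so [mum r] bounds
   the smallest eigenvalue of Z Z^T from below, Z being the r-th block. *)
Definition Am r o : R := 1 + \sum_i \sum_j (\adj (minor_mx r q o)) i j ^+ 2.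
Definition mum r o : R := Dm r q o ^+ 2 / Am r o.
Definition mun n o : R := \sum_(0 <= r < n) mum r o.

Lemma Am_ge1 r o : 1 <= Am r o.
Proof. by rewrite lerDl sumr_ge0// => i _; rewrite sumr_ge0// => j _; rewrite sqr_ge0. Qed.

Lemma Am_gt0 r o : 0 < Am r o.
Proof. exact: lt_le_trans (Am_ge1 r o). Qed.

Lemma mum_ge0 r o : 0 <= mum r o.
Proof. by rewrite divr_ge0 ?sqr_ge0// ltW// Am_gt0. Qed.

Lemma ubd_Am : ubd P Am.
Proof.
apply: ubdD; first exact: ubd_cst1.
apply: ubd_sum => i _; apply: ubd_sum => j _; apply: ubdX.
apply: (@ubd_ext _ _ _ _ _ _ _ (fun r o => cofactor (minor_mx r q o) j i)); last first.
  by move=> r o; rewrite /adjugate mxE.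
apply: ubdM; first exact: ubd_cst1.
apply: ubd_det => a b.
apply: (ubd_ext (ubd_comp (fun r => (r * q + lift i b, lift j a : nat)%N) bz)).
by move=> r o; rewrite !mxE.
Qed.

(* Group the blocks by m = 8p. In a group the sum of the [mum]'s exceeds each of
   them, so its power -8p is at most the product of their inverses, which is
   integrable after two Cauchy-Schwarz steps by [J_prod_bound]. *)
Lemma mun_ubd : lbd P (fun n o => n%:R / mun n o).
Proof.
have mmum r : measurable_fun setT (mum r).
  apply: measurable_funM; first by apply: measurable_funX; exact: measurable_Dm.
  by apply: measurable_fun_inv; exact: (ubd_meas r ubd_Am).
split=> [n|p].
  apply: measurable_funM => //; apply: measurable_fun_inv.
  by apply: measurable_sum => r.
have [->|p0] := posnP p.
  exists 1, 0%N => n _; under eq_integral do rewrite expr0.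
  by rewrite integral_prob_cst.
pose m := (8 * p)%N; have m0 : (0 < m)%N by rewrite /m; lia.
have [CJ CJ1 hJ] := J_prod_bound.
have bA : ubd P (fun r0 o => \prod_(0 <= r < m) Am (r0 + r) o).
  by apply: ubd_prod => r _; exact: (ubd_comp (fun r0 => r0 + r)%N ubd_Am).
have [CA hA] := ubdE bA 1.
exists ((2 * m%:R) ^+ p * (CA + CJ ^+ (q * m))), m => n mn /=.
pose B := (n %/ m)%N; have B0 : (0 < B)%N by rewrite divn_gt0.
pose a b o := \prod_(0 <= r < m) Am (b * m + r) o.
pose j b o := \prod_(0 <= r < m) Num.sqrt (`|Dm (b * m + r) q o|^-1).
pose s b o := \sum_(0 <= r < m) mum (b * m + r) o.
have a1 b o : 1 <= a b o.
  by apply: prodr_ge1 => r; exact: Am_ge1.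
have j0 b o : 0 <= j b o by rewrite prodr_ge0// => r _; exact: sqrtr_ge0.
have sn o : \sum_(0 <= b < B) s b o <= mun n o.
  have -> : \sum_(0 <= b < B) s b o = \sum_(0 <= r < B * m) mum r o.
    elim: B {B0} => [|b IH]; first by rewrite !big_geq.
    rewrite big_nat_recr//= IH mulSn addnC [RHS](@big_cat_nat _ _ _ (b * m))//=; last exact: leq_addr.
    congr (_ + _); rewrite /s -{2}[(b * m)%N]add0n big_addn addKn.
    by apply: eq_bigr => r _; rewrite addnC.
  rewrite /mun [leRHS](@big_cat_nat _ _ _ (B * m))//=; last exact: leq_trunc_div.
  by rewrite lerDl sumr_ge0// => r _; exact: mum_ge0.
have sJ b o : (forall r, Dm r q o != 0) -> 0 < s b o /\ (s b o)^-1 ^+ p <= a b o + j b o.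
  move=> D0.
  have mum0 r : 0 < mum r o.
    by rewrite divr_gt0 ?Am_gt0// lt_neqAle sqr_ge0 andbT eq_sym sqrf_eq0.
  have ms r : (r < m)%N -> mum (b * m + r) o <= s b o.
    move=> rm; rewrite /s (big_rem r)/= ?mem_index_iota// lerDl.
    by rewrite sumr_ge0// => i _; exact: mum_ge0.
  have s0 : 0 < s b o by apply: lt_le_trans (mum0 _) (ms 0%N m0).
  split=> //; set y := _ ^+ p; have y0 : 0 <= y by rewrite exprn_ge0// invr_ge0 ltW.
  (* Each of the 8p factors 1 / s is at most 1 / [mum] = [Am] / D^2, and D^(-2) is the fourth power
     of |D|^(-1/2). *)
  have y8 : y ^+ 8 <= a b o * j b o ^+ 4.
    rewrite /y -exprM mulnC -/m /a /j -prodrXl -big_split/=.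
    have -> : (s b o)^-1 ^+ m = \prod_(0 <= r < m) (s b o)^-1.
      by rewrite prodr_const_nat subn0.
    rewrite !big_nat; apply: ler_prod => r /= rm; rewrite invr_ge0 (ltW s0)/=.
    have -> : Am (b * m + r) o * Num.sqrt `|Dm (b * m + r) q o|^-1 ^+ 4 = (mum (b * m + r) o)^-1.
      rewrite (exprM _ 2 2) sqr_sqrtr ?invr_ge0// exprVn real_normK ?num_real//.
      by rewrite /mum invf_div.
    by rewrite lef_pV2 ?posrE ?ms// mum0.
  have a0 : 0 <= a b o by exact: le_trans (a1 b o).
  clearbody y.
  (* As a >= 1, y^8 <= a j^4 <= (a j)^4. Then y^2 <= a j <= (a + j)^2 bounds y by a sum whose two
     expectations are known. *)
  have y2 : y ^+ 2 <= a b o * j b o.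
    rewrite -(@ler_pXn2r _ 4)// ?nnegrE ?exprn_ge0 ?mulr_ge0//.
    rewrite -exprM exprMn; apply: le_trans y8 _; rewrite ler_wpM2r ?exprn_ge0//.
    by rewrite exprS ler_peMr ?exprn_ege1//; exact: le_trans (a1 b o).
  rewrite -(@ler_pXn2r _ 2)// ?nnegrE ?addr_ge0//; apply: le_trans y2 _.
  by rewrite sqrrD; have := sqr_ge0 (a b o); have := sqr_ge0 (j b o);
     have := mulr_ge0 a0 (j0 b o); lra.
have ptw o : (forall r, Dm r q o != 0) ->
   `|n%:R / mun n o| ^+ p <= (2 * m%:R) ^+ p * (B%:R^-1 * \sum_(0 <= b < B) (a b o + j b o)).
  move=> D0; have sp b := (sJ b o D0).1.
  have S0 : 0 < \sum_(0 <= b < B) s b o.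
    case: (B) B0 => // B' _; rewrite big_nat_recl//.
    by rewrite ltr_pwDl// sumr_ge0// => i _; exact: ltW.
  have mu0 : 0 < mun n o by exact: lt_le_trans (sn o).
  have B0R : 0 < B%:R :> R by rewrite ltr0n.
  rewrite ger0_norm ?divr_ge0 ?(ltW mu0)//.
  (* Since B = floor (n / m) is at least 1, n <= 2 m B; Jensen's inequality is then applied to the B
     group sums. *)
  apply: (@le_trans _ _ ((2 * m%:R * (B%:R / \sum_(0 <= b < B) s b o)) ^+ p)).
    rewrite lerXn2r ?nnegrE ?divr_ge0 ?mulr_ge0 ?invr_ge0 ?(ltW mu0) ?(ltW S0)//.
    rewrite mulrA ler_pM ?invr_ge0 ?(ltW mu0)//.
      rewrite -!natrM ler_nat; have := divn_eq n m; have := ltn_pmod n m0; rewrite -/B; nia.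
    by rewrite lef_pV2 ?posrE.
  rewrite exprMn ler_wpM2l ?exprn_ge0 ?mulr_ge0//.
  apply: le_trans (mean_inv_pow p B0 sp) _.
  by rewrite ler_wpM2l ?invr_ge0//; apply: ler_sum => b _; exact: (sJ b o D0).2.
have mj b : measurable_fun setT (j b).
  apply: measurable_prod => r _; apply: measurable_fun_sqrt.
  by apply: measurable_fun_inv; apply: measurableT_comp => //; exact: measurable_Dm.
have ma b : measurable_fun setT (a b) by exact: (ubd_meas (b * m)%N bA).
have a0 b o : 0 <= a b o by exact: le_trans (a1 b o).
have maj : measurable_fun setT (fun o => \sum_(0 <= b < B) (a b o + j b o)).
  by apply: measurable_sum => b; exact: measurable_funD.
apply: (@le_trans _ _ (\int[P]_o (((2 * m%:R) ^+ p * B%:R^-1) * \sum_(0 <= b < B) (a b o + j b o))%:E)%E).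
  apply: ae_ge0_le_integral => //.
  - apply/measurable_EFinP; apply: measurable_funX; apply: measurableT_comp => //.
    apply: measurable_funM => //; apply: measurable_fun_inv.
    by apply: measurable_sum => r.
  - move=> o _; rewrite lee_fin !mulr_ge0 ?exprn_ge0 ?invr_ge0 ?mulr_ge0//.
    by rewrite sumr_ge0// => b _; rewrite addr_ge0.
  - by apply/measurable_EFinP; apply: measurable_funM.
  have := Dm_neq0_all; apply: filterS => o D0 _; rewrite lee_fin -mulrA; exact: ptw.
under eq_integral do rewrite EFinM.
rewrite ge0_integralZl//; try by (apply/measurable_EFinP) ||
  (move=> o _; rewrite lee_fin sumr_ge0// => b _; rewrite addr_ge0) ||
  (rewrite lee_fin !mulr_ge0 ?exprn_ge0 ?invr_ge0 ?mulr_ge0).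
rewrite !EFinM -muleA; apply: lee_wpmul2l; first by rewrite lee_fin exprn_ge0 ?mulr_ge0.
under eq_integral do rewrite -sumEFin.
rewrite ge0_integral_sum//; try by (move=> b o _; rewrite lee_fin addr_ge0) ||
  (move=> b; apply/measurable_EFinP; exact: measurable_funD).
apply: (@le_trans _ _ ((B%:R^-1)%:E * \sum_(0 <= b < B) (CA + CJ ^+ (q * m))%:E)%E).
  apply: lee_wpmul2l; first by rewrite lee_fin invr_ge0.
  apply: lee_sum => b _; under eq_integral do rewrite EFinD.
  rewrite ge0_integralD//; try by (apply/measurable_EFinP) || (move=> o _; rewrite lee_fin).
  rewrite EFinD; apply: leeD; last exact: hJ.
  apply: le_trans (hA (b * m)%N); rewrite le_eqVlt; apply/orP; left; apply/eqP.
  by apply: eq_integral => o _; rewrite expr1 ger0_norm//; exact: a0.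
rewrite sumEFin -EFinM lee_fin sumr_const_nat subn0.
by rewrite -[X in _ * X]mulr_natl mulrA mulVf ?mul1r// pnatr_eq0 -lt0n.
Qed.

End smallball.

(** * Stable and controllable linear systems *)

Section stability.
Context (R : realType).
Local Notation C := R[i].
Local Notation normc := (@ComplexField.Normc.normc R).

Definition geom_decay n m (F : nat -> 'M[C]_(n, m)) : Prop :=
  exists K r : R, [/\ 0 <= K, 0 <= r, r < 1 &
    forall k i j, normc (F k i j) <= K * r ^+ k].

Lemma normc_ge0 (z : C) : 0 <= normc z.
Proof. by case: z => a b; exact: sqrtr_ge0. Qed.

(** The rate s lies strictly between max (|z|, r) and 1, which absorbs the resonance when |z| = r;
    the forcing then contributes K / (s - |z|) to the constant. *)
Lemma geom_decay_recr n m (z : C) (F G : nat -> 'M[C]_(n, m)) : normc z < 1 ->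
  (forall k, F k.+1 = z *: F k + G k) -> geom_decay G -> geom_decay F.
Proof.
move=> z1 FG [K [r [K0 r0 r1 hG]]].
have z0 := normc_ge0 z.
pose mm := Num.max (normc z) r; pose s := (1 + mm) / 2.
have mm1 : mm < 1 by rewrite gt_max z1.
have zm : normc z <= mm by rewrite le_max lexx.
have rm : r <= mm by rewrite le_max lexx orbT.
have s1 : s < 1 by rewrite /s; lra.
have s0 : 0 <= s by rewrite /s; lra.
have zs : 0 < s - normc z by rewrite /s; lra.
have rs : r <= s by rewrite /s; lra.
pose L := \sum_i \sum_j normc (F 0%N i j) + K / (s - normc z).
exists L, s; split => //.
  by rewrite addr_ge0 ?divr_ge0 ?(ltW zs)// sumr_ge0// => i _; rewrite sumr_ge0// => j _; exact: normc_ge0.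
elim=> [|k IH] i j.
  rewrite expr0 mulr1 /L (bigD1 i)//= (bigD1 j)//= -!addrA lerDl.
  rewrite !addr_ge0 ?divr_ge0 ?(ltW zs)//.
    by rewrite sumr_ge0// => ? _; exact: normc_ge0.
  by rewrite sumr_ge0// => ? _; rewrite sumr_ge0// => ? _; exact: normc_ge0.
rewrite FG !mxE; apply: le_trans (le_normcD _ _) _.
rewrite ComplexField.Normc.normcM.
apply: (@le_trans _ _ (normc z * (L * s ^+ k) + K * s ^+ k)).
  apply: lerD; first by rewrite ler_wpM2l.
  apply: le_trans (hG _ _ _) _; rewrite ler_wpM2l// lerXn2r// nnegrE.
have -> : normc z * (L * s ^+ k) + K * s ^+ k = (normc z * L + K) * s ^+ k by ring.
rewrite exprS mulrA ler_wpM2r ?exprn_ge0//.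
have : K / (s - normc z) <= L.
  by rewrite /L lerDr sumr_ge0// => a _; rewrite sumr_ge0// => b _; exact: normc_ge0.
rewrite ler_pdivrMr//; lra.
Qed.

(* One root of the polynomial is peeled off at a time; with Cayley-Hamilton this
   turns the spectral radius into a rate of decay without a Jordan form. *)
Lemma geom_decay_horner n (A : 'M[C]_n.+1) (s : seq C) (M : 'M[C]_n.+1) :
  (forall z, z \in s -> normc z < 1) ->
  horner_mx A (\prod_(z <- s) ('X - z%:P)) *m M = 0 ->
  geom_decay (fun k => A ^+ k *m M).
Proof.
elim: s M => [|z s IH] M sz.
  rewrite big_nil rmorph1 mul1mx => ->.
  exists (0 : R), (0 : R); split => // k i j.
  by rewrite mulmx0 mxE mul0r /= expr0n addr0 sqrtr0.
rewrite big_cons mulrC rmorphM/= rmorphB/= horner_mx_X horner_mx_C -mulmxE -mulmxA => h.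
apply: (@geom_decay_recr _ _ z _ (fun k => A ^+ k *m ((A - z%:M) *m M))).
- by apply: sz; rewrite inE eqxx.
- move=> k; rewrite mulmxBl mul_scalar_mx mulmxBr -scalemxAr addrC subrK.
  by rewrite mulmxA exprSr -mulmxE.
- by apply: IH => // y ys; apply: sz; rewrite inE ys orbT.
Qed.

(** The spectral radius is a supremum, so the spectrum must be shown bounded: eigenvalues are roots
    of the characteristic polynomial, and each modulus is at most the sum of the moduli of all
    roots. *)
Lemma spectral_radius_ge n (A : 'M[R]_n) (l : C) :
  eigenvalue (map_mx (real_complex R) A) l -> normc l <= spectral_radius A.
Proof.
move=> el; apply: ub_le_sup; last by exists l.
case: n A el => [|n] A el.
  exists 0; move=> x [m /eigenvalueP em _]; have [v _] := em.
  by rewrite thinmx0 eqxx.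
have [rs E] := closed_field_poly_normal (char_poly (map_mx (real_complex R) A)).
exists (\sum_(z <- rs) normc z) => _ [m em <-].
have : m \in rs.
  move: em; rewrite /= eigenvalue_root_char E rootZ ?root_prod_XsubC//.
  by rewrite (monicP (char_poly_monic _)) oner_eq0.
move=> mrs; rewrite (big_rem m)//= -[leLHS]/(normc m) lerDl sumr_ge0// => z _.
exact: normc_ge0.
Qed.

Lemma stable_geom n (A : 'M[R]_n) : spectral_radius A < 1 ->
  exists K r : R, [/\ 0 <= K, 0 <= r, r < 1 &
    forall k i j, `|(A ^+ k) i j| <= K * r ^+ k].
Proof.
case: n A => [|n] A sA; first by exists 0, 0; split => // k [].
pose A' := map_mx (real_complex R) A.
have [rs E] := closed_field_poly_normal (char_poly A').
rewrite (monicP (char_poly_monic _)) scale1r in E.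
have [] := @geom_decay_horner _ A' rs 1%:M.
- move=> z zrs; apply: le_lt_trans sA; apply: spectral_radius_ge.
  by rewrite eigenvalue_root_char E root_prod_XsubC.
- by rewrite -E Cayley_Hamilton mul0mx.
move=> K [r [K0 r0 r1 h]]; exists K, r; split => // k i j.
have EA : A' ^+ k = map_mx (real_complex R) (A ^+ k) by rewrite rmorphXn.
have := h k i j; rewrite mulmx1 EA mxE /= expr0n addr0 sqrtr_sqr.
exact.
Qed.

Lemma le_geom_eq0 (x K r : R) : 0 <= r -> r < 1 ->
  (forall k, `|x| <= K * r ^+ k) -> x = 0.
Proof.
move=> r0 r1 h; apply/eqP; rewrite -normr_eq0 eq_le normr_ge0 andbT.
have cv : (fun k => K * r ^+ k) @ \oo --> (0 : R).
  by apply: (@cvg_geometric R K r); rewrite ger0_norm.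
apply: (@ler_cvg_to _ _ _ _ (fun=> `|x|) (fun k => K * r ^+ k)) cv _.
  exact: cvg_cst.
exact: nearW.
Qed.

End stability.

(** * The Lyapunov equation and the stationary covariance *)

Section lyapunov.
Context (R : realType) (n : nat) (A : 'M[R]_n).
Hypothesis As : spectral_radius A < 1.

Lemma conj_pow_decay (D : 'M[R]_n) : exists K r : R, [/\ 0 <= r, r < 1 &
  forall k i j, `|(A ^+ k *m D *m (A ^+ k)^T) i j| <= K * r ^+ k].
Proof.
have [K [r [K0 r0 r1 h]]] := stable_geom As.
exists (\sum_a \sum_b (K * `|D b a| * K)), r; split => // k i j.
rewrite mxE; apply: le_trans (ler_norm_sum _ _ _) _.
rewrite mulr_suml; apply: ler_sum => a _.
rewrite mxE mulr_suml; apply: le_trans (ler_norm_sum _ _ _) _.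
rewrite mulr_suml; apply: ler_sum => b _.
have rk : r ^+ k <= 1 by rewrite exprn_ile1// ltW.
have rk0 : 0 <= r ^+ k by rewrite exprn_ge0.
rewrite !normrM mxE.
apply: (@le_trans _ _ (K * r ^+ k * `|D b a| * K)).
  apply: ler_pM => //; first by rewrite ler_wpM2r.
  by apply: le_trans (h _ _ _) _; rewrite ler_piMr.
by rewrite le_eqVlt; apply/orP; left; apply/eqP; ring.
Qed.

Lemma lyap_iter (S Q : 'M[R]_n) m : S = A *m S *m A^T + Q ->
  S = A ^+ m *m S *m (A ^+ m)^T + \sum_(k < m) A ^+ k *m Q *m (A ^+ k)^T.
Proof.
move=> SE; elim: m => [|m IH].
  by rewrite expr0 big_ord0 addr0 trmx1 mul1mx mulmx1.
have e : A ^+ m *m S *m (A ^+ m)^T =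
    A ^+ m.+1 *m S *m (A ^+ m.+1)^T + A ^+ m *m Q *m (A ^+ m)^T.
  by rewrite {1}SE mulmxDr mulmxDl exprSr -mulmxE trmx_mul !mulmxA.
by rewrite big_ord_recr/= {1}IH e -addrA [_ + \sum_(_ < _) _]addrC.
Qed.

Lemma lyap_inj (D : 'M[R]_n) : D = A *m D *m A^T -> D = 0.
Proof.
move=> DE; have [K [r [r0 r1 h]]] := conj_pow_decay D.
apply/matrixP => i j; rewrite mxE; apply: (le_geom_eq0 r0 r1) => k.
have /(@lyap_iter D 0 k) : D = A *m D *m A^T + 0 by rewrite addr0.
rewrite big1 ?addr0; last by move=> l _; rewrite mulmx0 mul0mx.
by move=> {1}->.
Qed.

Definition lyap_op (D : 'M[R]_n) : 'M[R]_n := D - A *m D *m A^T.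

Lemma lyap_op_is_linear : linear lyap_op.
Proof.
move=> a D E; rewrite /lyap_op mulmxDr mulmxDl -scalemxAr -scalemxAl scalerBr.
by rewrite opprD addrACA.
Qed.

HB.instance Definition _ := GRing.isLinear.Build R 'M[R]_n 'M[R]_n _ lyap_op
  lyap_op_is_linear.

(* The Lyapunov operator has a linear inverse: a law of large numbers for
   D - A D A^T yields one for D. *)
Lemma lyap_solve : exists c : 'I_n -> 'I_n -> 'I_n -> 'I_n -> R,
  forall (D : 'M[R]_n) i j,
    D i j = \sum_a \sum_b c i j a b * (D - A *m D *m A^T) a b.
Proof.
pose M := lin_mx lyap_op.
have Mu : M \in unitmx.
  rewrite -row_free_unit -kermx_eq0; apply/rowV0P => v /sub_kermxP.
  rewrite -[v]vec_mxK mul_vec_lin => /(congr1 vec_mx); rewrite mxvecK linear0.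
  move=> /eqP; rewrite subr_eq0 => /eqP /lyap_inj ->; exact: linear0.
pose W := invmx M.
exists (fun i j a b => W (mxvec_index a b) (mxvec_index i j)) => D i j.
have : mxvec D = mxvec (lyap_op D) *m W.
  by rewrite -mul_vec_lin -/M mulmxK.
move=> /matrixP/(_ 0 (mxvec_index i j)); rewrite mxvecE mxE => ->.
rewrite (reindex _ (curry_mxvec_bij _ _))/= [RHS]pair_bigA/=.
by apply: eq_bigr => -[a b] _ /=; rewrite mxvecE mulrC.
Qed.

Context (m : nat) (Cm : 'M[R]_(n, m)) (Sx : 'M[R]_n).
Hypothesis Ac : controllable A Cm.
Hypothesis SE : Sx = A *m Sx *m A^T + Cm *m Cm^T.

(** The transpose solves the same equation, and the homogeneous equation has only the zero
    solution. *)
Lemma Sx_sym : Sx^T = Sx.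
Proof.
apply/eqP; rewrite -subr_eq0; apply/eqP/lyap_inj.
rewrite {1 2}SE raddfD/= !trmx_mul !trmxK -mulmxA mulmxBr mulmxBl.
by rewrite opprD addrACA subrr addr0 !mulmxA.
Qed.

Lemma qform_ge0 p (v : 'rV[R]_n) (B : 'M[R]_(n, p)) :
  0 <= (v *m (B *m B^T) *m v^T) 0 0.
Proof.
rewrite mulmxA -mulmxA -trmx_mul mxE sumr_ge0// => i _.
by rewrite !mxE -expr2 sqr_ge0.
Qed.

Lemma qform_eq0 p (v : 'rV[R]_n) (B : 'M[R]_(n, p)) :
  (v *m (B *m B^T) *m v^T) 0 0 = 0 -> v *m B = 0.
Proof.
rewrite mulmxA -mulmxA -trmx_mul mxE => /eqP.
rewrite psumr_eq0; last by move=> i _; rewrite !mxE -expr2 sqr_ge0.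
move=> /allP h; apply/rowP => i; have := h i; rewrite mem_index_enum => /(_ isT).
by rewrite [X in _ * X]mxE -expr2 sqrf_eq0 => /eqP ->; rewrite mxE.
Qed.

(** The form is a sum of squares plus a remainder that decays geometrically in k; positivity and
    invertibility of [Sx] both follow from letting k grow. *)
Lemma qform_Sx (v : 'rV[R]_n) k : (v *m Sx *m v^T) 0 0 =
  ((v *m A ^+ k) *m Sx *m (v *m A ^+ k)^T) 0 0 +
  \sum_(l < k) (v *m (A ^+ l *m Cm *m (A ^+ l *m Cm)^T) *m v^T) 0 0.
Proof.
rewrite {1}(lyap_iter k SE) mulmxDr mulmxDl [LHS]mxE; congr (_ + _).
  by rewrite trmx_mul !mulmxA.
rewrite mulmx_sumr mulmx_suml summxE; apply: eq_bigr => l _.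
by rewrite trmx_mul !mulmxA.
Qed.

Lemma qform_decay (v : 'rV[R]_n) : exists K r : R, [/\ 0 <= r, r < 1 &
  forall k, `|((v *m A ^+ k) *m Sx *m (v *m A ^+ k)^T) 0 0| <= K * r ^+ k].
Proof.
have [K [r [r0 r1 h]]] := conj_pow_decay Sx.
exists (\sum_a \sum_b `|v 0 b| * K * `|v 0 a|), r; split => // k.
have -> : (v *m A ^+ k) *m Sx *m (v *m A ^+ k)^T = v *m (A ^+ k *m Sx *m (A ^+ k)^T) *m v^T.
  by rewrite trmx_mul !mulmxA.
rewrite mxE; apply: le_trans (ler_norm_sum _ _ _) _.
rewrite mulr_suml; apply: ler_sum => a _.
rewrite mxE mulr_suml; apply: le_trans (ler_norm_sum _ _ _) _.
rewrite mulr_suml; apply: ler_sum => b _.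
rewrite [X in _ * X]mxE !normrM [leRHS]mulrAC ler_wpM2r// -mulrA ler_wpM2l//.
Qed.

Lemma Sx_psd (v : 'rV[R]_n) : 0 <= (v *m Sx *m v^T) 0 0.
Proof.
have [K [r [r0 r1 h]]] := qform_decay v.
rewrite leNgt; apply/negP => neg.
suff : (v *m Sx *m v^T) 0 0 = 0 by move=> e; rewrite e ltxx in neg.
apply: (le_geom_eq0 r0 r1) => k.
have s0 : 0 <= \sum_(l < k) (v *m (A ^+ l *m Cm *m (A ^+ l *m Cm)^T) *m v^T) 0 0.
  by rewrite sumr_ge0// => l _; exact: qform_ge0.
have := h k; have := qform_Sx v k; set X := (_ *m _) 0 0 in neg *; set Y := _ 0 0; set Z := \sum_(_ < _) _ in s0 *.
move=> e hk; rewrite ltr0_norm//; apply: le_trans hk; rewrite ler0_norm; lra.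
Qed.

(** Such a row annihilates every state reachable from 0. By controllability v^T is one of them, so v
    v^T = 0. *)
Lemma uncontrollable_row (v : 'rV[R]_n) :
  (forall k, v *m (A ^+ k *m Cm) = 0) -> v = 0.
Proof.
move=> h; have [u [t e]] := Ac 0 v^T.
have st s : forall k, v *m (A ^+ k *m steer A Cm 0 u s) = 0.
  elim: s => [|s IH] k /=; first by rewrite !mulmx0.
  rewrite mulmxDr mulmxDr !mulmxA.
  have := IH k.+1; rewrite exprSr -mulmxE !mulmxA => ->.
  by have := h k; rewrite mulmxA => ->; rewrite mul0mx addr0.
have := st t 0%N; rewrite e expr0 mul1mx => /matrixP/(_ 0 0); rewrite !mxE.
move=> /eqP; rewrite psumr_eq0; last by move=> i _; rewrite !mxE -expr2 sqr_ge0.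
move=> /allP h2; apply/rowP => i; have := h2 i; rewrite mem_index_enum => /(_ isT).
by rewrite mxE -expr2 sqrf_eq0 => /eqP ->; rewrite mxE.
Qed.

(** For v in the left kernel the sum of squares in [qform_Sx] is minus the decaying remainder. Hence
    every square vanishes, that is v A^k C = 0 for all k. *)
Lemma Sx_unit : Sx \in unitmx.
Proof.
rewrite -row_free_unit -kermx_eq0; apply/rowV0P => v /sub_kermxP vS.
apply: uncontrollable_row => k; apply: qform_eq0.
have [K [r [r0 r1 h]]] := qform_decay v.
apply: (@le_geom_eq0 _ _ (K * r ^+ k.+1) _ r0 r1) => l.
rewrite -mulrA -exprD addSn.
have := qform_Sx v (k + l).+1; rewrite vS mul0mx mxE => e.
have hk := h (k + l).+1.
rewrite ger0_norm ?qform_ge0//; apply: le_trans hk.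
have lt : (k < (k + l).+1)%N by rewrite ltnS leq_addr.
rewrite (bigD1 (Ordinal lt))//= in e.
set X := (_ *m _) 0 0 in e *; set Y := _ 0 0 in e *.
have s0 : 0 <= \sum_(i < (k + l).+1 | i != Ordinal lt) (v *m (A ^+ i *m Cm *m (A ^+ i *m Cm)^T) *m v^T) 0 0.
  by rewrite sumr_ge0// => i _; exact: qform_ge0.
have YX : X <= - Y by lra.
by rewrite -normrN; apply: le_trans YX _; exact: ler_norm.
Qed.

Lemma invSx_psd (v : 'rV[R]_n) : 0 <= (v *m invmx Sx *m v^T) 0 0.
Proof.
have := Sx_psd (v *m invmx Sx); rewrite mulmxKV ?Sx_unit//.
by rewrite trmx_mul trmx_inv Sx_sym mulmxA.
Qed.

(** A uniform horizon: each basis vector is steered to from 0 in some finite time, and the sum of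
    these times serves for all of them. *)
Lemma reach_horizon : exists tau : nat, forall v : 'rV[R]_n,
  (forall k, (k < tau)%N -> v *m (A ^+ k *m Cm) = 0) -> v = 0.
Proof.
have /choice[tt htt] : forall i : 'I_n, exists t, exists u, steer A Cm 0 u t = delta_mx i 0.
  by move=> i; have [u [t e]] := Ac 0 (delta_mx i 0); exists t, u.
exists (\sum_i tt i)%N => v h.
have st u s : forall k, (k + s <= \sum_i tt i)%N -> v *m (A ^+ k *m steer A Cm 0 u s) = 0.
  elim: s => [|s IH] k ks /=; first by rewrite !mulmx0.
  rewrite mulmxDr mulmxDr !mulmxA.
  have := IH k.+1; rewrite addSnnS => /(_ ks); rewrite exprSr -mulmxE !mulmxA => ->.
  have := h k; rewrite mulmxA => ->; first by rewrite mul0mx addr0.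
  by apply: leq_trans ks; rewrite addnS ltnS leq_addr.
apply/rowP => i; have [u e] := htt i.
have := st u (tt i) 0%N; rewrite add0n (bigD1 i)//= leq_addr => /(_ isT).
rewrite e expr0 mul1mx => /matrixP/(_ 0 0); rewrite -colE !mxE.
by [].
Qed.

End lyapunov.

(** * Impulse responses of the state and of the regressor *)

Section impulse.
Context (R : realType) (dx du H : nat).
Variables (A : 'M[R]_dx) (B : 'M[R]_(dx, du)) (Bw : 'M[R]_dx).
Local Notation C := (row_mx B Bw).
Local Notation K := (nat * 'I_(du + dx))%type.

(* The responses of [x_t] and of [z_t] to a unit noise [k] (time, coordinate). *)
Definition ximp (t : nat) (k : K) : 'cV[R]_dx :=
  if (k.1 < t)%N then A ^+ (t - k.1.+1) *m C *m delta_mx k.2 0 else 0.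

Definition zimp (t : nat) (k : K) : 'cV[R]_(dx + H * du) :=
  col_mx (ximp t k) (stack (fun i : 'I_H =>
    if (t + i == k.1)%N then usubmx (delta_mx k.2 0 : 'cV[R]_(du + dx)) else 0)).

Lemma zimp_shift s t o k : zimp (s + t) (s + o, k)%N = zimp t (o, k).
Proof.
rewrite /zimp /ximp/= ltn_add2l -addnS subnDl; congr col_mx.
by apply/matrixP => i j; rewrite !mxE -addnA eqn_add2l.
Qed.

(* Finitely many noises steer z_tau anywhere. *)
Lemma zimp_span : controllable A C -> exists tau (f : 'I_(dx + H * du) -> K),
  (forall i, (f i).1 < tau + H)%N /\
  \matrix_(i, j) zimp tau (f i) j 0 \in unitmx.
Proof.
move=> Ac; have [tau htau] := reach_horizon Ac; exists tau.
pose KK := ('I_(tau + H) * 'I_(du + dx))%type.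
pose key (k : KK) : K := (k.1 : nat, k.2).
pose L : 'M[R]_(#|{: KK}|, dx + H * du) := \matrix_(a, j) zimp tau (key (enum_val a)) j 0.
have Lfull : row_full L.
  rewrite /row_full -mxrank_tr -/(row_free L^T) -kermx_eq0.
  apply/rowV0P => v /sub_kermxP vL.
  have vk (k : KK) : v *m zimp tau (key k) = 0.
    have := congr1 (fun M : 'rV_ _ => M 0 (enum_rank k)) vL.
    rewrite !mxE => e; apply/matrixP => i j; rewrite !ord1 !mxE -[RHS]e.
    by apply: eq_bigr => l _; rewrite !mxE enum_rankK.
  rewrite -(hsubmxK v).
  (* The inputs from time tau on are themselves coordinates of z_tau and do not affect x_tau. *)
  have vr : rsubmx v = 0.
    apply/rowP => c; rewrite [RHS]mxE.
    case: (mxtens_indexP c) => i b.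
    have lt : (tau + i < tau + H)%N by rewrite ltn_add2l.
    have := vk (Ordinal lt, lshift dx b).
    rewrite -{1}(hsubmxK v) /zimp mul_row_col /ximp/= ltnNge leq_addr/= mulmx0 add0r.
    move=> /matrixP/(_ 0 0); rewrite [RHS]mxE mxE (bigD1 (mxtens_index (i, b)))//=.
    rewrite big1 ?addr0 => [|l lib].
      by rewrite !mxE mxtens_indexK/= eqxx !mxE/= eqxx mulr1.
    case: (mxtens_indexP l) lib => i' b' lib; rewrite !mxE mxtens_indexK/= eqn_add2l.
    case: eqP => [ii|_]; last by rewrite mxE mulr0.
    rewrite !mxE/= (inj_eq (@lshift_inj _ _)); case: eqP => [bb|]; last by rewrite mulr0.
    by move: lib; rewrite bb (ord_inj ii) eqxx.
  (* The noise at time tau - k - 1 reaches x_tau through A^k C. *)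
  have vl : lsubmx v = 0.
    apply: htau => k kt; apply/rowP => c; rewrite [RHS]mxE.
    have lt : (tau - k.+1 < tau + H)%N by lia.
    have := vk (Ordinal lt, c).
    rewrite -{1}(hsubmxK v) vr /zimp mul_row_col mul0mx addr0 /ximp/=.
    have -> : (tau - k.+1 < tau)%N by lia.
    have -> : (tau - (tau - k.+1).+1)%N = k by lia.
    move=> e; transitivity (col c (lsubmx v *m (A ^+ k *m C)) 0 0); first by rewrite [RHS]mxE.
    by rewrite colE -mulmxA e mxE.
  by rewrite vl vr row_mx0.
exists (fun i => key (enum_val (fullrankfun Lfull i))); split.
  by move=> i /=; exact: ltn_ord.
have -> : \matrix_(i, j) zimp tau (key (enum_val (fullrankfun Lfull i))) j 0 =
    rowsub (fullrankfun Lfull) L by apply/matrixP => i j; rewrite !mxE.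
exact: fullrowsub_unit.
Qed.

End impulse.

(** * The scalar noises form a Gaussian family *)

Section noise.
Context (R : realType) d (T : measurableType d) (P : probability T R) (dx du : nat).
Variables (w : nat -> T -> 'cV[R]_dx) (u : nat -> T -> 'cV[R]_du).
Hypothesis w_iid : iid_std_gaussian P w.
Hypothesis u_iid : iid_std_gaussian P u.
Hypothesis wu_indep : independent_seqs P w u.
Local Notation K := (nat * 'I_(du + dx))%type.
Local Notation N := (@normal_prob R 0 1).

Definition noise t o : 'cV[R]_(du + dx) := col_mx (u t o) (w t o).
Definition ncoord (k : K) (o : T) : R := noise k.1 o k.2 0.

Lemma ncoord_u t b o : ncoord (t, lshift dx b) o = u t o b 0.
Proof. by rewrite /ncoord /noise col_mxEu. Qed.

Lemma ncoord_w t a o : ncoord (t, rshift du a) o = w t o a 0.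
Proof. by rewrite /ncoord /noise col_mxEd. Qed.

Lemma ncoord_meas k : measurable_fun [set: T] (ncoord k).
Proof.
case: k => t k; rewrite -(fintype.splitK k); case: (fintype.split k) => [b|a] /=.
  rewrite (_ : ncoord _ = fun o => u t o b 0).
    by have [hu _] := u_iid; have [mu _] := hu t; exact: mu.
  by apply/funext => o; exact: ncoord_u.
rewrite (_ : ncoord _ = fun o => w t o a 0).
  by have [hw _] := w_iid; have [mw _] := hw t; exact: mw.
by apply/funext => o; exact: ncoord_w.
Qed.

Lemma sigma_vec_rect n (X : T -> 'cV[R]_n) (B : 'I_n -> set R) :
  (forall i, measurable (B i)) -> sigma_vec X [set o | forall i, B i (X o i 0)].
Proof.
move=> mB.
pose GG := \bigcup_(i in [set: 'I_n])
        preimage_set_system [set: T] (fun o => X o i 0) measurable.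
have -> : [set o | forall i, B i (X o i 0)] =
    \bigcap_(i in [set: 'I_n]) ((fun o => X o i 0) @^-1` B i).
  by apply/seteqP; split=> o /= h; [move=> i _; exact: h|move=> i; exact: h].
apply: (@fin_bigcap_measurable _ (g_sigma_algebraType GG)) => //.
move=> i _; apply: sub_sigma_algebra; exists i => //; exists (B i) => //.
by rewrite setTI.
Qed.

Lemma sigma_vec_seq n (X : nat -> T -> 'cV[R]_n) t E :
  sigma_vec (X t) E -> sigma_seq X E.
Proof. by move=> h; apply: sub_sigma_algebra; exists t. Qed.

Lemma iid_rect n (X : nat -> T -> 'cV[R]_n) (Bt : nat -> 'I_n -> set R) M :
  iid_std_gaussian P X -> (forall t i, measurable (Bt t i)) ->
  let E := [set o | forall t, (t < M)%N -> forall i, Bt t i (X t o i 0)] in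
  sigma_seq X E /\ P E = (\prod_(0 <= t < M) \prod_(i < n) N (Bt t i))%E.
Proof.
move=> [gX iX] mB E.
pose J : {fset nat} := [fset t in iota 0 M]%fset.
pose Et t := [set o | forall i, Bt t i (X t o i 0)].
have EE : E = \bigcap_(t in [set` J]) Et t.
  apply/seteqP; split=> o /= h t.
    by rewrite /= in_fset/= mem_iota add0n => /= tM; exact: h.
  by move=> tM; apply: h; rewrite /= in_fset/= mem_iota add0n.
have sE t : sigma_vec (X t) (Et t) by exact: sigma_vec_rect.
split.
  rewrite EE; pose GG := \bigcup_(t in [set: nat]) sigma_vec (X t).
  apply: (@fin_bigcap_measurable _ (g_sigma_algebraType GG)) => //.
  by move=> t _; exact: sigma_vec_seq.
rewrite EE iX; last by move=> t _; exact: sE.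
rewrite (perm_big (iota 0 M)); last first.
  apply: uniq_perm; [exact: fset_uniq|exact: iota_uniq|].
  by move=> t; rewrite in_fset.
rewrite -{1}[M]subn0; apply: eq_bigr => t _.
by have [_ ->] := gX t.
Qed.

Definition cyl (Bk : K -> set R) : set T := [set o | forall k, Bk k (ncoord k o)].

Lemma cyl_prob (Bk : K -> set R) M : (forall k, measurable (Bk k)) ->
  (forall k, (M <= k.1)%N -> Bk k = setT) ->
  measurable (cyl Bk) /\
  P (cyl Bk) = (\prod_(0 <= t < M) \prod_(i < du + dx) N (Bk (t, i)))%E.
Proof.
move=> mB BT.
have [sw pw] := @iid_rect _ w (fun t i => Bk (t, rshift du i)) M w_iid (fun t i => mB _).
have [su pu] := @iid_rect _ u (fun t i => Bk (t, lshift dx i)) M u_iid (fun t i => mB _).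
set Ew := [set o | _] in sw pw; set Eu := [set o | _] in su pu.
have E : cyl Bk = Ew `&` Eu.
  apply/seteqP; split=> o /=.
    move=> h; split=> t _ i.
      by have := h (t, rshift du i); rewrite ncoord_w.
    by have := h (t, lshift dx i); rewrite ncoord_u.
  move=> [hw hu] [t k]; have [Mt|tM] := leqP M t; first by rewrite BT.
  rewrite -(fintype.splitK k); case: (fintype.split k) => [b|a] /=.
    by rewrite ncoord_u; exact: hu.
  by rewrite ncoord_w; exact: hw.
split.
  have -> : cyl Bk = \bigcap_(t in [set: nat]) \bigcap_(k in [set: 'I_(du + dx)]) (ncoord (t, k) @^-1` Bk (t, k)).
    apply/seteqP; split=> o /= h; first by move=> t _ k _; exact: h.
    by move=> [t k]; exact: h.
  apply: bigcapT_measurable => t; apply: fin_bigcap_measurable => [|k _].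
    exact: finite_finset.
  by rewrite -[_ @^-1` _]setTI; exact: ncoord_meas.
rewrite E wu_indep// pw pu -big_split/=.
apply: eq_bigr => t _; rewrite big_split_ord/= muleC.
by congr (_ * _)%E.
Qed.

(** Cylinders leaving the coordinate [k0] unconstrained are stable under intersection and generate
    the sigma-algebra of the other coordinates. On them the finite measures P (E and g_k0 in B) and
    N(B) P(E) agree, hence on the whole sigma-algebra. *)
Lemma noise_gauss_family : gauss_family P ncoord.
Proof.
split; first exact: ncoord_meas.
move=> k0 E0 B sE0 mB.
pose CC := [set S | exists Bk M, [/\ forall k, measurable (Bk k),
   forall k : K, (M <= k.1)%N -> Bk k = setT, Bk k0 = setT & S = cyl Bk]].
have sE : <<s CC >> E0.
  apply: smallest_sub sE0; first exact: smallest_sigma_algebra.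
  move=> _ [l /= lk [D mD <-]]; apply: sub_sigma_algebra.
  exists (fun k => if k == l then D else setT), l.1.+1; split.
  - by move=> k; case: ifP.
  - by move=> k lt; case: eqP => // kl; move: lt; rewrite kl ltnn.
  - by rewrite eq_sym (negbTE lk).
  - apply/seteqP; split=> o /=.
      by move=> [_ h] k; case: eqP => // ->.
    by move=> h; split => //; have := h l; rewrite eqxx.
have mD : measurable (ncoord k0 @^-1` B) by rewrite -[_ @^-1` _]setTI; exact: ncoord_meas.
pose m1 := mrestr P mD.
pose m2 := mscale (NngNum (fine_ge0 (measure_ge0 N B))) P.
suff : m1 E0 = m2 E0.
  rewrite /m1 /m2 /mrestr /mscale/= => ->.
  by rewrite fineK ?fin_num_measure// muleC.
have CCm : CC `<=` measurable.
  by move=> _ [Bk [M [mBk BT _ ->]]]; exact: (cyl_prob mBk BT).1.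
apply: (g_sigma_algebra_measure_unique CC CCm (fun=> setT)) => //.
- move=> _; exists (fun=> setT), 0%N; split => //.
  by apply/seteqP; split.
- by rewrite bigcup_const.
- move=> _ _ [B1 [M1 [mB1 BT1 Bk1 ->]]] [B2 [M2 [mB2 BT2 Bk2 ->]]].
  exists (fun k => B1 k `&` B2 k), (maxn M1 M2); split.
  + by move=> k; exact: measurableI.
  + by move=> k; rewrite geq_max => /andP[h1 h2]; rewrite BT1// BT2// setIT.
  + by rewrite Bk1 Bk2 setIT.
  + apply/seteqP; split=> o /=; first by move=> [h1 h2] k; split; [exact: h1|exact: h2].
    by move=> h; split=> k; have [] := h k.
- move=> _ [Bk [M [mBk BT Bk0 ->]]].
  change (P (cyl Bk `&` ncoord k0 @^-1` B) = ((fine (N B))%:E * P (cyl Bk))%E).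
  pose M' := maxn M k0.1.+1.
  pose Bk' k := if k == k0 then B else Bk k.
  have mBk' k : measurable (Bk' k) by rewrite /Bk'; case: ifP.
  have BT' k : (M' <= k.1)%N -> Bk' k = setT.
    rewrite geq_max => /andP[h1 h2]; rewrite /Bk'; case: eqP => [kk|_]; last exact: BT.
    by move: h2; rewrite kk ltnn.
  have BTM k : (M' <= k.1)%N -> Bk k = setT.
    by rewrite geq_max => /andP[h1 _]; exact: BT.
  have -> : cyl Bk `&` ncoord k0 @^-1` B = cyl Bk'.
    apply/seteqP; split=> o /=.
      by move=> [h1 h2] k; rewrite /Bk'; case: eqP => [->//|_]; exact: h1.
    move=> h; split; last by have := h k0; rewrite /Bk' eqxx.
    by move=> k; have := h k; rewrite /Bk'; case: eqP => // ->; rewrite Bk0.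
  have [_ ->] := cyl_prob mBk' BT'; have [_ ->] := cyl_prob mBk BTM.
  rewrite fineK ?fin_num_measure// !big_mkord.
  have lt : (k0.1 < M')%N by rewrite /M' leq_max ltnSn orbT.
  rewrite (bigD1 (Ordinal lt))//= [in RHS](bigD1 (Ordinal lt))//=.
  rewrite (bigD1 k0.2)//= [in RHS](bigD1 k0.2)//=.
  rewrite /Bk' -surjective_pairing eqxx Bk0 [N setT]probability_setT mul1e -muleA.
  congr (_ * (_ * _))%E.
    apply: eq_bigr => i ik; case: eqP => // kk; move: ik; rewrite -kk/= eqxx//.
  apply: eq_bigr => t tk; apply: eq_bigr => i _; case: eqP => // kk.
  by move: tk; rewrite -val_eqE/= -kk/= eqxx.
- move=> _; rewrite /m1 /mrestr; apply: le_lt_trans (ltry 1).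
  by apply: probability_le1; exact: measurableI.
Qed.

End noise.

(** Convexity of the power by induction: the defect of each step is l (1 - l) (a - c) (a^p - c^p),
    which is non-negative. *)
Lemma convex_exprn (R : realType) (l a c : R) p : 0 <= l -> l <= 1 -> 0 <= a -> 0 <= c ->
  (l * a + (1 - l) * c) ^+ p <= l * a ^+ p + (1 - l) * c ^+ p.
Proof.
move=> l0 l1 a0 c0; elim: p => [|p IH]; first by rewrite !expr0; lra.
rewrite exprS; have s0 : 0 <= l * a + (1 - l) * c by nra.
apply: (@le_trans _ _ ((l * a + (1 - l) * c) * (l * a ^+ p + (1 - l) * c ^+ p))).
  by rewrite ler_wpM2l.
have m : 0 <= (a - c) * (a ^+ p - c ^+ p).
  have [ac|/ltW ac] := leP a c.
    by rewrite mulr_le0 ?subr_le0 ?lerXn2r.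
  by rewrite mulr_ge0 ?subr_ge0 ?lerXn2r.
have ll : 0 <= l * (1 - l) by rewrite mulr_ge0// subr_ge0.
rewrite -subr_ge0 !exprS.
rewrite [X in 0 <= X](_ : _ = l * (1 - l) * ((a - c) * (a ^+ p - c ^+ p))); last by ring.
exact: mulr_ge0.
Qed.

(** * Matrix-valued families with bounded moments *)

Section matrix_moments.
Context (R : realType) d (T : measurableType d) (P : probability T R).
Context (b : bool) (I : Type) (h : I -> nat).

Definition mbdm (m n : nat) (F : I -> T -> 'M[R]_(m, n)) : Prop :=
  forall i j, mbd P b h (fun k o => F k o i j).

Lemma mbdm_ext m n (F G : I -> T -> 'M[R]_(m, n)) : mbdm F ->
  (forall k o, F k o = G k o) -> mbdm G.
Proof. by move=> bF FG i j; apply: (ubd_ext (bF i j)) => k o; rewrite FG. Qed.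

Lemma mbdm_cst m n (M : 'M[R]_(m, n)) : mbdm (fun _ _ => M).
Proof. by move=> i j; exact: ubd_cst1. Qed.

Lemma mbdmD m n (F G : I -> T -> 'M[R]_(m, n)) : mbdm F -> mbdm G ->
  mbdm (fun k o => F k o + G k o).
Proof.
by move=> bF bG i j; apply: (ubd_ext (ubdD (bF i j) (bG i j))) => k o; rewrite !mxE.
Qed.

Lemma mbdmN m n (F : I -> T -> 'M[R]_(m, n)) : mbdm F -> mbdm (fun k o => - F k o).
Proof. by move=> bF i j; apply: (ubd_ext (ubdN (bF i j))) => k o; rewrite !mxE. Qed.

Lemma mbdmB m n (F G : I -> T -> 'M[R]_(m, n)) : mbdm F -> mbdm G ->
  mbdm (fun k o => F k o - G k o).
Proof. by move=> bF bG; apply: mbdmD => //; exact: mbdmN. Qed.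

Lemma mbdmZ m n (c : I -> T -> R) (F : I -> T -> 'M[R]_(m, n)) : mbd P b h c -> mbdm F ->
  mbdm (fun k o => c k o *: F k o).
Proof.
by move=> bc bF i j; apply: (ubd_ext (ubdM bc (bF i j))) => k o; rewrite !mxE.
Qed.

Lemma mbdm_tr m n (F : I -> T -> 'M[R]_(m, n)) : mbdm F -> mbdm (fun k o => (F k o)^T).
Proof. by move=> bF i j; apply: (ubd_ext (bF j i)) => k o; rewrite !mxE. Qed.

Lemma mbdm_mul m n p (F : I -> T -> 'M[R]_(m, n)) (G : I -> T -> 'M[R]_(n, p)) :
  mbdm F -> mbdm G -> mbdm (fun k o => F k o *m G k o).
Proof.
move=> bF bG i j.
apply: (ubd_ext (F := fun k o => \sum_l F k o i l * G k o l j)).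
  by apply: ubd_sum => l _; exact: ubdM.
by move=> k o; rewrite mxE.
Qed.

Lemma mbdm_mull m n p (M : 'M[R]_(m, n)) (G : I -> T -> 'M[R]_(n, p)) :
  mbdm G -> mbdm (fun k o => M *m G k o).
Proof. by apply: mbdm_mul; exact: mbdm_cst. Qed.

Lemma mbdm_mulr m n p (F : I -> T -> 'M[R]_(m, n)) (M : 'M[R]_(n, p)) :
  mbdm F -> mbdm (fun k o => F k o *m M).
Proof. by move=> bF; apply: mbdm_mul => //; exact: mbdm_cst. Qed.

Lemma mbdm_sum m n J (r : seq J) (F : J -> I -> T -> 'M[R]_(m, n)) :
  (forall j, mbdm (F j)) -> mbdm (fun k o => \sum_(j <- r) F j k o).
Proof.
move=> bF i j; apply: (ubd_ext (F := fun k o => \sum_(l <- r) F l k o i j)).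
  by apply: ubd_sum => l _; exact: bF.
by move=> k o; rewrite summxE.
Qed.

End matrix_moments.

(** * Dependence on each noise, and moments, of the state and the regressor *)

Section system.
Context (R : realType) d (T : measurableType d) (P : probability T R) (dx du H : nat).
Variables (A : 'M[R]_dx) (B : 'M[R]_(dx, du)) (Bw : 'M[R]_dx).
Variables (w : nat -> T -> 'cV[R]_dx) (u : nat -> T -> 'cV[R]_du).
Hypothesis gf : gauss_family P (ncoord w u).
Local Notation C := (row_mx B Bw).
Local Notation K := (nat * 'I_(du + dx))%type.
Local Notation g := (ncoord w u).
Local Notation noise := (noise w u).
Local Notation xs := (state A B Bw w u).
Local Notation z := (zvec H A B Bw w u).
Local Notation ximp := (ximp A B Bw).
Local Notation zimp := (zimp H A B Bw).

Lemma stateS t o : xs t.+1 o = A *m xs t o + C *m noise t o.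
Proof. by rewrite /= /noise mul_row_col addrA. Qed.

Lemma noise_free k t l : free g k (fun o => noise t o l 0 - g k o * ((t, l) == k)%:R).
Proof.
have [<-|kl] := eqVneq (t, l) k.
  by apply: (free_ext (@free_cst _ _ _ _ g (t, l) 0)) => o; rewrite mulr1 /ncoord subrr.
apply: (free_ext (free_gauss kl)) => o.
by rewrite mulr0 subr0.
Qed.

Lemma noise_delta (k : K) t l : (((t, l) == k)%:R : R) =
  if t == k.1 then (delta_mx k.2 0 : 'cV[R]_(du + dx)) l 0 else 0.
Proof.
case: k => s m; rewrite xpair_eqE/=; case: (t == s) => //=.
by rewrite mxE andbT.
Qed.

(** The state is affine in each scalar noise. Saying that the difference does not depend on [g k]
    avoids any formula for the remaining part. *)
Lemma state_free k t i : free g k (fun o => xs t o i 0 - g k o * ximp t k i 0).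
Proof.
elim: t i => [|t IH] i.
  apply: (free_ext (@free_cst _ _ _ _ g k 0)) => o.
  by rewrite /ximp ltn0 !mxE mulr0 subrr.
have E : ximp t.+1 k = A *m ximp t k + C *m (if t == k.1 then delta_mx k.2 0 else 0).
  rewrite /ximp ltnS leq_eqVlt eq_sym; have [->|tk]/= := eqVneq k.1 t.
    by rewrite subnn expr0 mul1mx ltnn mulmx0 add0r.
  case: ifP => [kt|_]; last by rewrite !mulmx0 addr0.
  by rewrite mulmx0 addr0 subSS -(subnSK kt) exprS -mulmxE !mulmxA.
apply: (@free_ext _ _ _ _ _ _ (fun o => \sum_j A i j * (xs t o j 0 - g k o * ximp t k j 0) +
   \sum_l C i l * (noise t o l 0 - g k o * ((t, l) == k)%:R))).
  apply: freeD; apply: free_sum => j _; apply: freeM; try exact: free_cst.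
  - exact: IH.
  - exact: noise_free.
move=> o; rewrite stateS E !mxE mulrDr opprD addrACA; congr (_ + _).
  rewrite mulr_sumr -sumrB; apply: eq_bigr => j _; ring.
rewrite mulr_sumr -sumrB; apply: eq_bigr => l _; rewrite noise_delta.
by case: ifP => _; [|rewrite [X in _ = _ - _ * (_ * X)]mxE]; ring.
Qed.

Lemma zvec_free k t i : free g k (fun o => z t o i 0 - g k o * zimp t k i 0).
Proof.
rewrite -(fintype.splitK i); case: (fintype.split i) => [a|c] /=.
  apply: (free_ext (@state_free k t a)) => o.
  by rewrite /zvec /zimp !col_mxEu.
case: (mxtens_indexP c) => j b.
apply: (free_ext (@noise_free k (t + j) (lshift dx b))) => o.
have -> : z t o (rshift dx (mxtens_index (j, b))) 0 = noise (t + j) o (lshift dx b) 0.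
  by rewrite /zvec col_mxEd [LHS]mxE mxtens_indexK /noise col_mxEu.
have -> : zimp t k (rshift dx (mxtens_index (j, b))) 0 = (((t + j)%N, lshift dx b) == k)%:R.
  rewrite /zimp col_mxEd [LHS]mxE mxtens_indexK/= noise_delta.
  by case: ifP => _; rewrite !mxE.
by [].
Qed.

Lemma state_free0 (k : K) t i : (t <= k.1)%N -> free g k (fun o => xs t o i 0).
Proof.
move=> tk; apply: (free_ext (@state_free k t i)) => o.
by rewrite /ximp ltnNge tk/= mxE mulr0 subr0.
Qed.

Lemma zvec_free0 (k : K) t i : (t + H <= k.1)%N -> free g k (fun o => z t o i 0).
Proof.
move=> tk; apply: (free_ext (@zvec_free k t i)) => o.
have -> : zimp t k = 0.
  rewrite /zimp /ximp ltnNge (leq_trans (leq_addr _ _) tk)/=.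
  apply/matrixP => a b; rewrite [RHS]mxE -(fintype.splitK a); case: (fintype.split a) => [a'|c] /=.
    by rewrite col_mxEu mxE.
  rewrite col_mxEd mxE; case: eqP => [e|_]; last by rewrite mxE.
  by move: tk; rewrite -e leq_add2l leqNgt ltn_ord.
by rewrite [X in _ * X]mxE mulr0 subr0.
Qed.

Lemma ubd_noise : ubd P (fun (tk : K) o => noise tk.1 o tk.2 0).
Proof. exact: (ubd_gauss1 gf). Qed.

Hypothesis As : spectral_radius A < 1.

(** The state is dominated by a scalar process with y_(t+1) = r y_t + nn_t, the convex combination
    of y_t and nn_t / (1 - r) with weights r and 1 - r. By convexity of x^p the moments of y stay
    below a bound for those of nn / (1 - r), up to the added 1 that covers p = 0. *)
Lemma ubd_state : ubd P (fun (ti : nat * 'I_dx) o => xs ti.1 o ti.2 0).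
Proof.
have [Ka [r [Ka0 r0 r1 hA]]] := stable_geom As.
pose nn t o : R := Ka * \sum_j `|(C *m noise t o) j 0|.
have nn0 t o : 0 <= nn t o by rewrite mulr_ge0// sumr_ge0.
have bn : ubd P nn.
  apply: ubdZ; apply: ubd_sum => j _; apply: ubd_norm.
  apply: (ubd_ext (F := fun t o => \sum_l C j l * noise t o l 0)).
    by apply: ubd_sum => l _; apply: ubdZ; exact: (ubd_comp (fun t : nat => (t, l)) ubd_noise).
  by move=> t o; rewrite mxE.
pose y := fix y (t : nat) (o : T) {struct t} : R := if t is s.+1 then r * y s o + nn s o else 0.
have y0 t o : 0 <= y t o by elim: t => //= t IH; rewrite addr_ge0// mulr_ge0.
(* All powers A^k are carried through the induction, since A itself need not be a contraction. *)
have dom t k i o : `|(A ^+ k *m xs t o) i 0| <= r ^+ k * y t o.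
  elim: t k i => [|t IH] k i; first by rewrite mulmx0 mxE normr0 mulr0.
  have EA : A ^+ k *m A = A ^+ k.+1 by rewrite exprSr mulmxE.
  rewrite stateS mulmxDr mulmxA EA [y _ _]/= mxE; apply: le_trans (ler_normD _ _) _.
  rewrite mulrDr; apply: lerD; first by apply: le_trans (IH k.+1 i) _; rewrite exprSr mulrA.
  rewrite mxE; apply: le_trans (ler_norm_sum _ _ _) _.
  rewrite /nn mulr_sumr mulr_sumr; apply: ler_sum => j _.
  by rewrite normrM mulrA ler_wpM2r// mulrC; exact: hA.
have my t : moms P (y t).
  elim: t => [|t IH]; first exact: ubd_cst1.
  by apply: ubdD; [exact: ubdZ|exact: ubd_moms bn].
have by_ : ubd P y.
  apply: ubd_ex1 => [t|p]; first exact: (ubd_meas tt (my t)).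
  have r10 : 0 < 1 - r by rewrite subr_gt0.
  pose c t o := nn t o / (1 - r).
  have c0 t o : 0 <= c t o by rewrite divr_ge0// ltW.
  have bc : ubd P c by apply: ubdM => //; exact: ubd_cst1.
  have [M hM] := ubd_ex (ubdX p bc).
  have M0 : 0 <= M by exact: le_trans (hM 0%N).
  exists (M + 1) => t; split; first exact: my.
  have -> : (fun o => `|y t o| ^+ p) = (fun o => y t o ^+ p).
    by apply/funext => o; rewrite ger0_norm.
  elim: t => [|t IH].
    rewrite (_ : (fun o => _) = fun=> (0 : R) ^+ p)//; rewrite ex_cst expr0n.
    by apply: (@le_trans _ _ 1); [case: (p == 0%N)|rewrite lerDr].
  have m1 : moms P (fun o => y t o ^+ p) by apply: ubdX; exact: my.
  have m2 : moms P (fun o => c t o ^+ p) by apply: ubdX; exact: ubd_moms bc.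
  apply: (@le_trans _ _ (ex P (fun o => r * y t o ^+ p + (1 - r) * c t o ^+ p))).
    apply: ex_le.
    - by apply: ubdX; exact: (my t.+1).
    - by apply: ubdD; exact: ubdZ.
    move=> o; apply: le_trans (convex_exprn p r0 (ltW r1) (y0 t o) (c0 t o)).
    rewrite /= /c mulrCA divff ?mulr1// gt_eqF//.
  rewrite exD; [|exact: ubdZ|exact: ubdZ].
  rewrite !exZ//.
  have := le_trans (ler_norm _) (hM t); move: IH r10 r0; set E1 := ex _ _; set E2 := ex _ _.
  nra.
apply: (@ubd_le _ _ _ _ _ _ _ _ (fun ti => y ti.1)) => [[t i]||[t i] o] /=.
- have : measurable_fun setT (fun o => xs t o i 0); last by [].
  elim: t i => [|t IH] i; first exact: measurable_cst.
  rewrite (_ : (fun o => _) = (fun o => \sum_j A i j * xs t o j 0 + \sum_l C i l * noise t o l 0)).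
    apply: measurable_funD; apply: measurable_sum => j; apply: measurable_funM => //.
    exact: (ubd_meas (t, j) ubd_noise).
  by apply/funext => o; rewrite stateS !mxE.
- exact: (ubd_comp (fun ti : nat * 'I_dx => ti.1) by_).
- rewrite [leRHS]ger0_norm//.
  by have := dom t 0%N i o; rewrite expr0 mul1mx mul1r.
Qed.

Lemma ubd_zvec : ubd P (fun (ti : nat * 'I_(dx + H * du)) o => z ti.1 o ti.2 0).
Proof.
suff h i : ubd P (fun t o => z t o i 0).
  split=> [[t i]|p]; first exact: (ubd_meas t (h i)).
  have /choice[Cf hC] := fun i => ubdE (h i) p.
  exists (\sum_i `|Cf i|), 0%N => -[t i] _ /=.
  apply: le_trans (hC i t) _; rewrite lee_fin (bigD1 i)//=.
  apply: le_trans (ler_norm _) _; rewrite lerDl sumr_ge0//.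
rewrite -(fintype.splitK i); case: (fintype.split i) => [a|c] /=.
  apply: (ubd_ext (ubd_comp (fun t : nat => (t, a)) ubd_state)) => t o.
  by rewrite /zvec col_mxEu.
case: (mxtens_indexP c) => j b.
apply: (ubd_ext (ubd_comp (fun t : nat => ((t + j)%N, lshift dx b)) ubd_noise)) => t o.
by rewrite /zvec col_mxEd [RHS]mxE mxtens_indexK /= /noise col_mxEu.
Qed.

End system.

(** * Laws of large numbers *)

Section normalized_sums.
Context (R : realType) d (T : measurableType d) (P : probability T R).

(* Junk value: [rt 0 = 0]. *)
Definition rt (n : nat) : R := (Num.sqrt n%:R)^-1.

Lemma rtE n : rt n = (Num.sqrt n%:R)^-1. Proof. by []. Qed.

Lemma rt_ge0 n : 0 <= rt n. Proof. by rewrite invr_ge0 sqrtr_ge0. Qed.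

Lemma rt_le1 n : rt n <= 1.
Proof.
rewrite /rt; case: n => [|n]; first by rewrite sqrtr0 invr0.
have h : 1 <= Num.sqrt n.+1%:R :> R by rewrite -[leLHS](sqrtr1 R) ler_wsqrtr// ler1n.
by rewrite invf_le1// (lt_le_trans ltr01 h).
Qed.

Lemma ubd_rt (I : Type) (f : I -> nat) : ubd P (fun (i : I) (_ : T) => rt (f i)).
Proof. by apply: (@ubd_cst _ _ _ _ _ _ _ _ 1) => i; rewrite ger0_norm ?rt_ge0 ?rt_le1. Qed.

Definition nsum m n (G : nat -> T -> 'M[R]_(m, n)) (k : nat) (o : T) : 'M[R]_(m, n) :=
  rt k *: \sum_(0 <= t < k) G t o.

(** A quantitative law of large numbers for centred terms: a sum of n of them is of order sqrt n in
    every L^p. *)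
Definition sqrt_bd m n (G : nat -> T -> 'M[R]_(m, n)) : Prop :=
  mbdm P true (fun=> 0%N) (nsum G).

Lemma sqrt_bd_entry m n (G : nat -> T -> 'M[R]_(m, n)) :
  (forall i j, ubd P (fun k o => rt k * \sum_(0 <= t < k) G t o i j)) -> sqrt_bd G.
Proof. by move=> h i j; apply: (ubd_ext (h i j)) => k o; rewrite mxE summxE. Qed.

Lemma sqrt_bdE m n (G : nat -> T -> 'M[R]_(m, n)) i j :
  sqrt_bd G -> ubd P (fun k o => rt k * \sum_(0 <= t < k) G t o i j).
Proof. by move=> h; apply: (ubd_ext (h i j)) => k o; rewrite mxE summxE. Qed.

Lemma sqrt_bd_ext m n (F G : nat -> T -> 'M[R]_(m, n)) : sqrt_bd F ->
  (forall k o, F k o = G k o) -> sqrt_bd G.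
Proof.
move=> bF FG; apply: (mbdm_ext bF) => k o; congr (_ *: _).
by apply: eq_bigr => t _; exact: FG.
Qed.

Lemma sqrt_bdD m n (F G : nat -> T -> 'M[R]_(m, n)) : sqrt_bd F -> sqrt_bd G ->
  sqrt_bd (fun k o => F k o + G k o).
Proof.
move=> bF bG; apply: (mbdm_ext (mbdmD bF bG)) => k o.
by rewrite /nsum big_split/= scalerDr.
Qed.

Lemma sqrt_bd_mul m n p q (M : 'M[R]_(m, n)) (G : nat -> T -> 'M[R]_(n, p)) (N : 'M[R]_(p, q)) :
  sqrt_bd G -> sqrt_bd (fun k o => M *m G k o *m N).
Proof.
move=> bG; apply: (mbdm_ext (mbdm_mulr N (mbdm_mull M bG))) => k o.
by rewrite /nsum -scalemxAr -scalemxAl mulmx_sumr mulmx_suml.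
Qed.

Lemma sqrt_bd_tr m n (G : nat -> T -> 'M[R]_(m, n)) : sqrt_bd G ->
  sqrt_bd (fun k o => (G k o)^T).
Proof.
move=> bG; apply: (mbdm_ext (mbdm_tr bG)) => k o.
by rewrite /nsum linearZ/= linear_sum.
Qed.

Lemma sqrt_bd_telescope m n (F : nat -> T -> 'M[R]_(m, n)) :
  mbdm P true (fun=> 0%N) F -> sqrt_bd (fun k o => F k o - F k.+1 o).
Proof.
move=> bF.
have b0 : mbdm P true (fun=> 0%N) (fun (_ : nat) o => F 0%N o).
  by move=> i j; exact: (ubd_comp (fun _ : nat => 0%N) (bF i j)).
apply: (mbdm_ext (mbdmZ (ubd_rt id) (mbdmB b0 bF))) => k o; congr (_ *: _).
by rewrite -(opprB (F k o)) -(telescope_sumr (fun k => F k o) (leq0n k)) -sumrN;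
  apply: eq_bigr => t _; rewrite opprB.
Qed.

End normalized_sums.

Section lln.
Context (R : realType) d (T : measurableType d) (P : probability T R) (dx du H : nat).
Variables (A : 'M[R]_dx) (B : 'M[R]_(dx, du)) (Bw : 'M[R]_dx).
Variables (w : nat -> T -> 'cV[R]_dx) (u : nat -> T -> 'cV[R]_du).
Hypothesis gf : gauss_family P (ncoord w u).
Hypothesis As : spectral_radius A < 1.
Local Notation C := (row_mx B Bw).
Local Notation K := (nat * 'I_(du + dx))%type.
Local Notation g := (ncoord w u).
Local Notation noise := (noise w u).
Local Notation xs := (state A B Bw w u).
Local Notation z := (zvec H A B Bw w u).
Local Notation zimp := (zimp H A B Bw).
Local Notation ubd := (ubd P).
Local Notation rt := (rt R).
Variable Sx : 'M[R]_dx.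
Hypothesis SxE : Sx = A *m Sx *m A^T + C *m C^T.

(** The noise at time t + 1 + i is fresh with respect to x_(t+1), so the terms are martingale
    increments. Times are shifted by one because samples start at t = 1. *)
Lemma sqrt_bd_xv i a k :
  ubd (fun n o => rt n * \sum_(0 <= t < n) xs t.+1 o a 0 * noise (t.+1 + i) o k 0).
Proof.
have := @martingale_ubd R d T P _ g gf (fun t o => xs t.+1 o a 0) (fun s => s)
  (fun t => (t.+1 + i, k)%N) (moms_id R) (normal_mean R).
apply.
- exact: (ubd_comp (fun t : nat => (t.+1, a)) (@ubd_state _ _ _ _ _ _ A B Bw w u gf As)).
- by move=> t s st; apply: state_free0 => /=; lia.
- by move=> t s st; rewrite xpair_eqE negb_and; apply/orP; left; lia.
Qed.

Lemma sqrt_bd_vv_lt i j k l : (j < i)%N || (i == j) && (k != l) ->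
  ubd (fun n o => rt n * \sum_(0 <= t < n) noise (t.+1 + j) o l 0 * noise (t.+1 + i) o k 0).
Proof.
move=> ijkl.
have := @martingale_ubd R d T P _ g gf (fun t o => noise (t.+1 + j) o l 0) (fun s => s)
  (fun t => (t.+1 + i, k)%N) (moms_id R) (normal_mean R).
apply.
- exact: (ubd_comp (fun t : nat => (t.+1 + j, l)%N) (@ubd_noise _ _ _ _ _ _ w u gf)).
- move=> t s st; apply: (@free_gauss _ _ _ _ g _ (s.+1 + j, l)%N).
  rewrite xpair_eqE negb_and; case/orP: ijkl => [ij|/andP[/eqP -> kl]].
    by apply/orP; left; lia.
  by rewrite [l == k]eq_sym kl orbT.
- by move=> t s st; rewrite xpair_eqE negb_and; apply/orP; left; lia.
Qed.

Lemma sqrt_bd_vv i j k l : ubd (fun n o => rt n * \sum_(0 <= t < n)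
  (noise (t.+1 + i) o k 0 * noise (t.+1 + j) o l 0 - ((i == j) && (k == l))%:R)).
Proof.
have [/andP[/eqP <- /eqP <-]|ne] := boolP ((i == j) && (k == l)).
  have mf : moms (@normal_prob R 0 1) (fun s => s ^+ 2 - 1).
    by apply: ubdB; [apply: ubdX; exact: moms_id|exact: ubd_cst1].
  have := @martingale_ubd R d T P _ g gf (fun t o => 1) (fun s => s ^+ 2 - 1)
    (fun t => (t.+1 + i, k)%N) mf (normal_var1 R).
  move=> h; apply: (ubd_ext (h _ _ _)).
  - exact: ubd_cst1.
  - by move=> t s st; exact: free_cst.
  - by move=> t s st; rewrite xpair_eqE negb_and; apply/orP; left; lia.
  - move=> n o; congr (_ * _); apply: eq_bigr => t _.
    by rewrite mul1r expr2.
have [ij|ij|ij] := ltngtP i j.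
- have h := @sqrt_bd_vv_lt j i l k _; rewrite ij in h.
  by apply: (ubd_ext (h isT)) => n o; congr (_ * _); apply: eq_bigr => t _; rewrite subr0.
- have h := @sqrt_bd_vv_lt i j k l _; rewrite ij in h.
  by apply: (ubd_ext (h isT)) => n o; congr (_ * _); apply: eq_bigr => t _; rewrite subr0 mulrC.
- have h := @sqrt_bd_vv_lt i j k l _; rewrite ij ltnn eqxx /= in h.
  rewrite ij eqxx/= in ne; rewrite ij.
  by apply: (ubd_ext (h ne)) => n o; congr (_ * _); apply: eq_bigr => t _; rewrite subr0 mulrC.
Qed.

(** For D_t = x_(t+1) x_(t+1)^T - Sx, the recursion writes D_t - A D_t A^T as a telescoping
    difference plus state-noise cross terms and centred noise products, both martingale sums.
    Inverting the Lyapunov operator recovers D_t. *)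
Lemma sqrt_bd_xx : sqrt_bd P (fun t o => xs t.+1 o *m (xs t.+1 o)^T - Sx).
Proof.
pose D t o : 'M[R]_dx := xs t.+1 o *m (xs t.+1 o)^T - Sx.
pose xv t o : 'M[R]_(dx, du + dx) := xs t.+1 o *m (noise t.+1 o)^T.
pose vv t o : 'M[R]_(du + dx) := noise t.+1 o *m (noise t.+1 o)^T - 1%:M.
have bxv : sqrt_bd P xv.
  apply: sqrt_bd_entry => a k; apply: (ubd_ext (sqrt_bd_xv 0 a k)) => n o.
  by congr (_ * _); apply: eq_bigr => t _; rewrite addn0 !mxE big_ord1 !mxE.
have bvv : sqrt_bd P vv.
  apply: sqrt_bd_entry => k l; apply: (ubd_ext (sqrt_bd_vv 0 0 k l)) => n o.
  by congr (_ * _); apply: eq_bigr => t _; rewrite addn0 !mxE big_ord1 !mxE.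
have bxx : mbdm P true (fun=> 0%N) (fun t o => xs t.+1 o *m (xs t.+1 o)^T).
  have bx : mbdm P true (fun=> 0%N) (fun t o => xs t.+1 o).
    move=> a b; rewrite ord1.
    exact: (ubd_comp (fun t : nat => (t.+1, a)) (@ubd_state _ _ _ _ _ _ A B Bw w u gf As)).
  by apply: mbdm_mul => //; exact: mbdm_tr.
have bF : sqrt_bd P (fun t o => D t o - A *m D t o *m A^T).
  have b1 := sqrt_bd_telescope bxx.
  have b2 := sqrt_bd_mul A C^T bxv.
  have b3 := sqrt_bd_mul C C^T bvv.
  apply: (sqrt_bd_ext (sqrt_bdD (sqrt_bdD b1 (sqrt_bdD b2 (sqrt_bd_tr b2))) b3)) => t o.
  have e1 : xs t.+2 o *m (xs t.+2 o)^T = A *m (xs t.+1 o *m (xs t.+1 o)^T) *m A^T +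
      A *m xv t o *m C^T + (A *m xv t o *m C^T)^T + C *m (noise t.+1 o *m (noise t.+1 o)^T) *m C^T.
    have -> : xs t.+2 o = A *m xs t.+1 o + C *m noise t.+1 o by exact: stateS.
    rewrite /xv; generalize (xs t.+1 o) (noise t.+1 o) (C) => x v M.
    by rewrite raddfD/= !trmx_mul mulmxDl !mulmxDr !trmxK !mulmxA !addrA.
  have e2 : A *m Sx *m A^T = Sx - C *m C^T by rewrite [X in _ = X - _]SxE addrK.
  rewrite e1 /D !mulmxBr !mulmxBl e2.
  rewrite mulmx1.
  have alg (s m1 m3 m4 m4' m5 : 'M[R]_dx) :
    s - (m3 + m4 + m4' + m5) + (m4 + m4') + (m5 - m1) = s - Sx - (m3 - (Sx - m1)).
    by apply/matrixP => i j; rewrite !mxE; ring.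
  exact: alg.
have [c hc] := lyap_solve As.
apply: sqrt_bd_entry => i j.
apply: (ubd_ext (F := fun n o => \sum_a \sum_b c i j a b *
   (rt n * \sum_(0 <= t < n) (D t o - A *m D t o *m A^T) a b))).
  by apply: ubd_sum => a _; apply: ubd_sum => b _; apply: ubdZ; exact: sqrt_bdE.
move=> n o; under [in RHS]eq_bigr do rewrite -/(D _ o) hc.
rewrite [X in _ = _ * X]exchange_big/= mulr_sumr; apply: eq_bigr => a _.
rewrite [X in _ = _ * X]exchange_big/= mulr_sumr; apply: eq_bigr => b _.
by rewrite -mulr_sumr mulrCA.
Qed.

(** The stationary covariance of z_t: x_t is independent of the inputs from time t on, which are
    standard. Its equality with [Sigma_z] is [Sigma_zE]. *)
Definition Sz : 'M[R]_(dx + H * du) := block_mx Sx 0 0 1%:M.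

Lemma SzE : Sz = block_mx Sx 0 0 1%:M. Proof. by []. Qed.

Lemma zE_l t o a : z t o (lshift (H * du) a) 0 = xs t o a 0.
Proof. by rewrite /zvec col_mxEu. Qed.

Lemma zE_r t o j b : z t o (rshift dx (mxtens_index (j, b))) 0 = noise (t + j) o (lshift dx b) 0.
Proof. by rewrite /zvec col_mxEd [LHS]mxE mxtens_indexK /= /noise col_mxEu. Qed.

Lemma sqrt_bd_zz : sqrt_bd P (fun t o => z t.+1 o *m (z t.+1 o)^T - Sz).
Proof.
apply: sqrt_bd_entry => i j.
have E t o : (z t.+1 o *m (z t.+1 o)^T - Sz) i j =
    z t.+1 o i 0 * z t.+1 o j 0 - Sz i j.
  by rewrite mxE [in LHS]mxE big_ord1 [X in _ + X]mxE; congr (_ * _ - _); rewrite mxE.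
apply: (@ubd_ext _ _ _ _ _ _ _ (fun n o => rt n * \sum_(0 <= t < n) (z t.+1 o i 0 * z t.+1 o j 0 - Sz i j))); last first.
  by move=> n o; congr (_ * _); apply: eq_bigr => t _; rewrite E.
rewrite -(fintype.splitK i) -(fintype.splitK j).
case: (fintype.split i) => [a|c]; case: (fintype.split j) => [b|e] /=.
- apply: (ubd_ext (sqrt_bdE a b sqrt_bd_xx)) => n o; congr (_ * _).
  apply: eq_bigr => t _; rewrite !zE_l; have -> : Sz (lshift (H * du) a) (lshift (H * du) b) = Sx a b.
    by rewrite /Sz block_mxEul.
  by rewrite mxE [in LHS]mxE big_ord1 [X in _ + X]mxE; congr (_ * _ - _); rewrite mxE.
- case: (mxtens_indexP e) => j' b.
  apply: (ubd_ext (sqrt_bd_xv j' a (lshift dx b))) => n o; congr (_ * _).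
  by apply: eq_bigr => t _; rewrite zE_l zE_r /Sz block_mxEur [X in _ - X]mxE subr0.
- case: (mxtens_indexP c) => i' b'.
  apply: (ubd_ext (sqrt_bd_xv i' b (lshift dx b'))) => n o; congr (_ * _).
  by apply: eq_bigr => t _; rewrite zE_l zE_r /Sz block_mxEdl [X in _ - X]mxE subr0 mulrC.
case: (mxtens_indexP c) => i' b'; case: (mxtens_indexP e) => j' b.
apply: (ubd_ext (sqrt_bd_vv i' j' (lshift dx b') (lshift dx b))) => n o; congr (_ * _).
apply: eq_bigr => t _; rewrite !zE_r /Sz block_mxEdr [X in _ = _ - X]mxE.
congr (_ - _%:R); rewrite (inj_eq (@lshift_inj _ _)).
by rewrite (inj_eq (can_inj (@mxtens_indexK _ _))) xpair_eqE.
Qed.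

Lemma sqrt_bd_wz i : sqrt_bd P (fun t o => w (t.+1 + i)%N o *m (z t.+1 o)^T).
Proof.
apply: sqrt_bd_entry => a c.
have E t o : (w (t.+1 + i)%N o *m (z t.+1 o)^T) a c = noise (t.+1 + i) o (rshift du a) 0 * z t.+1 o c 0.
  by rewrite mxE big_ord1 [X in _ * X]mxE /noise col_mxEd.
apply: (@ubd_ext _ _ _ _ _ _ _ (fun n o => rt n * \sum_(0 <= t < n) (noise (t.+1 + i) o (rshift du a) 0 * z t.+1 o c 0))); last first.
  by move=> n o; congr (_ * _); apply: eq_bigr => t _; rewrite E.
rewrite -(fintype.splitK c); case: (fintype.split c) => [b|e] /=.
  apply: (ubd_ext (sqrt_bd_xv i b (rshift du a))) => n o; congr (_ * _).
  by apply: eq_bigr => t _; rewrite zE_l mulrC.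
case: (mxtens_indexP e) => j b.
apply: (ubd_ext (sqrt_bd_vv i j (rshift du a) (lshift dx b))) => n o; congr (_ * _).
by apply: eq_bigr => t _; rewrite zE_r eq_rlshift andbF subr0.
Qed.

End lln.

(** * Quadratic forms and determinants *)

Section qforms.
Context (R : realType).

Lemma cauchy_schwarz_sum (I : finType) (a c : I -> R) :
  (\sum_i a i * c i) ^+ 2 <= (\sum_i a i ^+ 2) * \sum_i c i ^+ 2.
Proof.
have : 0 <= \sum_i \sum_j (a i * c j - a j * c i) ^+ 2.
  by do 2 (apply: sumr_ge0 => ? _); exact: sqr_ge0.
have -> : \sum_i \sum_j (a i * c j - a j * c i) ^+ 2 =
   2 * ((\sum_i a i ^+ 2) * (\sum_i c i ^+ 2) - (\sum_i a i * c i) ^+ 2).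
  have e1 : (\sum_i a i ^+ 2) * (\sum_i c i ^+ 2) = \sum_i \sum_j a i ^+ 2 * c j ^+ 2.
    by rewrite mulr_suml; apply: eq_bigr => i _; rewrite mulr_sumr.
  have e2 : (\sum_i a i ^+ 2) * (\sum_i c i ^+ 2) = \sum_i \sum_j a j ^+ 2 * c i ^+ 2.
    by rewrite e1 exchange_big.
  have e3 : (\sum_i a i * c i) ^+ 2 = \sum_i \sum_j (a i * c i) * (a j * c j).
    by rewrite expr2 mulr_suml; apply: eq_bigr => i _; rewrite mulr_sumr.
  rewrite mulrBr mulr2n !mulrDl !mul1r {1}e1 e2 e3 -!big_split/= -sumrB.
  apply: eq_bigr => i _; rewrite -!big_split/= -sumrB; apply: eq_bigr => j _; ring.
lra.
Qed.

Definition sqn n (v : 'rV[R]_n) : R := \sum_i v 0 i ^+ 2.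

Lemma sqn_ge0 n (v : 'rV[R]_n) : 0 <= sqn v.
Proof. by apply: sumr_ge0 => i _; exact: sqr_ge0. Qed.

Lemma sqn_mul n m (v : 'rV[R]_n) (M : 'M[R]_(n, m)) :
  sqn (v *m M) <= sqn v * \sum_i \sum_j M i j ^+ 2.
Proof.
rewrite exchange_big/= mulr_sumr; apply: ler_sum => j _.
by rewrite mxE; exact: cauchy_schwarz_sum.
Qed.

Lemma qform_gram n (v : 'rV[R]_n) (J : Type) (r : seq J) (z : J -> 'cV[R]_n) :
  (v *m (\sum_(t <- r) z t *m (z t)^T) *m v^T) 0 0 = \sum_(t <- r) (v *m z t) 0 0 ^+ 2.
Proof.
rewrite mulmx_sumr mulmx_suml summxE; apply: eq_bigr => t _.
rewrite mulmxA -mulmxA -trmx_mul mxE big_ord1 expr2; congr (_ * _).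
by rewrite mxE.
Qed.

Lemma det_sqn n (v : 'rV[R]_n) (Z : 'M[R]_n) :
  \det Z ^+ 2 * sqn v <= sqn (v *m Z) * (1 + \sum_i \sum_j (\adj Z) i j ^+ 2).
Proof.
have -> : \det Z ^+ 2 * sqn v = sqn (v *m Z *m \adj Z).
  rewrite -mulmxA mul_mx_adj mul_mx_scalar /sqn mulr_sumr.
  by apply: eq_bigr => i _; rewrite mxE exprMn.
apply: le_trans (sqn_mul _ _) _; rewrite ler_wpM2l ?sqn_ge0// lerDr ler01//.
Qed.

End qforms.

Section reindex.
Context (R : realType) d (T : measurableType d) (P : probability T R).

Lemma mbd_reindex b (I : Type) (h h' : I -> nat) (F : I -> T -> R) : mbd P b h F ->
  (forall n0, exists n1, forall i, (n1 <= h' i)%N -> (n0 <= h i)%N) -> mbd P false h' F.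
Proof.
move=> [mF bF] hh; split=> // p; have [c [n0 hc]] := bF p; have [n1 h1] := hh n0.
by exists c, n1 => i /h1 ni; apply: hc; rewrite ni orbT.
Qed.

End reindex.

(** * Persistent excitation of the regressors *)

Section excitation.
Context (R : realType) d (T : measurableType d) (P : probability T R) (dx du H : nat).
Variables (A : 'M[R]_dx) (B : 'M[R]_(dx, du)) (Bw : 'M[R]_dx).
Variables (w : nat -> T -> 'cV[R]_dx) (u : nat -> T -> 'cV[R]_du).
Hypothesis gf : gauss_family P (ncoord w u).
Hypothesis As : spectral_radius A < 1.
Hypothesis Ac : controllable A (row_mx B Bw).
Local Notation K := (nat * 'I_(du + dx))%type.
Local Notation g := (ncoord w u).
Local Notation z := (zvec H A B Bw w u).
Local Notation zimp := (zimp H A B Bw).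

Lemma sum_spaced (F : nat -> R) l tau J n : (forall t, 0 <= F t) -> (tau < l)%N -> (J * l <= n)%N ->
  \sum_(0 <= j < J) F (j * l + tau)%N <= \sum_(0 <= t < n) F t.
Proof.
move=> F0 tl; elim: J n => [|J IH] n Jn; first by rewrite big_geq// sumr_ge0.
rewrite big_nat_recr//= (@big_cat_nat _ _ _ (J * l)%N 0 n)//=; last by lia.
apply: lerD; first exact: IH.
rewrite (@big_cat_nat _ _ _ (J * l + tau)%N (J * l) n)//=; [|lia|lia].
rewrite (@big_ltn _ _ _ (J * l + tau)); last by lia.
by rewrite addrCA lerDl addr_ge0// sumr_ge0.
Qed.

(* In disjoint windows of length l, the vectors z are affine in fresh noises with
   an invertible matrix [Z]; q windows make one block of the small-ball estimate. *)
Lemma excitation : exists mu : nat -> T -> R,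
  [/\ lbd P (fun n o => n%:R / mu n o),
      exists n0, {ae P, forall o, forall n, (n0 <= n)%N -> 0 < mu n o} &
      forall n o (v : 'rV[R]_(dx + H * du)), mu n o * sqn v <=
        (v *m (\sum_(0 <= t < n) z t.+1 o *m (z t.+1 o)^T) *m v^T) 0 0].
Proof.
have [q0|q0] := posnP (dx + H * du).
  (* Without coordinates both sides of the last inequality vanish, and mu = n keeps n / mu
     bounded. *)
  exists (fun n _ => n%:R); split.
  - apply: ubd_mbd; apply: (@ubd_cst _ _ _ _ _ _ _ _ 1) => n.
    case: n => [|n]; first by rewrite mul0r normr0.
    by rewrite divff ?normr1// pnatr_eq0.
  - by exists 1%N; apply: aeW => o n; rewrite ltr0n.
  - move=> n o v; rewrite qform_gram.
    have -> : sqn v = 0.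
      by rewrite /sqn big1// => i; have := ltn_ord i; rewrite {2}q0.
    by rewrite mulr0 sumr_ge0// => t _; exact: sqr_ge0.
have [tau [f [ftau fU]]] := zimp_span H Ac.
set Z := (\matrix_(i, j) _) in fU.
(* The vector z_(s j + tau) only involves noises before time s j + tau + H. As l exceeds tau + H,
   these precede all the noises chosen in later windows. *)
pose q := (dx + H * du)%N; pose l := (tau + H).+1.
pose i0 : 'I_q := Ordinal q0.
(* From M Z^T = 1, coordinate i of M z_(s j + tau) has slope 1 in its own noise [kp j i] and slope 0
   in the noises assigned to the other coordinates. *)
pose M := invmx Z^T.
have MZ : M *m Z^T = 1%:M by rewrite mulVmx// unitmx_tr.
pose s j := (j * l).+1.
pose kp (j i : nat) : K := ((s j + (f (insubd i0 i)).1)%N, (f (insubd i0 i)).2).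
pose zt (j i : nat) (o : T) : R := (M *m z (s j + tau) o) (insubd i0 i) 0.
have idK i (iq : (i < q)%N) : insubd i0 i = Ordinal iq.
  by apply: val_inj; rewrite val_insubd iq.
have ztE j i i' : free g (kp j i') (fun o => zt j i o - g (kp j i') o * (insubd i0 i == insubd i0 i')%:R).
  apply: (@free_ext _ _ _ _ _ _ (fun o => \sum_c M (insubd i0 i) c *
     (z (s j + tau) o c 0 - g (kp j i') o * zimp tau (f (insubd i0 i')) c 0))).
    apply: free_sum => c _; apply: freeM; first exact: free_cst.
    have := @zvec_free _ _ _ dx du H A B Bw w u (kp j i') (s j + tau) c.
    have -> // : zimp (s j + tau) (kp j i') = zimp tau (f (insubd i0 i')).
    by rewrite /kp zimp_shift; case: (f _).
  move=> o; have -> : (insubd i0 i == insubd i0 i')%:R = (M *m Z^T) (insubd i0 i) (insubd i0 i').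
    by rewrite MZ [RHS]mxE.
  rewrite /zt ![(M *m _) _ _]mxE mulr_sumr -sumrB; apply: eq_bigr => c _.
  by rewrite [Z^T _ _]mxE [Z _ _]mxE; ring.
have zt1 j i : (i < q)%N -> free g (kp j i) (fun o => zt j i o - g (kp j i) o).
  by move=> iq; apply: (free_ext (ztE j i i)) => o; rewrite eqxx mulr1.
have zt2 j i i' : (i < q)%N -> (i' < q)%N -> i' != i -> free g (kp j i) (zt j i').
  move=> iq iq' ne; apply: (free_ext (ztE j i' i)) => o.
  by rewrite !idK -val_eqE/= (negbTE ne) mulr0 subr0.
have zt3 j j' i i' : (j' < j)%N -> (i < q)%N -> (i' < q)%N -> free g (kp j i) (zt j' i').
  move=> jj iq iq'; apply: (@free_ext _ _ _ _ _ _ (fun o => \sum_c M (insubd i0 i') c * z (s j' + tau) o c 0)).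
    apply: free_sum => c _; apply: freeM; first exact: free_cst.
    apply: zvec_free0; rewrite /kp/=.
    have : (j'.+1 * l <= j * l)%N by rewrite leq_mul2r jj orbT.
    by rewrite /s /l; lia.
  by move=> o; rewrite /zt [RHS]mxE.
have bz : ubd P (fun (ji : nat * nat) => zt ji.1 ji.2).
  have b1 : ubd P (fun (ji : nat * nat) o => \sum_c `|\sum_a M c a * z (s ji.1 + tau) o a 0|).
    apply: ubd_sum => c _; apply: ubd_norm; apply: ubd_sum => a _; apply: ubdZ.
    exact: (ubd_comp (fun ji : nat * nat => (s ji.1 + tau, a)%N) (@ubd_zvec _ _ _ _ _ _ H A B Bw w u gf As)).
  apply: (ubd_le _ b1) => [[j i]|[j i] o] /=.
    rewrite /zt (_ : (fun o => _) = (fun o => \sum_a M (insubd i0 i) a * z (s j + tau) o a 0)).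
      apply: measurable_sum => a; apply: measurable_funM => //.
      exact: (ubd_meas ((s j + tau)%N, a) (@ubd_zvec _ _ _ _ _ _ H A B Bw w u gf As)).
    by apply/funext => o; rewrite mxE.
  rewrite [leRHS]ger0_norm ?sumr_ge0// (bigD1 (insubd i0 i))//=.
  by rewrite /zt [in leLHS]mxE lerDl sumr_ge0.
(* One plus the squared Frobenius norm of M: [sqn v] is at most [kap] times [sqn] of v M^-1, the
   price of the change of coordinates. *)
pose kap : R := 1 + \sum_i \sum_j M i j ^+ 2.
have kap0 : 0 < kap.
  by rewrite ltr_pwDl ?ltr01// sumr_ge0// => i _; rewrite sumr_ge0// => j _; exact: sqr_ge0.
pose rr n := (n %/ (q * l))%N.
have ql0 : (0 < q * l)%N by rewrite muln_gt0 q0.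
pose mu n o := kap^-1 * mun q zt (rr n) o.
exists mu; split.
- have b1 : mbd P false id (fun n o => (rr n)%:R / mun q zt (rr n) o).
    apply: (mbd_reindex (ubd_comp rr (mun_ubd gf zt1 zt2 zt3 bz))) => n0.
    by exists (n0 * (q * l))%N => n hn /=; rewrite leq_divRL.
  have b2 : mbd P false id (fun n (_ : T) => kap * (n%:R / (rr n)%:R)).
    apply: (@ubd_cst _ _ _ _ _ _ _ _ (kap * (2 * (q * l)%:R))) => n.
    rewrite ger0_norm ?mulr_ge0 ?(ltW kap0)// ler_wpM2l ?(ltW kap0)//.
    have [->|r0] := posnP (rr n); first by rewrite invr0 mulr0 mulr_ge0.
    rewrite ler_pdivrMr ?ltr0n// -!natrM ler_nat.
    have := ltn_ceil n ql0; rewrite -/(rr n) mulSn => h.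
    by move: h r0; generalize (rr n) (q * l)%N => a c; nia.
  apply: (ubd_ext (ubdM b2 b1)) => n o; rewrite /mu.
  have [->|r0] := posnP (rr n); first by rewrite /mun big_geq// invr0 !mulr0 invr0 mulr0.
  rewrite invfM invrK; have : (rr n)%:R != 0 :> R by rewrite pnatr_eq0 -lt0n.
  have alg (a m b k : R) : a != 0 -> k * (b / a) * (a * m) = b * (k * m) by move=> a0; field.
  exact: alg.
- exists (q * l)%N; have := Dm_neq0_all gf zt1 zt2 zt3 bz; apply: filterS => o hD n hn.
  rewrite /mu mulr_gt0 ?invr_gt0// /mun big_ltn; last by rewrite /rr divn_gt0.
  rewrite ltr_pwDl//; last by apply: sumr_ge0 => r _; exact: mum_ge0.
  by rewrite /mum divr_gt0 ?Am_gt0// exprn_even_gt0//= hD.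
move=> n o v; rewrite qform_gram.
pose F t := (v *m z t.+1 o) 0 0 ^+ 2; rewrite -[leRHS]/(\sum_(0 <= t < n) F t).
apply: (@le_trans _ _ (\sum_(0 <= j < rr n * q) F (j * l + tau)%N)); last first.
  apply: sum_spaced => [t||]; [exact: sqr_ge0|by rewrite /l; lia|].
  by rewrite -mulnA /rr leq_trunc_div.
have -> : \sum_(0 <= j < rr n * q) F (j * l + tau)%N =
    \sum_(0 <= r < rr n) \sum_(c < q) F ((r * q + c) * l + tau)%N.
  elim: (rr n) => [|r IH]; first by rewrite !big_geq.
  rewrite big_nat_recr//= -IH (@big_cat_nat _ _ _ (r * q)%N)//=; last by lia.
  congr (_ + _); rewrite -{1}[(r * q)%N]add0n big_addn mulSn addnK big_mkord.
  by apply: eq_bigr => c _; rewrite [(c + _)%N]addnC.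
have -> : mu n o * sqn v = \sum_(0 <= r < rr n) kap^-1 * mum q zt r o * sqn v.
  by rewrite -mulr_suml -mulr_sumr.
apply: ler_sum => r _.
have -> : \sum_(c < q) F ((r * q + c) * l + tau)%N = sqn (v *m invmx M *m minor_mx q zt r q o).
  apply: eq_bigr => c _; rewrite /F; congr (_ ^+ 2).
  have : col c (minor_mx q zt r q o) = M *m z ((r * q + c) * l + tau).+1 o.
    apply/matrixP => a b; rewrite ord1 [LHS]mxE [LHS]mxE /zt /s addSn.
    by rewrite (_ : insubd i0 a = a)//; apply: val_inj; rewrite val_insubd ltn_ord.
  have MU : M \in unitmx by rewrite unitmx_inv unitmx_tr.
  move=> h; have -> : (v *m invmx M *m minor_mx q zt r q o) 0 c = (v *m invmx M *m col c (minor_mx q zt r q o)) 0 0.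
    by rewrite colE mulmxA -colE [RHS]mxE.
  by rewrite h mulmxA mulmxKV.
have := det_sqn (v *m invmx M) (minor_mx q zt r q o).
have MU : M \in unitmx by rewrite unitmx_inv unitmx_tr.
have := sqn_mul (v *m invmx M) M; rewrite mulmxKV// => h1.
rewrite -/(Dm q zt r q o) -/(Am q zt r o) /mum.
have := Am_gt0 q zt r o; have := sqr_ge0 (Dm q zt r q o).
move: h1; have := sqn_ge0 (v *m invmx M).
rewrite (_ : \sum_i _ = kap - 1); last by rewrite /kap addrAC subrr add0r.
have alg (D2 a v' vv y k : R) : 0 < k -> 0 <= v' -> vv <= v' * (k - 1) -> 0 <= D2 -> 0 < a ->
    D2 * v' <= y * a -> k^-1 * (D2 / a) * vv <= y.
  move=> k0 v0 h1 D0 a0 h2.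
  rewrite [leLHS](_ : _ = D2 * vv / (k * a)); last by rewrite invfM; ring.
  rewrite ler_pdivrMr ?mulr_gt0//.
  apply: (@le_trans _ _ (D2 * (v' * k))).
    by rewrite ler_wpM2l//; apply: le_trans h1 _; rewrite ler_wpM2l//; lra.
  rewrite mulrA mulrC [leRHS](_ : _ = k * (y * a)); last by ring.
  by rewrite ler_wpM2l// ltW.
exact: alg.
Qed.

End excitation.

(** * Least squares *)

Section least_squares.
Context (R : realType).

Lemma fnorm_sqr m n (M : 'M[R]_(m, n)) : fnorm M ^+ 2 = \sum_i \sum_j M i j ^+ 2.
Proof. by rewrite sqr_sqrtr// sumr_ge0// => i _; rewrite sumr_ge0// => j _; exact: sqr_ge0. Qed.

Lemma fnorm_tr m n (M : 'M[R]_(m, n)) : fnorm M ^+ 2 = \tr (M *m M^T).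
Proof.
rewrite fnorm_sqr; apply: eq_bigr => i _; rewrite mxE; apply: eq_bigr => j _.
by rewrite mxE expr2.
Qed.

(** A quadratic polynomial that is minimal at 0 has no linear term: e = a / (|b| + 1) is small
    enough for a nonzero linear term to win. *)
Lemma quad_min_eq0 (a b : R) : (forall e, 0 <= e ^+ 2 * b - 2 * (e * a)) -> a = 0.
Proof.
move=> h; have := h (a / (`|b| + 1)); set c := `|b| + 1.
have c0 : 0 < c by rewrite ltr_wpDl.
have cb : b <= c - 1 by rewrite /c addrK ler_norm.
move=> h1; have h2 : 0 <= a ^+ 2 * b - 2 * (a ^+ 2 * c).
  have -> : a ^+ 2 * b - 2 * (a ^+ 2 * c) = c ^+ 2 * ((a / c) ^+ 2 * b - 2 * (a / c * a)).
    by field; rewrite gt_eqF.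
  by rewrite mulr_ge0// sqr_ge0.
have h3 : a ^+ 2 * b <= a ^+ 2 * (c - 1) by rewrite ler_wpM2l// sqr_ge0.
have h4 : a ^+ 2 * 1 <= a ^+ 2 * c by rewrite ler_wpM2l ?sqr_ge0// /c lerDr.
have : a ^+ 2 = 0 by apply/eqP; rewrite eq_le sqr_ge0 andbT; nra.
by move/eqP; rewrite sqrf_eq0 => /eqP.
Qed.

Lemma tr_sub_sqr m n (a b : 'M[R]_(m, n)) (e : R) : \tr ((a - e *: b) *m (a - e *: b)^T) =
  \tr (a *m a^T) + e ^+ 2 * \tr (b *m b^T) - 2 * (e * \tr (a *m b^T)).
Proof.
rewrite -!fnorm_tr !fnorm_sqr [\tr (a *m b^T)](_ : _ = \sum_i \sum_j a i j * b i j).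
  rewrite !mulr_sumr -big_split/= -sumrB; apply: eq_bigr => i _.
  rewrite !mulr_sumr -big_split/= -sumrB; apply: eq_bigr => j _.
  by rewrite !mxE; ring.
by apply: eq_bigr => i _; rewrite mxE; apply: eq_bigr => j _; rewrite mxE.
Qed.

(* Only minimality is used, along the ray in the direction of the gradient. *)
Lemma lsq_normal m p (r : seq nat) (Y : nat -> 'cV[R]_m) (z : nat -> 'cV[R]_p) (G : 'M[R]_(m, p)) :
  (forall G' : 'M[R]_(m, p), \sum_(t <- r) fnorm (Y t - G *m z t) ^+ 2 <=
     \sum_(t <- r) fnorm (Y t - G' *m z t) ^+ 2) ->
  G *m (\sum_(t <- r) z t *m (z t)^T) = \sum_(t <- r) Y t *m (z t)^T.
Proof.
move=> hG; pose D : 'M[R]_(m, p) := \sum_(t <- r) (Y t - G *m z t) *m (z t)^T.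
suff D0 : D = 0.
  have -> : \sum_(t <- r) Y t *m (z t)^T = D + G *m (\sum_(t <- r) z t *m (z t)^T).
    rewrite /D mulmx_sumr -big_split/=; apply: eq_bigr => t _.
    by rewrite mulmxBl mulmxA subrK.
  by rewrite D0 add0r.
suff : \tr (D *m D^T) = 0.
  rewrite -fnorm_tr fnorm_sqr => h; apply/matrixP => i j; rewrite [RHS]mxE; apply/eqP.
  move/eqP: h; rewrite psumr_eq0 => [/allP h|k _]; last first.
    by rewrite sumr_ge0// => l _; exact: sqr_ge0.
  have := h i (mem_index_enum _); rewrite psumr_eq0 => [/allP h'|k _]; last exact: sqr_ge0.
  by have := h' j (mem_index_enum _); rewrite sqrf_eq0.
apply: (@quad_min_eq0 _ (\sum_(t <- r) fnorm (D *m z t) ^+ 2)) => e.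
have := hG (G + e *: D); rewrite -subr_ge0 -sumrB.
have -> // : \sum_(t <- r) (fnorm (Y t - (G + e *: D) *m z t) ^+ 2 - fnorm (Y t - G *m z t) ^+ 2) =
   e ^+ 2 * (\sum_(t <- r) fnorm (D *m z t) ^+ 2) - 2 * (e * \tr (D *m D^T)).
have -> : \tr (D *m D^T) = \sum_(t <- r) \tr ((Y t - G *m z t) *m (D *m z t)^T).
  rewrite {1}/D mulmx_suml raddf_sum/=; apply: eq_bigr => t _.
  by rewrite trmx_mul mulmxA.
rewrite !mulr_sumr -sumrB; apply: eq_bigr => t _.
rewrite mulmxDl -scalemxAl opprD addrA !fnorm_tr.
by rewrite tr_sub_sqr; ring.
Qed.

(** For a row v of the error, v S = w gives mu |v|^2 <= v S v^T = w v^T, which is at most the l^1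
    norm of w times |v|; divide by |v|. *)
Lemma energy_bound p (v w : 'rV[R]_p) (mu : R) j : 0 < mu ->
  mu * sqn v <= \sum_l w 0 l * v 0 l -> mu * `|v 0 j| <= \sum_l `|w 0 l|.
Proof.
move=> mu0 h; pose r := Num.sqrt (sqn v).
have rE : r ^+ 2 = sqn v by rewrite sqr_sqrtr// sqn_ge0.
have r0 : 0 <= r by exact: sqrtr_ge0.
have vr l : `|v 0 l| <= r.
  rewrite -(@ler_pXn2r _ 2%N) ?nnegrE// rE real_normK ?num_real//.
  by rewrite /sqn (bigD1 l)//= lerDl sumr_ge0// => k _; exact: sqr_ge0.
have hb : \sum_l w 0 l * v 0 l <= (\sum_l `|w 0 l|) * r.
  rewrite mulr_suml; apply: ler_sum => l _; apply: le_trans (ler_norm _) _.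
  by rewrite normrM ler_wpM2l.
have := le_trans h hb; rewrite -rE expr2 mulrA.
have [r00|rp] := eqVneq r 0.
  move=> _; have := vr j; rewrite r00 normr_le0 => /eqP ->.
  by rewrite normr0 mulr0 sumr_ge0.
rewrite ler_pM2r; last by rewrite lt_neqAle eq_sym rp.
by apply: le_trans; rewrite ler_wpM2l// ltW.
Qed.

End least_squares.

(** * Expansion of a least-squares error *)

Section regression.
Context (R : realType) d (T : measurableType d) (P : probability T R) (m p : nat).
Variables (zeta : nat -> T -> 'cV[R]_p) (e : nat -> T -> 'cV[R]_m) (Sg : 'M[R]_p).
Variables (mu : nat -> T -> R) (n0 : nat) (Th : nat -> T -> 'M[R]_(m, p)).
Local Notation rt := (rt R).
Local Notation lbdm := (mbdm P false id).
Let S n o := \sum_(0 <= t < n) zeta t o *m (zeta t o)^T.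
Let w n o := \sum_(0 <= t < n) e t o *m (zeta t o)^T.
Let D := nsum (fun t o => zeta t o *m (zeta t o)^T - Sg).
Let W := nsum (fun t o => e t o *m (zeta t o)^T).
Hypothesis bD : sqrt_bd P (fun t o => zeta t o *m (zeta t o)^T - Sg).
Hypothesis bW : sqrt_bd P (fun t o => e t o *m (zeta t o)^T).
Hypothesis SgU : Sg \in unitmx.
Hypothesis bmu : lbd P (fun n o => n%:R / mu n o).
Hypothesis mu_gt0 : {ae P, forall o, forall n, (n0 <= n)%N -> 0 < mu n o}.
Hypothesis muS : forall n o (v : 'rV[R]_p), mu n o * sqn v <= (v *m S n o *m v^T) 0 0.
Hypothesis mTh : forall n, measurable_mx (Th n).
Hypothesis Th0 : forall n o, (n < n0)%N -> Th n o = 0.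
Hypothesis ThE : forall n, (n0 <= n)%N -> {ae P, forall o, Th n o *m S n o = w n o}.

Definition root_err n o : 'M[R]_(m, p) := Num.sqrt n%:R *: Th n o.
Local Notation X := root_err.

Lemma sqrt_rt n : (0 < n)%N -> Num.sqrt n%:R * rt n = 1.
Proof. by move=> n0'; rewrite rtE divff// gt_eqF// sqrtr_gt0 ltr0n. Qed.

(** By [energy_bound], sqrt n |Th i j| is at most n / mu times the l^1 norm of row i of W, a product
    of two controlled families. This a priori bound is what makes the remainder of the expansion
    controllable. *)
Lemma root_err_lbd : lbdm X.
Proof.
move=> i j.
have bb : lbd P (fun n o => n%:R / mu n o * \sum_l `|W n o i l|).
  by apply: ubdM => //; apply: ubd_sum => l _; apply: ubd_norm; apply: ubd_mbd; exact: bW.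
apply: (ubd_ae_le _ bb) => n.
  rewrite (_ : (fun o => _) = (fun o => Num.sqrt n%:R * Th n o i j)).
    by apply: measurable_funM => //; exact: mTh.
  by apply/funext => o; rewrite mxE.
have [nn|nn] := ltnP n n0.
  by apply: aeW => o; rewrite /X Th0// scaler0 mxE normr0.
have := mu_gt0; have := ThE nn; apply: filterS2 => o h1 /(_ _ nn) m0.
have hb : mu n o * `|Th n o i j| <= \sum_l `|w n o i l|.
  have := @energy_bound R p (row i (Th n o)) (row i (w n o)) (mu n o) j m0.
  have hb0 : mu n o * sqn (row i (Th n o)) <= \sum_l row i (w n o) 0 l * row i (Th n o) 0 l.
    apply: le_trans (muS _ _ _) _; rewrite -row_mul h1 mxE; apply: ler_sum => l _.
    by rewrite [_^T _ _]mxE.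
  by move/(_ hb0); rewrite mxE; under [X in _ <= X -> _]eq_bigr do rewrite mxE.
have wW l : `|W n o i l| = rt n * `|w n o i l|.
  by rewrite /W /nsum mxE normrM (ger0_norm (rt_ge0 _ _)).
under [in leRHS]eq_bigr do rewrite wW.
rewrite -mulr_sumr [leRHS]ger0_norm; last first.
  by rewrite mulr_ge0 ?divr_ge0 ?(ltW m0)// mulr_ge0 ?rt_ge0// sumr_ge0.
rewrite mxE normrM (ger0_norm (sqrtr_ge0 _)).
have [->|np] := posnP n; first by rewrite sqrtr0 !mul0r.
have alg (s r k m' b t : R) : k = s ^+ 2 -> s * r = 1 -> 0 <= s -> 0 < m' -> m' * t <= b ->
    s * t <= k / m' * (r * b).
  move=> -> sr s0 mp hb'; rewrite expr2 [leRHS](_ : _ = (s * r) * s * b / m'); last by ring.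
  by rewrite sr mul1r ler_pdivlMr// -mulrA ler_wpM2l// mulrC.
by apply: alg; rewrite ?sqrt_rt// sqr_sqrtr.
Qed.

(* From Th S = w with S = n Sg + sqrt n D: the error is the main term
   n^(-1/2) w Sg^-1 up to n^(-1/2) times this remainder. *)
Definition root_rem n o : 'M[R]_(m, p) := - (X n o *m D n o *m invmx Sg).

Lemma root_rem_lbd : lbdm root_rem.
Proof.
apply: mbdmN; apply: mbdm_mulr; apply: mbdm_mul; first exact: root_err_lbd.
by move=> i j; apply: ubd_mbd; exact: bD.
Qed.

Lemma root_errE n : (n0 <= n)%N -> (0 < n)%N ->
  {ae P, forall o, X n o = W n o *m invmx Sg + rt n *: root_rem n o}.
Proof.
move=> nn np; have := ThE nn; apply: filterS => o h1.
rewrite -[LHS](mulmxK SgU) -[RHS](mulmxK SgU); congr (_ *m _).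
rewrite mulmxDl (mulmxKV SgU) -[(rt n *: _) *m Sg]scalemxAl /root_rem mulNmx (mulmxKV SgU).
have -> : W n o = rt n *: (Th n o *m S n o) by rewrite h1.
have -> : S n o = n%:R *: Sg + Num.sqrt n%:R *: D n o.
  rewrite /D /nsum scalerA sqrt_rt// scale1r sumrB sumr_const_nat subn0 scaler_nat.
  by rewrite addrC subrK.
rewrite /X -!scalemxAl mulmxDr -!scalemxAr scalerDr !scalerA scalerN scalerA.
rewrite addrK.
congr (_ *: _); rewrite mulrC -{2}(@sqr_sqrtr _ n%:R)// expr2 -mulrA sqrt_rt// mulr1//.
Qed.

End regression.

(** * Limits at speed n^(-1/2) *)

Section rates.
Context (R : realType).
Local Notation rt := (rt R).

Definition rate (a : nat -> R) (l : R) : Prop :=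
  exists (c : R) (n0 : nat), forall n, (n0 <= n)%N -> `|a n - l| <= c * rt n.

Lemma rate_cst l : rate (fun=> l) l.
Proof. by exists 0, 0%N => n _; rewrite subrr normr0 mul0r. Qed.

Lemma rate_ext n0 a a' l : rate a l -> (forall n, (n0 <= n)%N -> a n = a' n) -> rate a' l.
Proof.
move=> [c [n1 h]] e; exists c, (maxn n0 n1) => n; rewrite geq_max => /andP[h1 h2].
by rewrite -e//; exact: h.
Qed.

Lemma rateD a b l k : rate a l -> rate b k -> rate (fun n => a n + b n) (l + k).
Proof.
move=> [c [n1 h]] [c' [n1' h']]; exists (c + c'), (maxn n1 n1') => n; rewrite geq_max => /andP[h1 h2].
rewrite opprD addrACA mulrDl; apply: le_trans (ler_normD _ _) _.
by apply: lerD; [exact: h|exact: h'].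
Qed.

Lemma rateZ x a l : rate a l -> rate (fun n => x * a n) (x * l).
Proof.
move=> [c [n1 h]]; exists (`|x| * c), n1 => n /h hn.
by rewrite -mulrBr normrM -mulrA ler_wpM2l.
Qed.

Lemma rate_sum J (r : seq J) (a : J -> nat -> R) (l : J -> R) :
  (forall j, rate (a j) (l j)) -> rate (fun n => \sum_(j <- r) a j n) (\sum_(j <- r) l j).
Proof.
move=> h; elim: r => [|j r IH].
  by rewrite big_nil; apply: (rate_ext (n0 := 0) (rate_cst 0)) => n _; rewrite big_nil.
rewrite big_cons; apply: (rate_ext (n0 := 0) (rateD (h j) IH)) => n _.
by rewrite big_cons.
Qed.

Lemma rt_cvg0 : rt n @[n --> \oo] --> (0 : R).
Proof.
apply/cvgrPdist_lt => eps eps0.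
have [k hk] := ltr_add_invr (y := 0) (x := eps ^+ 2) ltac:(by rewrite exprn_gt0).
near=> n; rewrite sub0r normrN ger0_norm ?rt_ge0//.
have n0 : (k.+1 <= n)%N by near: n; exists k.+1.
have np : 0 < Num.sqrt n%:R :> R by rewrite sqrtr_gt0 ltr0n; lia.
rewrite -(@ltr_pXn2r _ 2%N) ?nnegrE ?rt_ge0 ?ltW// rtE exprVn sqr_sqrtr//.
rewrite add0r in hk; apply: le_lt_trans hk.
by rewrite lef_pV2 ?posrE ?ltr0n ?ler_nat//; lia.
Unshelve. all: by end_near. Qed.

Lemma rate_cvg a l : rate a l -> a n @[n --> \oo] --> l.
Proof.
move=> [c [n0 h]]; apply/cvgrPdist_le.
have hc : c * rt n @[n --> \oo] --> (0 : R).
  by rewrite -[X in _ --> X](mulr0 c); apply: cvgM; [exact: cvg_cst|exact: rt_cvg0].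
move=> eps eps0; move/cvgrPdist_le : hc => /(_ _ eps0) hc.
near=> n; rewrite distrC.
have h1 : `|a n - l| <= c * rt n by apply: h; near: n; exists n0.
apply: le_trans h1 _; apply: le_trans (ler_norm _) _.
rewrite -normrN -sub0r; near: n; exact: hc.
Unshelve. all: by end_near. Qed.

Lemma invn_rt n : n%:R^-1 = rt n * rt n.
Proof. by rewrite rtE -invfM -expr2 sqr_sqrtr. Qed.

Lemma invn_le_rt n : n%:R^-1 <= rt n.
Proof. by rewrite invn_rt ler_piMr ?rt_ge0 ?rt_le1. Qed.

(* An estimator fitted to [n + k] samples uses only [n] regression terms. *)
Lemma rate_shift a l k : rate a l -> rate (fun n => (n + k)%:R / n%:R * a n) l.
Proof.
move=> [c [n0 h]]; exists (`|c| + k%:R * (`|l| + `|c|)), (maxn 1 n0) => n.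
rewrite geq_max => /andP[n1 hn].
have c1 : `|a n - l| <= `|c| * rt n.
  by apply: le_trans (h n hn) _; rewrite ler_wpM2r ?rt_ge0 ?ler_norm.
have a1 : `|a n| <= `|l| + `|c|.
  rewrite -[a n](subrK l) addrC; apply: le_trans (ler_normD _ _) _.
  by rewrite lerD2l; apply: le_trans c1 _; rewrite ler_piMr ?rt_le1.
rewrite (_ : _ - l = (a n - l) + k%:R * (n%:R^-1 * a n)); last first.
  by rewrite natrD mulrDl divff ?pnatr_eq0; [ring|lia].
apply: le_trans (ler_normD _ _) _; rewrite mulrDl; apply: lerD => //.
rewrite normrM ger0_norm// -mulrA ler_wpM2l// normrM mulrC (ger0_norm (_ : 0 <= n%:R^-1)) ?invr_ge0//.
by apply: ler_pM => //; rewrite ?invr_ge0 ?invn_le_rt.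
Qed.

Context d (T : measurableType d) (P : probability T R).

(** The remainder is integrable only for large n, and the expectation of F may be infinite before
    that; hence a real sequence [a] that equals it eventually. *)
Lemma expectation_rate n0 (F M Rem : nat -> T -> R) (l : R) : (forall n, measurable_fun setT (F n)) ->
  ubd P M -> lbd P Rem ->
  (forall n, (n0 <= n)%N -> {ae P, forall o, F n o = M n o + rt n * Rem n o}) ->
  rate (fun n => ex P (M n)) l ->
  exists a n1, rate a l /\ forall n, (n1 <= n)%N -> (\int[P]_o (F n o)%:E)%E = (a n)%:E.
Proof.
move=> mF bM bR FE rM.
have [n1 iR] := ubd_int bR; have [_ /(_ 1%N)[c [n2 hc]]] := bR.
pose a n := ex P (M n) + rt n * ex P (Rem n).
exists a, (maxn n0 n1); split.
  rewrite -[l]addr0; apply: rateD => //.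
  exists c, (maxn n1 n2) => n; rewrite geq_max => /andP[h1 h2].
  rewrite subr0 normrM ger0_norm ?rt_ge0// mulrC ler_wpM2r ?rt_ge0//.
  have iRn : P.-integrable setT (EFin \o Rem n) by apply: iR.
  rewrite -lee_fin /ex -fine_abse ?(integrable_fin_num _ iRn)// fineK; last first.
    by rewrite abse_fin_num (integrable_fin_num _ iRn).
  have [mR _] := integrableP _ _ _ iRn.
  apply: le_trans (le_abse_integral P measurableT mR) _.
  suff -> : (\int[P]_x `|(EFin \o Rem n) x| = \int[P]_o (`|Rem n o| ^+ 1)%:E)%E by exact: hc.
  by apply: eq_integral => o _; rewrite expr1.
move=> n; rewrite geq_max => /andP[h1 h2].
have iRn : P.-integrable setT (EFin \o Rem n) by apply: iR.
have iMn := moms_int (ubd_moms n bM).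
rewrite (@ae_eq_integral _ _ _ P setT (fun o => (M n o)%:E + (rt n)%:E * (Rem n o)%:E)%E (fun o => (F n o)%:E))//; first last.
- have := FE n h1; apply: filterS => o h _; by rewrite h EFinD EFinM.
- apply: emeasurable_funD; first by apply/measurable_EFinP; exact: (ubd_meas n bM).
  by apply: emeasurable_funM => //; apply/measurable_EFinP; exact: (ubd_meas n bR).
- exact/measurable_EFinP.
rewrite integralD//; last exact: integrableZl.
rewrite integralZl// exE ?ubd_moms//; last exact: ubd_moms bM.
have -> : (\int[P]_o (Rem n o)%:E)%E = (ex P (Rem n))%:E.
  by rewrite /ex fineK// (integrable_fin_num _ iRn).
by rewrite -EFinM -EFinD.
Qed.

End rates.

(** * Second moments of the noise-regressor sums *)

Section second_moments.
Context (R : realType) d (T : measurableType d) (P : probability T R) (dx du H : nat).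
Variables (A : 'M[R]_dx) (B : 'M[R]_(dx, du)) (Bw : 'M[R]_dx).
Variables (w : nat -> T -> 'cV[R]_dx) (u : nat -> T -> 'cV[R]_du).
Hypothesis gf : gauss_family P (ncoord w u).
Hypothesis As : spectral_radius A < 1.
Local Notation C := (row_mx B Bw).
Local Notation K := (nat * 'I_(du + dx))%type.
Local Notation g := (ncoord w u).
Local Notation noise := (noise w u).
Local Notation xs := (state A B Bw w u).
Local Notation z := (zvec H A B Bw w u).
Local Notation rt := (rt R).
Local Notation ex := (ex P).
Local Notation q := (dx + H * du)%N.
Variable Sx : 'M[R]_dx.
Hypothesis SxE : Sx = A *m Sx *m A^T + C *m C^T.
Hypothesis SxU : Sx \in unitmx.
Local Notation Sz := (Sz du H Sx).

Lemma rate_drop (f : nat -> R) c l m : (forall t, `|f t| <= c) ->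
  rate (fun n => n%:R^-1 * \sum_(0 <= t < n) f t) l ->
  rate (fun n => n%:R^-1 * \sum_(0 <= t < n - m) f t) l.
Proof.
move=> fc [c' [n0 h]]; have c0 : 0 <= c by exact: le_trans (fc 0%N).
exists (c' + m%:R * c), (maxn m n0) => n; rewrite geq_max => /andP[mn nn].
have -> : \sum_(0 <= t < n - m) f t = \sum_(0 <= t < n) f t - \sum_(n - m <= t < n) f t.
  by rewrite (@big_cat_nat _ _ _ (n - m)%N 0 n)//= ?leq_subr// addrK.
rewrite mulrBr addrAC mulrDl; apply: le_trans (ler_normB _ _) _.
apply: lerD; first exact: h.
rewrite normrM ger0_norm ?invr_ge0// mulrC ler_pM// ?invr_ge0//; last exact: invn_le_rt.
apply: le_trans (ler_norm_sum _ _ _) _.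
apply: le_trans (ler_sum _ (fun t _ => fc t)) _.
by rewrite sumr_const_nat subKn// mulr_natl.
Qed.

(** In contrast with the inputs, w_k does not enter z_t for any t <= k, even if k < t + H. *)
Lemma zvec_free_w k a t c : (t <= k)%N -> free g (k, rshift du a) (fun o => z t o c 0).
Proof.
move=> tk; apply: (free_ext (@zvec_free _ _ _ _ _ H A B Bw w u (k, rshift du a) t c)) => o.
have -> : zimp H A B Bw t (k, rshift du a) = 0.
  rewrite /zimp /ximp /= ltnNge tk/=.
  apply/matrixP => e b; rewrite [RHS]mxE -(fintype.splitK e); case: (fintype.split e) => [a'|f] /=.
    by rewrite col_mxEu mxE.
  rewrite col_mxEd mxE; case: eqP => [_|_]; last by rewrite mxE.
  by rewrite [LHS]mxE [LHS]mxE eq_lrshift.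
by rewrite [X in _ * X]mxE mulr0 subr0.
Qed.

Lemma qformE (Q : 'M[R]_q) (v y : 'cV[R]_q) :
  (v^T *m Q *m y) 0 0 = \sum_c \sum_e Q c e * (v c 0 * y e 0).
Proof.
rewrite mxE exchange_big/=; apply: eq_bigr => e _; rewrite [X in X * _]mxE mulr_suml.
by apply: eq_bigr => c _; rewrite [X in X * _ * _]mxE; ring.
Qed.

Lemma zvec_moms t c : moms P (fun o => z t o c 0).
Proof. exact: (ubd_moms (t, c) (@ubd_zvec _ _ _ _ _ _ H A B Bw w u gf As)). Qed.

Lemma qform_ubd (Q : 'M[R]_q) m :
  ubd P (fun t o => ((z (t + m).+1 o)^T *m Q *m z t.+1 o) 0 0).
Proof.
apply: (ubd_ext (F := fun t o => \sum_c \sum_e Q c e * (z (t + m).+1 o c 0 * z t.+1 o e 0))).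
  have b := @ubd_zvec _ _ _ _ _ _ H A B Bw w u gf As.
  apply: ubd_sum => c _; apply: ubd_sum => e _; apply: ubdZ; apply: ubdM.
  - exact: (ubd_comp (fun t : nat => ((t + m).+1, c)) b).
  - exact: (ubd_comp (fun t : nat => (t.+1, e)) b).
by move=> t o; rewrite qformE.
Qed.

(** If the two noises differ, the one with the later time is independent of the other and of both
    regressors, so it has mean 0 in the product. If they coincide, the square is independent of Y
    and has mean 1. *)
Lemma ex_wwzz (Q : 'M[R]_q) s t i j a b :
  let Y o := ((z s.+1 o)^T *m Q *m z t.+1 o) 0 0 in
  moms P (fun o => w (s.+1 + i) o a 0 * w (t.+1 + j) o b 0 * Y o) /\
  ex (fun o => w (s.+1 + i) o a 0 * w (t.+1 + j) o b 0 * Y o) =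
    ((s + i == t + j) && (a == b))%:R * ex Y.
Proof.
move=> Y; pose k : K := ((s.+1 + i)%N, rshift du a); pose l : K := ((t.+1 + j)%N, rshift du b).
have gk o : g k o = w (s.+1 + i) o a 0 by rewrite ncoord_w.
have gl o : g l o = w (t.+1 + j) o b 0 by rewrite ncoord_w.
have mg k' : moms P (g k') by exact: (moms_gauss gf _ (moms_id R)).
have mY : moms P Y.
  apply: (ubd_ext (F := fun _ o => \sum_c \sum_e Q c e * (z s.+1 o c 0 * z t.+1 o e 0))).
    apply: ubd_sum => c _; apply: ubd_sum => e _; apply: ubdZ; apply: ubdM; exact: zvec_moms.
  by move=> _ o; rewrite /Y qformE.
have fY k' c : (s.+1 <= k')%N -> (t.+1 <= k')%N -> free g (k', rshift du c) Y.
  move=> sk tk; apply: (@free_ext _ _ _ _ _ _ (fun o => \sum_c \sum_e Q c e * (z s.+1 o c 0 * z t.+1 o e 0))).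
    apply: free_sum => f _; apply: free_sum => e _; apply: freeM; first exact: free_cst.
    by apply: freeM; exact: zvec_free_w.
  by move=> o; rewrite /Y qformE.
split.
  apply: (ubd_ext (ubdM (ubdM (mg k) (mg l)) mY)) => _ o.
  by rewrite gk gl.
have kl : (k == l) = (s + i == t + j) && (a == b).
  by rewrite xpair_eqE (inj_eq (@rshift_inj _ _)) !addSn eqSS.
rewrite -kl; have [e|ne] := eqVneq k l.
  have -> : (fun o => w (s.+1 + i) o a 0 * w (t.+1 + j) o b 0 * Y o) =
      (fun o => Y o * (fun x => x ^+ 2) (g k o)).
    by apply/funext => o; rewrite -gk -gl -e mulrC expr2.
  rewrite (@ex_gauss _ _ _ P _ g gf k Y (fun x => x ^+ 2))//.
  - by rewrite normal_var mulr1 mul1r.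
  - by case: (e) => ei _; apply: fY; lia.
  - by apply: ubdX; exact: moms_id.
rewrite mul0r; have [le|/ltnW le] := leqP (t + j) (s + i).
  have -> : (fun o => w (s.+1 + i) o a 0 * w (t.+1 + j) o b 0 * Y o) =
      (fun o => (g l o * Y o) * g k o).
    by apply/funext => o; rewrite gk gl /=; ring.
  rewrite (@ex_gauss _ _ _ P _ g gf k (fun o => g l o * Y o) id) ?normal_mean ?mulr0//.
  - by apply: freeM; [apply: free_gauss; rewrite eq_sym|apply: fY; lia].
  - by apply: ubdM; [exact: mg|exact: mY].
  - exact: moms_id.
have -> : (fun o => w (s.+1 + i) o a 0 * w (t.+1 + j) o b 0 * Y o) =
    (fun o => (g k o * Y o) * g l o).
  by apply/funext => o; rewrite gk gl /=; ring.
rewrite (@ex_gauss _ _ _ P _ g gf l (fun o => g k o * Y o) id) ?normal_mean ?mulr0//.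
- by apply: freeM; [exact: free_gauss|apply: fY; lia].
- by apply: ubdM; [exact: mg|exact: mY].
- exact: moms_id.
Qed.

Definition Wn (i n : nat) (o : T) : 'M[R]_(dx, q) :=
  nsum (fun t o => w (t.+1 + i)%N o *m (z t.+1 o)^T) n o.

Lemma WQW_E (Q : 'M[R]_q) i j a b n o : (Wn i n o *m Q *m (Wn j n o)^T) a b =
  n%:R^-1 * \sum_(0 <= t < n) \sum_(0 <= s < n)
    w (s.+1 + i) o a 0 * w (t.+1 + j) o b 0 * ((z s.+1 o)^T *m Q *m z t.+1 o) 0 0.
Proof.
rewrite /Wn /nsum linearZ/= -scalemxAr -!scalemxAl scalerA mxE -invn_rt; congr (_ * _).
rewrite [(\sum_(0 <= t < n) _)^T]linear_sum/= mulmx_sumr summxE; apply: eq_bigr => t _.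
rewrite !mulmx_suml summxE; apply: eq_bigr => s _.
rewrite trmx_mul trmxK.
move: (w (s.+1 + i) o) (w (t.+1 + j) o) ((z s.+1 o)^T) (z t.+1 o) => v v' r y.
have -> : v *m r *m Q *m (y *m v'^T) = v *m (r *m Q *m y) *m v'^T by rewrite !mulmxA.
move: (r *m Q *m y) => c; rewrite {1}[c]mx11_scalar mul_mx_scalar -scalemxAl.
by move: (c 0 0) => x; rewrite !mxE big_ord1 !mxE; ring.
Qed.

Lemma ex_WQW (Q : 'M[R]_q) i m a b n :
  ex (fun o => (Wn i n o *m Q *m (Wn (i + m) n o)^T) a b) =
  (a == b)%:R * (n%:R^-1 * \sum_(0 <= t < n - m)
     ex (fun o => ((z (t + m).+1 o)^T *m Q *m z t.+1 o) 0 0)).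
Proof.
have -> : (fun o => (Wn i n o *m Q *m (Wn (i + m) n o)^T) a b) =
  (fun o => n%:R^-1 * \sum_(0 <= t < n) \sum_(0 <= s < n)
    w (s.+1 + i) o a 0 * w (t.+1 + (i + m)) o b 0 * ((z s.+1 o)^T *m Q *m z t.+1 o) 0 0).
  by apply/funext => o; rewrite WQW_E.
have mm t s := (@ex_wwzz Q s t i (i + m) a b).1.
rewrite exZ; last by apply: moms_sum => t _; apply: moms_sum => s _; exact: mm.
rewrite mulrCA; congr (_ * _).
rewrite ex_sum => [|t _]; last by apply: moms_sum => s _; exact: mm.
rewrite (eq_bigr (fun t => (a == b)%:R * ((t < n - m)%N%:R *
    ex (fun o => ((z (t + m).+1 o)^T *m Q *m z t.+1 o) 0 0)))) => [|t _]; last first.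
  rewrite ex_sum => [|s _]; last exact: mm.
  rewrite (eq_bigr (fun s => if s == (t + m)%N then (a == b)%:R *
     ex (fun o => ((z (t + m).+1 o)^T *m Q *m z t.+1 o) 0 0) else 0)) => [|s _]; last first.
    rewrite (@ex_wwzz Q s t i (i + m) a b).2.
    have -> : (s + i == t + (i + m))%N = (s == t + m)%N by lia.
    by case: eqP => [->|_] /=; rewrite ?mul0r.
  rewrite -big_mkcond/= big_nat1_eq leq0n/= ltn_subRL addnC.
  by case: ifP => _; rewrite ?mul1r ?mul0r ?mulr0.
rewrite -mulr_sumr; congr (_ * _).
rewrite (@big_cat_nat _ _ _ (n - m)%N 0 n)//= ?leq_subr//.
rewrite [X in _ + X]big_nat_cond [X in _ + X]big1 ?addr0.
  rewrite big_nat_cond [RHS]big_nat_cond; apply: eq_bigr => t; rewrite andbT => /andP[_ ->].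
  by rewrite mul1r.
by move=> t; rewrite andbT => /andP[h _]; rewrite ltnNge h mul0r.
Qed.

Lemma mean_rate c0 (F : nat -> T -> R) : (forall t, moms P (F t)) ->
  ubd P (fun n o => rt n * \sum_(0 <= t < n) (F t o - c0)) ->
  rate (fun n => n%:R^-1 * \sum_(0 <= t < n) ex (F t)) c0.
Proof.
move=> mF bF; have [c hc] := ubd_ex bF; exists c, 1%N => n n1.
have mc : moms P (fun=> c0) by exact: ubd_cst1.
have mFc t : moms P (fun o => F t o - c0) by exact: (ubdB (mF t) mc).
have mB : moms P (fun o => \sum_(0 <= t < n) (F t o - c0)).
  by apply: moms_sum => t _; exact: mFc.
have := hc n; rewrite exZ// ex_sum => [|t _]; last exact: mFc.
rewrite (eq_bigr (fun t => ex (F t) - c0)) => [|t _]; last first.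
  by rewrite exB ?ex_cst.
rewrite sumrB sumr_const_nat subn0 => h.
have -> : n%:R^-1 * \sum_(0 <= t < n) ex (F t) - c0 =
    rt n * (rt n * (\sum_(0 <= t < n) ex (F t) - c0 *+ n)).
  rewrite mulrA -invn_rt mulrBr -[c0 *+ n]mulr_natl mulrA mulVf ?mul1r//.
  by rewrite pnatr_eq0; lia.
by rewrite normrM ger0_norm ?rt_ge0// mulrC ler_wpM2r ?rt_ge0.
Qed.

Lemma zz_entry_rate c e : rate (fun n => n%:R^-1 * \sum_(0 <= t < n) ex (fun o => z t.+1 o c 0 * z t.+1 o e 0)) (Sz e c).
Proof.
apply: mean_rate => [t|]; first by apply: ubdM; exact: zvec_moms.
apply: (ubd_ext (sqrt_bdE e c (@sqrt_bd_zz _ _ _ _ _ _ H A B Bw w u gf As Sx SxE))) => n o.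
congr (_ * _); apply: eq_bigr => t _; rewrite mxE [in LHS]mxE big_ord1 [X in _ + X]mxE.
by rewrite [X in _ * X - _]mxE [z t.+1 o e 0 * _]mulrC.
Qed.

Lemma zz_rate (Q : 'M[R]_q) :
  rate (fun n => n%:R^-1 * \sum_(0 <= t < n) ex (fun o => ((z t.+1 o)^T *m Q *m z t.+1 o) 0 0))
    (\tr (Q *m Sz)).
Proof.
have -> : \tr (Q *m Sz) = \sum_c \sum_e Q c e * Sz e c.
  by apply: eq_bigr => c _; rewrite mxE.
have h := zz_entry_rate.
apply: (rate_ext (n0 := 0) (rate_sum _ (fun c => rate_sum _ (fun e => rateZ (Q c e) (h c e))))) => n _.
under eq_bigr do under eq_bigr do rewrite mulrCA mulr_sumr.
under eq_bigr do rewrite -mulr_sumr exchange_big/=.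
rewrite -mulr_sumr exchange_big/=; congr (_ * _); apply: eq_bigr => t _.
have -> : (fun o => ((z t.+1 o)^T *m Q *m z t.+1 o) 0 0) =
    (fun o => \sum_c \sum_e Q c e * (z t.+1 o c 0 * z t.+1 o e 0)).
  by apply/funext => o; rewrite qformE.
have mm c e : moms P (fun o => z t.+1 o c 0 * z t.+1 o e 0) by apply: ubdM; exact: zvec_moms.
rewrite ex_sum => [|c _]; last by apply: moms_sum => e _; apply: ubdZ; exact: mm.
apply: eq_bigr => c _; rewrite ex_sum => [|e _]; last by apply: ubdZ; exact: mm.
by apply: eq_bigr => e _; rewrite exZ.
Qed.

Lemma W0_rate (Q : 'M[R]_q) a b :
  rate (fun n => ex (fun o => (Wn 0 n o *m Q *m (Wn 0 n o)^T) a b)) ((a == b)%:R * \tr (Q *m Sz)).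
Proof.
apply: (rate_ext (n0 := 0) (rateZ (a == b)%:R (zz_rate Q))) => n _.
have := ex_WQW Q 0 0 a b n; rewrite addn0 subn0 => ->; congr (_ * (_ * _)).
by apply: eq_bigr => t _; rewrite addn0.
Qed.

Lemma state_moms t c : moms P (fun o => xs t o c 0).
Proof. exact: (ubd_moms (t, c) (@ubd_state _ _ _ _ _ _ A B Bw w u gf As)). Qed.

Lemma ex_xx t m a b : ex (fun o => xs (t + m) o a 0 * xs t o b 0) =
  \sum_c (A ^+ m) a c * ex (fun o => xs t o c 0 * xs t o b 0).
Proof.
elim: m a => [|m IH] a.
  rewrite addn0 (bigD1 a)//= big1 ?addr0 => [|c ca]; rewrite expr0 mxE ?eqxx ?mul1r//.
  by rewrite eq_sym (negbTE ca) mul0r.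
have mx s c : moms P (fun o => xs s o c 0 * xs t o b 0) by apply: ubdM; exact: state_moms.
have mn s l : moms P (fun o => xs t o b 0 * noise s o l 0).
  by apply: ubdM; [exact: state_moms|exact: (ubd_moms (s, l) (@ubd_noise _ _ _ _ _ _ w u gf))].
have -> : (fun o => xs (t + m.+1) o a 0 * xs t o b 0) =
   (fun o => \sum_c A a c * (xs (t + m) o c 0 * xs t o b 0) +
     \sum_l C a l * (xs t o b 0 * noise (t + m) o l 0)).
  apply/funext => o; rewrite addnS stateS [X in X * _]mxE mulrDl; congr (_ + _).
    by rewrite mxE mulr_suml; apply: eq_bigr => c _; rewrite mulrA.
  by rewrite mxE mulr_suml; apply: eq_bigr => l _; ring.
rewrite exD; last 2 first.
- by apply: moms_sum => c _; apply: ubdZ; exact: mx.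
- by apply: moms_sum => l _; apply: ubdZ; exact: mn.
rewrite !ex_sum => [|l _|c _]; try (apply: ubdZ; first [exact: mx|exact: mn]).
rewrite [X in _ + X]big1 ?addr0 => [|l _]; last first.
  rewrite exZ// (@ex_gauss _ _ _ P _ g gf (t + m, l)%N (fun o => xs t o b 0) id) ?normal_mean ?mulr0//.
  - by apply: state_free0 => /=; rewrite leq_addr.
  - exact: state_moms.
  - exact: moms_id.
under eq_bigr do rewrite exZ// IH mulr_sumr.
rewrite exchange_big/=; apply: eq_bigr => c _; rewrite exprS -mulmxE mxE mulr_suml.
by apply: eq_bigr => e _; rewrite mulrA.
Qed.

Definition Qz : 'M[R]_q := block_mx (invmx Sx) 0 0 1%:M.

(** The input part pairs u_(t+1+m+j) with u_(t+1+j), so it contributes only for m = 0, once per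
    input coordinate: this is the origin of H du. The state part is propagated by A^m. *)
Lemma ex_zQz m t : ex (fun o => ((z (t + m).+1 o)^T *m Qz *m z t.+1 o) 0 0) =
  \sum_a \sum_c (invmx Sx *m A ^+ m) a c * ex (fun o => xs t.+1 o c 0 * xs t.+1 o a 0) +
  (m == 0%N)%:R * (H * du)%:R.
Proof.
have -> : (fun o => ((z (t + m).+1 o)^T *m Qz *m z t.+1 o) 0 0) =
   (fun o => \sum_a \sum_b invmx Sx b a * (xs (t.+1 + m) o b 0 * xs t.+1 o a 0) +
      \sum_(k < H * du) (fun k o => ncoord w u ((t.+1 + m + (mxtens_unindex k).1)%N, lshift dx (mxtens_unindex k).2) o *
        ncoord w u ((t.+1 + (mxtens_unindex k).1)%N, lshift dx (mxtens_unindex k).2) o) k o).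
  apply/funext => o; rewrite /zvec tr_col_mx mul_row_block !mulmx0 addr0 add0r mulmx1 mul_row_col mxE.
  congr (_ + _).
    rewrite mxE; apply: eq_bigr => a _; rewrite [X in X * _]mxE mulr_suml.
    by apply: eq_bigr => b _; rewrite [X in X * _ * _]mxE addSn; ring.
  rewrite mxE; apply: eq_bigr => k _; rewrite !ncoord_u [X in X * _]mxE.
  by rewrite [X in X * _]mxE [X in _ * X]mxE !addSn.
have mx a b : moms P (fun o => xs (t.+1 + m) o b 0 * xs t.+1 o a 0).
  by apply: ubdM; exact: state_moms.
have mg k' : moms P (g k') by exact: (moms_gauss gf _ (moms_id R)).
rewrite exD; last 2 first.
- by apply: moms_sum => a _; apply: moms_sum => b _; apply: ubdZ; exact: mx.
- by apply: moms_sum => k _; apply: ubdM; exact: mg.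
congr (_ + _).
  rewrite ex_sum => [|a _]; last by apply: moms_sum => b _; apply: ubdZ; exact: mx.
  apply: eq_bigr => a _; rewrite ex_sum => [|b _]; last by apply: ubdZ; exact: mx.
  under eq_bigr do rewrite exZ// ex_xx mulr_sumr.
  rewrite exchange_big/=; apply: eq_bigr => c _; rewrite mxE mulr_suml.
  have sI b : invmx Sx b a = invmx Sx a b.
    by rewrite -{1}(Sx_sym As SxE) -trmx_inv mxE.
  by apply: eq_bigr => b _; rewrite sI mulrA.
rewrite ex_sum => [|k _]; last by apply: ubdM; exact: mg.
rewrite (eq_bigr (fun=> (m == 0%N)%:R)) ?sumr_const ?card_ord ?mulr_natr// => k _.
have [->|m0] := eqVneq m 0%N.
  rewrite addn0; set kk := (_, _).
  have -> : (fun o => g kk o * g kk o) = (fun o => 1 * (fun x => x ^+ 2) (g kk o)).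
    by apply/funext => o; rewrite mul1r expr2.
  rewrite (@ex_gauss _ _ _ P _ g gf kk (fun=> 1) (fun x => x ^+ 2)) ?normal_var ?ex_cst ?mulr1//.
  - exact: free_cst.
  - exact: ubd_cst1.
  - by apply: ubdX; exact: moms_id.
rewrite (@ex_gauss _ _ _ P _ g gf _ _ id) ?normal_mean ?mulr0//.
- by apply: free_gauss; rewrite xpair_eqE negb_and; apply/orP; left; lia.
- exact: moms_id.
Qed.

(** In the limit the covariance cancels: tr (Sx^-1 A^m Sx) = tr A^m. *)
Lemma zQz_rate m : rate (fun n => n%:R^-1 * \sum_(0 <= t < n)
    ex (fun o => ((z (t + m).+1 o)^T *m Qz *m z t.+1 o) 0 0))
  (\tr (A ^+ m) + (m == 0%N)%:R * (H * du)%:R).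
Proof.
have h a c : rate (fun n => n%:R^-1 * \sum_(0 <= t < n) ex (fun o => xs t.+1 o c 0 * xs t.+1 o a 0)) (Sx c a).
  apply: mean_rate => [t|]; first by apply: ubdM; exact: state_moms.
  apply: (ubd_ext (sqrt_bdE c a (@sqrt_bd_xx _ _ _ _ _ _ A B Bw w u gf As Sx SxE))) => n o.
  congr (_ * _); apply: eq_bigr => t _; rewrite mxE [in LHS]mxE big_ord1 [X in _ + X]mxE.
  by rewrite [X in _ * X - _]mxE.
have -> : \tr (A ^+ m) = \sum_a \sum_c (invmx Sx *m A ^+ m) a c * Sx c a.
  transitivity (\tr (invmx Sx *m A ^+ m *m Sx)); last by apply: eq_bigr => a _; rewrite mxE.
  by rewrite mxtrace_mulC mulmxA mulmxV// mul1mx.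
have := rateD (rate_sum (index_enum _) (fun a => rate_sum (index_enum _) (fun c => rateZ ((invmx Sx *m A ^+ m) a c) (h a c))))
  (rate_cst ((m == 0%N)%:R * (H * du)%:R)).
move/(rate_ext (n0 := 1)); apply => n n1.
rewrite (eq_bigr _ (fun t _ => ex_zQz m t)).
rewrite big_split/= sumr_const_nat subn0 mulrDr; congr (_ + _); last first.
  move: (_ * _) => x.
  by rewrite -[x *+ n]mulr_natl mulrA mulVf ?mul1r// pnatr_eq0; lia.
rewrite [X in _ = _ * X]exchange_big/= mulr_sumr; apply: eq_bigr => a _.
rewrite [X in _ = _ * X]exchange_big/= mulr_sumr; apply: eq_bigr => c _.
by rewrite -mulr_sumr mulrCA.
Qed.

(* Of the double sum over s and t only the terms with s + i = t + j survive. *)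
Lemma WW_rate i j a b :
  rate (fun n => ex (fun o => (Wn i n o *m Qz *m (Wn j n o)^T) a b))
   ((a == b)%:R * (\tr (A ^+ `|i%:Z - j%:Z|%N) + (i == j)%:R * (H * du)%:R)).
Proof.
have QT : Qz^T = Qz.
  by rewrite /Qz tr_block_mx !trmx0 trmx1 trmx_inv (Sx_sym As SxE).
have le i' m a' b' : rate (fun n => ex (fun o => (Wn i' n o *m Qz *m (Wn (i' + m) n o)^T) a' b'))
   ((a' == b')%:R * (\tr (A ^+ m) + (m == 0)%:R * (H * du)%:R)).
  have [c hc] := ubd_ex (qform_ubd Qz m).
  apply: (rate_ext (n0 := 0) (rateZ (a' == b')%:R (rate_drop m hc (zQz_rate m)))) => n _.
  by rewrite ex_WQW.
have [ij|/ltnW ij] := leqP i j.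
  have -> : `|i%:Z - j%:Z|%N = (j - i)%N by lia.
  have -> : (i == j) = (j - i == 0)%N by lia.
  by have := le i (j - i)%N a b; rewrite subnKC.
have -> : `|i%:Z - j%:Z|%N = (i - j)%N by lia.
have -> : (i == j) = (i - j == 0)%N by lia.
have := le j (i - j)%N b a; rewrite subnKC// eq_sym => h.
apply: (rate_ext (n0 := 0) h) => n _; congr ex; apply/funext => o.
have <- : (Wn j n o *m Qz *m (Wn i n o)^T)^T = Wn i n o *m Qz *m (Wn j n o)^T.
  by rewrite !trmx_mul trmxK QT mulmxA.
by rewrite [RHS]mxE.
Qed.

End second_moments.

(** * Rollouts *)

Section blocks.
Context (R : realType).

Lemma stackE H p n (F : 'I_H -> 'M[R]_(p, n)) i a c : stack F (mxtens_index (i, a)) c = F i a c.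
Proof. by rewrite mxE mxtens_indexK. Qed.

Lemma sum_mxtens H p (F : 'I_(H * p) -> R) : \sum_k F k = \sum_i \sum_b F (mxtens_index (i, b)).
Proof.
rewrite pair_bigA (reindex (@mxtens_index H p))/=; first by apply: eq_bigr => -[i b].
by exists (@mxtens_unindex H p) => k _; rewrite ?mxtens_indexK ?mxtens_unindexK.
Qed.

(** The value at time k of the recursion x_(l+1) = A x_l + F_l started at 0. *)
Definition prop n p (A : 'M[R]_n) (k : nat) (F : nat -> 'M[R]_(n, p)) : 'M[R]_(n, p) :=
  \sum_(0 <= l < k) A ^+ (k - l.+1) *m F l.

Lemma propS n p (A : 'M[R]_n) k (F : nat -> 'M[R]_(n, p)) :
  prop A k.+1 F = A *m prop A k F + F k.
Proof.
rewrite /prop big_nat_recr//= subnn expr0 mul1mx mulmx_sumr; congr (_ + _).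
rewrite big_nat [RHS]big_nat; apply: eq_bigr => l /andP[_ lk].
by rewrite subSS -(subnSK lk) exprS -mulmxE mulmxA.
Qed.

Lemma toeplitz_stack H n m p (A : 'M[R]_n) (M : 'M[R]_(n, m)) (F : nat -> 'M[R]_(m, p)) :
  toeplitz H A M *m stack (fun i : 'I_H => F i) =
  stack (fun i : 'I_H => prop A i.+1 (fun l => M *m F l)).
Proof.
apply/matrixP => r c; case: (mxtens_indexP r) => i a.
rewrite stackE mxE sum_mxtens /prop summxE big_mkord (@big_ord_widen _ _ _ i.+1 H (fun l => (A ^+ (i.+1 - l.+1) *m (M *m F l)) a c))//.
rewrite [RHS]big_mkcond; apply: eq_bigr => j _.
transitivity (\sum_b (if (j <= i)%N then A ^+ (i - j) *m M else 0) a b * F j b c).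
  by apply: eq_bigr => b _; rewrite stackE [X in X * _]mxE !mxtens_indexK.
rewrite ltnS subSS mulmxA; case: ifP => _; first by rewrite mxE.
by rewrite big1// => b _; rewrite mxE mul0r.
Qed.

End blocks.

Section rollouts.
Context (R : realType) (dx du H : nat).
Local Notation q := (dx + H * du)%N.

(** Selects the k-th block of the stacked inputs, so that [Uk k] extracts u_(t+k) from z_t for k <
    H. *)
Definition Vk (k : nat) : 'M[R]_(du, H * du) :=
  \matrix_(b, c) (((mxtens_unindex c).1 == k :> nat) && ((mxtens_unindex c).2 == b))%:R.

Lemma VkE k b j b' : Vk k b (mxtens_index (j, b')) = ((j == k :> nat) && (b' == b))%:R.
Proof. by rewrite mxE mxtens_indexK. Qed.

Definition Uk (k : nat) : 'M[R]_(du, q) := row_mx 0 (Vk k).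

(* The predictor of [x_(t+k)] from [z_t]. *)
Fixpoint Rw (Gy : 'M[R]_dx) (Gu : 'M[R]_(dx, du)) (k : nat) : 'M[R]_(dx, q) :=
  if k is l.+1 then Gy *m Rw Gy Gu l + Gu *m Uk l else row_mx 1%:M 0.

Definition Yk (Gy : 'M[R]_dx) (Gu : 'M[R]_(dx, du)) (k : nat) : 'M[R]_(dx, H * du) :=
  \matrix_(a, c) if ((mxtens_unindex c).1 < k)%N
    then (Gy ^+ (k - (mxtens_unindex c).1.+1) *m Gu) a (mxtens_unindex c).2 else 0.

Lemma YkE Gy Gu k a j b : Yk Gy Gu k a (mxtens_index (j, b)) =
  if (j < k)%N then (Gy ^+ (k - j.+1) *m Gu) a b else 0.
Proof. by rewrite mxE mxtens_indexK. Qed.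

Lemma RwE Gy Gu k : Rw Gy Gu k = row_mx (Gy ^+ k) (Yk Gy Gu k).
Proof.
elim: k => [|k IH].
  rewrite /= expr0; congr row_mx; apply/matrixP => a c; case: (mxtens_indexP c) => j b.
  by rewrite YkE mxE.
rewrite [LHS]/= IH /Uk !mul_mx_row add_row_mx mulmx0 addr0 exprS -mulmxE; congr row_mx.
apply/matrixP => a c; case: (mxtens_indexP c) => j b; rewrite YkE [LHS]mxE.
rewrite [X in X + _]mxE [X in _ + X]mxE.
rewrite ltnS leq_eqVlt; have [e|jk]/= := eqVneq (j : nat) k.
  rewrite big1 ?add0r => [|f _]; last by rewrite YkE e ltnn mulr0.
  rewrite (bigD1 b)//= big1 ?addr0 => [|b' b'b]; last first.
    by rewrite VkE e eqxx/= eq_sym (negbTE b'b) mulr0.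
  by rewrite VkE e !eqxx mulr1 subnn expr0 mul1mx.
rewrite [X in _ + X]big1 ?addr0 => [|b' _]; last by rewrite VkE (negbTE jk) mulr0.
case: ifP => jk'; last by rewrite big1// => f _; rewrite YkE jk' mulr0.
rewrite subSS -(subnSK jk') exprS -mulmxE -mulmxA mxE; apply: eq_bigr => f _.
by rewrite YkE jk'.
Qed.

Lemma rollout_Rw Gy Gu : rollout H Gy Gu = stack (fun i : 'I_H => Rw Gy Gu i.+1).
Proof.
apply/matrixP => r c; case: (mxtens_indexP r) => i a; rewrite stackE RwE /rollout.
rewrite -(fintype.splitK c); case: (fintype.split c) => [e|e] /=.
  by rewrite !row_mxEl stackE.
rewrite !row_mxEr; case: (mxtens_indexP e) => j b; rewrite YkE mxE !mxtens_indexK ltnS.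
by case: ifP => _; rewrite ?subSS// mxE.
Qed.

(** Predicts the pair (x_(t+k), u_(t+k)) from z_t; for k = 0 it selects the single-step
    regressor. *)
Definition Xi A B k : 'M[R]_(dx + du, q) := col_mx (Rw A B k) (Uk k).

(* The first- and second-order terms of the rollout in the error [X] of the
   single-step estimates. *)
Definition Lin A B k (X : 'M[R]_(dx, dx + du)) : 'M[R]_(dx, q) :=
  prop A k (fun j => X *m Xi A B j).

Fixpoint Quad A B (h : R) (X : 'M[R]_(dx, dx + du)) (k : nat) : 'M[R]_(dx, q) :=
  if k is l.+1 then A *m Quad A B h X l + lsubmx X *m Lin A B l X + h *: (lsubmx X *m Quad A B h X l)
  else 0.

(** The identity is exact: [Quad] depends on h and collects all orders from two on, so its moments
    are controlled by those of X with no Taylor estimate. *)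
Lemma Rw_expand A B h X k :
  Rw (A + h *: lsubmx X) (B + h *: rsubmx X) k =
  Rw A B k + h *: Lin A B k X + h ^+ 2 *: Quad A B h X k.
Proof.
elim: k => [|k IH]; first by rewrite /= /Lin /prop big_geq// !scaler0 !addr0.
have E : Lin A B k.+1 X = A *m Lin A B k X + lsubmx X *m Rw A B k + rsubmx X *m Uk k.
  have -> : Lin A B k.+1 X = A *m Lin A B k X + X *m Xi A B k by rewrite /Lin propS.
  by rewrite /Xi -{2}(hsubmxK X) mul_row_col addrA.
rewrite [LHS]/= IH E [Quad _ _ _ _ k.+1]/= [Rw _ _ k.+1]/=.
move: (lsubmx X) (rsubmx X) (Rw A B k) (Lin A B k X) (Quad A B h X k) (Uk k) => Y V r l Q U.
rewrite !mulmxDl !mulmxDr -!scalemxAl -!scalemxAr !scalerDr !scalerA.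
have -> : h * h = h ^+ 2 by rewrite expr2.
have -> : h * h ^+ 2 = h ^+ 2 * h by rewrite mulrC.
move: (A *m r) (B *m U) (A *m l) (A *m Q) (Y *m r) (Y *m l) (Y *m Q) (V *m U).
move=> m1 m2 m3 m4 m5 m6 m7 m8; apply/matrixP => i j; rewrite !mxE; ring.
Qed.

Section noise_representation.
Context d (T : measurableType d) (A : 'M[R]_dx) (B : 'M[R]_(dx, du)) (Bw : 'M[R]_dx).
Variables (w : nat -> T -> 'cV[R]_dx) (u : nat -> T -> 'cV[R]_du).
Local Notation xs := (state A B Bw w u).
Local Notation z := (zvec H A B Bw w u).

Lemma Uk_z k t o : (k < H)%N -> Uk k *m z t o = u (t + k)%N o.
Proof.
move=> kH; rewrite /Uk /zvec mul_row_col mul0mx add0r; apply/matrixP => b c; rewrite ord1.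
rewrite mxE sum_mxtens (bigD1 (Ordinal kH))//= [X in _ + X]big1 ?addr0 => [|j jk].
  rewrite (bigD1 b)//= [X in _ + X]big1 ?addr0 => [|b' b'b].
    by rewrite stackE VkE !eqxx mul1r.
  by rewrite VkE (negbTE b'b) andbF mul0r.
rewrite big1// => b' _; rewrite VkE.
have -> : (j == k :> nat) = false by apply: negbTE; move: jk; rewrite -val_eqE.
by rewrite mul0r.
Qed.

Lemma state_Rw k t o : (k <= H)%N ->
  xs (t + k)%N o = Rw A B k *m z t o + prop A k (fun l => Bw *m w (t + l)%N o).
Proof.
elim: k => [|k IH] kH.
  by rewrite addn0 /= /prop big_geq// addr0 /zvec mul_row_col mul1mx mul0mx addr0.
rewrite addnS [LHS]/= IH ?(ltnW kH)// propS [Rw _ _ _]/= mulmxDl -!mulmxA Uk_z//.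
by rewrite mulmxDr -!addrA; congr (_ + _); rewrite addrCA.
Qed.

Lemma futureE t o : future H A B Bw w u t o =
  rollout H A B *m z t o + toeplitz H A Bw *m stack (fun i : 'I_H => w (t + i)%N o).
Proof.
rewrite rollout_Rw (@toeplitz_stack _ H _ _ _ A Bw (fun i => w (t + i)%N o)) /future.
apply/matrixP => r c; case: (mxtens_indexP r) => i a; rewrite stackE.
rewrite -addnS state_Rw ?ltn_ord// [RHS]mxE stackE [LHS]mxE; congr (_ + _).
by rewrite !mxE; apply: eq_bigr => e _; rewrite stackE.
Qed.

End noise_representation.

(** * Covariances of the predictions and the matrix M_SS *)

Section covariances.
Variables (A : 'M[R]_dx) (B : 'M[R]_(dx, du)) (Bw Sx : 'M[R]_dx).
Hypothesis SxE : Sx = A *m Sx *m A^T + B *m B^T + Bw *m Bw^T.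
Hypothesis SxT : Sx^T = Sx.
Hypothesis SxU : Sx \in unitmx.
Local Notation Sz := (Sz du H Sx).
Local Notation Xs := (Xi A B).
Local Notation Rw := (Rw A B).

Lemma Uk_Sz_Uk k l : (k < H)%N -> Uk k *m Sz *m (Uk l)^T = (k == l)%:R%:M.
Proof.
move=> kH; rewrite /Uk SzE mul_row_block !mul0mx !mulmx0 mulmx1 !add0r tr_row_mx mul_row_col.
rewrite trmx0 mulmx0 add0r; apply/matrixP => b b'; rewrite mxE sum_mxtens.
rewrite (bigD1 (Ordinal kH))//= [X in _ + X]big1 ?addr0 => [|j jk]; last first.
  rewrite big1// => e _; rewrite VkE.
  have -> : (j == k :> nat) = false by apply: negbTE; move: jk; rewrite -val_eqE.
  by rewrite mul0r.
rewrite (bigD1 b)//= [X in _ + X]big1 ?addr0 => [|e eb]; last first.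
  by rewrite VkE (negbTE eb) andbF mul0r.
rewrite [X in _ * X]mxE !VkE !eqxx mul1r [RHS]mxE.
by case: (k == l) => /=; [rewrite eq_sym|rewrite mul0rn].
Qed.

Lemma Sz_tr : Sz^T = Sz.
Proof. by rewrite SzE tr_block_mx SxT !trmx0 trmx1. Qed.

(** The prediction of x_(t+k) uses x_t and the inputs before time t + k only, which are independent
    of u_(t+l). *)
Lemma Rw_Sz_Uk k l : (k <= l)%N -> (k <= H)%N -> Rw k *m Sz *m (Uk l)^T = 0.
Proof.
elim: k => [|k IH] kl kH.
  rewrite /= /Uk SzE mul_row_block !mul0mx !mulmx0 mul1mx !addr0 tr_row_mx mul_row_col.
  by rewrite trmx0 mulmx0 mul0mx addr0.
rewrite [Rw _]/= !mulmxDl -!mulmxA [Rw k *m _]mulmxA IH ?(ltnW kl) ?(ltnW kH)// mulmx0 add0r.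
have e : Uk k *m Sz *m (Uk l)^T = 0.
  by rewrite Uk_Sz_Uk// (ltn_eqF kl); apply/matrixP => i j; rewrite !mxE mul0rn.
by rewrite [Uk k *m (_ *m _)]mulmxA e mulmx0.
Qed.

Lemma Uk_Sz_Rw k l : (k <= l)%N -> (k <= H)%N -> Uk l *m Sz *m (Rw k)^T = 0.
Proof.
by move=> kl kH; rewrite -(trmx0 R dx du) -(Rw_Sz_Uk kl kH) !trmx_mul trmxK Sz_tr mulmxA.
Qed.

(** The predictable part of x_(t+k) has the stationary covariance minus the contribution of the k
    noises w_t, ..., w_(t+k-1): the origin of the truncated sum in [M_SS]. *)
Lemma Rw_Sz_Rw k : (k <= H)%N -> Rw k *m Sz *m (Rw k)^T =
  Sx - \sum_(l < k) A ^+ l *m Bw *m Bw^T *m (A ^+ l)^T.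
Proof.
elim: k => [|k IH] kH.
  rewrite big_ord0 subr0 /= SzE mul_row_block !mul0mx !mulmx0 !mul1mx !addr0 tr_row_mx mul_row_col.
  by rewrite trmx0 mulmx0 trmx1 mulmx1 addr0.
have kH' := ltnW kH.
have -> : Rw k.+1 *m Sz *m (Rw k.+1)^T = A *m (Rw k *m Sz *m (Rw k)^T) *m A^T + B *m B^T.
  have e1 := Rw_Sz_Uk (leqnn k) kH'; have e2 := Uk_Sz_Rw (leqnn k) kH'.
  have e3 := Uk_Sz_Uk k kH; rewrite eqxx in e3.
  rewrite [Rw k.+1]/= raddfD/= !trmx_mul !mulmxDl !mulmxDr.
  have -> : A *m Rw k *m Sz *m ((Uk k)^T *m B^T) = A *m (Rw k *m Sz *m (Uk k)^T) *m B^T.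
    by rewrite !mulmxA.
  have -> : B *m Uk k *m Sz *m ((Rw k)^T *m A^T) = B *m (Uk k *m Sz *m (Rw k)^T) *m A^T.
    by rewrite !mulmxA.
  have -> : B *m Uk k *m Sz *m ((Uk k)^T *m B^T) = B *m (Uk k *m Sz *m (Uk k)^T) *m B^T.
    by rewrite !mulmxA.
  by rewrite e1 e2 e3 !mulmx0 !mul0mx mulmx1 addr0 add0r !mulmxA.
rewrite IH// mulmxBr mulmxBl.
have -> : A *m Sx *m A^T = Sx - B *m B^T - Bw *m Bw^T.
  have alg (x b c s : 'M[R]_dx) : s = x + b + c -> x = s - b - c.
    by move=> ->; apply/matrixP => i j; rewrite !mxE; ring.
  exact: alg.
have -> : A *m (\sum_(l < k) A ^+ l *m Bw *m Bw^T *m (A ^+ l)^T) *m A^T =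
    \sum_(l < k) A ^+ l.+1 *m Bw *m Bw^T *m (A ^+ l.+1)^T.
  rewrite mulmx_sumr mulmx_suml; apply: eq_bigr => l _.
  by rewrite exprS -mulmxE trmx_mul !mulmxA.
rewrite big_ord_recl expr0 mul1mx trmx1 mulmx1.
move: (\sum_(i < k) _) (B *m B^T) (Bw *m Bw^T) => s b c.
by apply/matrixP => i j; rewrite !mxE; ring.
Qed.

Lemma Rw_Sz_Rw_add k m : (k + m <= H)%N -> Rw k *m Sz *m (Rw (k + m))^T =
  Rw k *m Sz *m (Rw k)^T *m (A ^+ m)^T.
Proof.
elim: m => [|m IH] kH; first by rewrite addn0 expr0 trmx1 mulmx1.
rewrite addnS [Rw _.+1]/= raddfD/= !trmx_mul mulmxDr !mulmxA IH; last by lia.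
rewrite Rw_Sz_Uk ?leq_addr//; last by lia.
by rewrite mul0mx addr0 exprS -mulmxE trmx_mul !mulmxA.
Qed.

Definition Qzeta : 'M[R]_(dx + du) := block_mx (invmx Sx) 0 0 1%:M.
Definition Szeta : 'M[R]_(dx + du) := block_mx Sx 0 0 1%:M.

Lemma Qzeta_Szeta : Qzeta *m Szeta = 1%:M.
Proof.
rewrite /Qzeta /Szeta mulmx_block !mul0mx !mulmx0 !mulmx1 !addr0 !add0r mulVmx//.
by rewrite -scalar_mx_block.
Qed.

Lemma Szeta_unit : Szeta \in unitmx.
Proof. by have [] := mulmx1_unit Qzeta_Szeta. Qed.

Lemma Szeta_inv : invmx Szeta = Qzeta.
Proof.
by rewrite -[RHS]mulmx1 -(mulmxV Szeta_unit) mulmxA Qzeta_Szeta mul1mx.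
Qed.

Lemma Qz_Sz : Qz du H Sx *m Sz = 1%:M.
Proof.
rewrite /Qz SzE mulmx_block !mul0mx !mulmx0 !mulmx1 !addr0 !add0r mulVmx//.
by rewrite -scalar_mx_block.
Qed.

Lemma Sz_unit : Sz \in unitmx.
Proof. by have [] := mulmx1_unit Qz_Sz. Qed.

Lemma Sz_inv : invmx Sz = Qz du H Sx.
Proof. by rewrite -[RHS]mulmx1 -(mulmxV Sz_unit) mulmxA Qz_Sz mul1mx. Qed.

Lemma Xi_Sz_Xi i j : Xs i *m Sz *m (Xs j)^T =
  block_mx (Rw i *m Sz *m (Rw j)^T) (Rw i *m Sz *m (Uk j)^T)
           (Uk i *m Sz *m (Rw j)^T) (Uk i *m Sz *m (Uk j)^T).
Proof. by rewrite /Xi tr_col_mx mul_col_mx mul_col_row. Qed.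

Lemma Xi0_Sz : (0 < H)%N -> Xs 0 *m Sz *m (Xs 0)^T = Szeta.
Proof.
move=> H0; rewrite Xi_Sz_Xi Rw_Sz_Uk// Uk_Sz_Rw// Uk_Sz_Uk// Rw_Sz_Rw// big_ord0 subr0.
by rewrite eqxx.
Qed.

(** The state block gives the entry of [M_SS], by transposition when j < i. The input block is the
    identity for i = j and 0 otherwise. *)
Lemma M_SS_trace (i j : 'I_H) :
  \tr (Qzeta *m (Xs i *m Sz *m (Xs j)^T)) = M_SS H A Bw Sx i j + (i == j)%:R * du%:R.
Proof.
have QT : (invmx Sx)^T = invmx Sx by rewrite trmx_inv SxT.
rewrite Xi_Sz_Xi /Qzeta mulmx_block !mul0mx !add0r !addr0 !mul1mx mxtrace_block.
rewrite Uk_Sz_Uk// mxtrace_scalar -val_eqE mulr_natr; congr (_ + _).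
rewrite mxE.
have h (k m : nat) : (k + m <= H)%N ->
    \tr (invmx Sx *m (Rw k *m Sz *m (Rw (k + m))^T)) =
    \tr ((1%:M - invmx Sx *m (\sum_(l < k) A ^+ l *m Bw *m Bw^T *m (A ^+ l)^T)) *m (A ^+ m)^T).
  move=> kH; rewrite Rw_Sz_Rw_add// Rw_Sz_Rw; last by lia.
  by rewrite mulmxA mulmxBr mulVmx.
have [ij|/ltnW ij] := leqP i j.
  rewrite (_ : `|_|%N = (j - i)%N); last by lia.
  by rewrite -h subnKC// ltnW.
rewrite (_ : `|_|%N = (i - j)%N); last by lia.
rewrite -h subnKC//; last by rewrite ltnW.
by rewrite -mxtrace_tr !trmx_mul !trmxK Sz_tr QT mxtrace_mulC !mulmxA.
Qed.

End covariances.

End rollouts.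

(** * Positive semidefiniteness of the gap *)

Section gram.
Context (R : realType) (H dx : nat).

(** As the second tensor factor is the identity, each diagonal entry splits over the inner index a
    into values of the quadratic form of D. *)
Lemma tensmx_psd (D : 'M[R]_H) (G : 'M[R]_(H * dx)) : psd D ->
  0 <= \tr (G *m tensmx D (1%:M : 'M[R]_dx) *m G^T).
Proof.
move=> [_ D0]; apply: sumr_ge0 => r _.
have -> : (G *m tensmx D (1%:M : 'M[R]_dx) *m G^T) r r =
   \sum_a ((\col_i G r (mxtens_index (i, a)))^T *m D *m (\col_i G r (mxtens_index (i, a)))) 0 0.
  rewrite mxE sum_mxtens exchange_big/=; apply: eq_bigr => a _.
  rewrite mxE; apply: eq_bigr => j _; rewrite [X in _ * X]mxE [X in _ = _ * X]mxE; congr (_ * _).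
  rewrite mxE [RHS]mxE sum_mxtens; apply: eq_bigr => i _.
  rewrite (bigD1 a)//= big1 ?addr0 => [|b ba]; rewrite [tensmx _ _ _ _]mxE !mxtens_indexK/= [X in D _ _ * X]mxE.
    by rewrite eqxx mulr1 !mxE.
  by rewrite (negbTE ba) mulr0 mulr0.
by apply: sumr_ge0 => a _; exact: D0.
Qed.

Variables (A Bw Sx : 'M[R]_dx).
Hypothesis SxT : Sx^T = Sx.
Hypothesis Qpsd : forall v : 'rV[R]_dx, 0 <= (v *m invmx Sx *m v^T) 0 0.

Let F (i m : nat) : 'M[R]_dx := if (m < i)%N then A ^+ (i - m.+1) *m Bw else 0.

(** The terms tr A^|i-j| cancel and leave the truncated sum of [M_SS]. Reversing its index makes its
    terms match, by F (k + m) e = A^m F k e for e < k, and F k e = 0 for e >= k. *)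
Lemma gram_entry (i j : 'I_H) : (M_MS H A - M_SS H A Bw Sx) i j =
  \sum_(m < H) \tr (invmx Sx *m (F i m *m (F j m)^T)).
Proof.
have QT : (invmx Sx)^T = invmx Sx by rewrite trmx_inv SxT.
have sym (a b : nat) : \sum_(m < H) \tr (invmx Sx *m (F a m *m (F b m)^T)) =
    \sum_(m < H) \tr (invmx Sx *m (F b m *m (F a m)^T)).
  apply: eq_bigr => m _; rewrite -mxtrace_tr trmx_mul QT mxtrace_mulC trmx_mul trmxK//.
have h (k m : nat) : (k + m < H)%N ->
    \tr (invmx Sx *m (\sum_(l < k) A ^+ l *m Bw *m Bw^T *m (A ^+ l)^T) *m (A ^+ m)^T) =
    \sum_(e < H) \tr (invmx Sx *m (F k e *m (F (k + m) e)^T)).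
  move=> kH; rewrite mulmx_sumr mulmx_suml raddf_sum/=.
  rewrite (reindex_inj rev_ord_inj)/=.
  rewrite (@big_ord_widen _ _ _ k H (fun l : nat => \tr (invmx Sx *m (A ^+ (k - l.+1) *m Bw *m Bw^T *m (A ^+ (k - l.+1))^T) *m (A ^+ m)^T))); last by lia.
  rewrite big_mkcond; apply: eq_bigr => e _; rewrite /F; case: ifP => ek.
    rewrite (_ : (e < k + m)%N); last by lia.
    have -> : (k + m - e.+1)%N = (m + (k - e.+1))%N by lia.
    by rewrite exprD -mulmxE !trmx_mul !mulmxA.
  by rewrite mul0mx mulmx0 mxtrace0.
rewrite !mxE mulmxBl mul1mx raddfB/= opprB addrCA.
rewrite (_ : `|j%:Z - i%:Z|%N = `|i%:Z - j%:Z|%N); last by lia.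
rewrite mxtrace_tr subrr addr0.
have [ij|/ltnW ij] := leqP i j.
  rewrite (_ : `|_|%N = (j - i)%N); last by lia.
  by rewrite h subnKC.
rewrite (_ : `|_|%N = (i - j)%N); last by lia.
by rewrite h subnKC// sym.
Qed.

Lemma M_MS_sub_M_SS_psd : psd (M_MS H A - M_SS H A Bw Sx).
Proof.
have QT : (invmx Sx)^T = invmx Sx by rewrite trmx_inv SxT.
split.
  apply/matrixP => i j; rewrite [LHS]mxE !gram_entry; apply: eq_bigr => m _.
  by rewrite -mxtrace_tr trmx_mul QT mxtrace_mulC trmx_mul trmxK.
move=> v; pose G (m : 'I_H) := \sum_i v i 0 *: F i m.
have -> : (v^T *m (M_MS H A - M_SS H A Bw Sx) *m v) 0 0 =
    \sum_m \tr ((G m)^T *m invmx Sx *m G m).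
  rewrite mxE.
  under eq_bigr do rewrite mxE mulr_suml.
  rewrite exchange_big/=.
  under eq_bigr do under eq_bigr do rewrite gram_entry mulr_sumr mulr_suml.
  under eq_bigr do rewrite exchange_big/=.
  rewrite exchange_big/=; apply: eq_bigr => m _.
  rewrite -mulmxA mxtrace_mulC -mulmxA /G mulmx_suml mulmx_sumr raddf_sum/=.
  apply: eq_bigr => i _; rewrite linear_sum/= mulmx_sumr mulmx_sumr raddf_sum/=.
  apply: eq_bigr => j _; rewrite [X in X * _ * _]mxE linearZ/= -scalemxAl -!scalemxAr !linearZ/=.
  by ring.
apply: sumr_ge0 => m _; apply: sumr_ge0 => a _.
have := Qpsd (row a (G m)^T).
rewrite -row_mul [in X in X -> _]mxE => h; rewrite mxE.
apply: le_trans h _; rewrite le_eqVlt; apply/orP; left; apply/eqP.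
by apply: eq_bigr => b _; rewrite !mxE.
Qed.

End gram.

(** * Measurability of random matrices *)

Section measurable_matrices.
Context (R : realType) d (T : measurableType d).

Lemma measurable_mx_cst m n (M : 'M[R]_(m, n)) : measurable_mx (fun _ : T => M).
Proof. by move=> i j; exact: measurable_cst. Qed.

Lemma measurable_mxD m n (F G : T -> 'M[R]_(m, n)) :
  measurable_mx F -> measurable_mx G -> measurable_mx (fun o => F o + G o).
Proof.
move=> mF mG i j; rewrite (_ : (fun o => _) = (fun o => F o i j + G o i j)).
  exact: measurable_funD.
by apply/funext => o; rewrite mxE.
Qed.

Lemma measurable_mxM m n p (F : T -> 'M[R]_(m, n)) (G : T -> 'M[R]_(n, p)) :
  measurable_mx F -> measurable_mx G -> measurable_mx (fun o => F o *m G o).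
Proof.
move=> mF mG i j; rewrite (_ : (fun o => _) = (fun o => \sum_k F o i k * G o k j)).
  by apply: measurable_sum => k; exact: measurable_funM.
by apply/funext => o; rewrite mxE.
Qed.

Lemma measurable_mx_sub m n (F : T -> 'M[R]_(m, n)) M :
  measurable_mx F -> measurable_mx (fun o => F o - M).
Proof. by move=> mF; apply: measurable_mxD => //; exact: measurable_mx_cst. Qed.

Lemma measurable_row_mx m n p (F : T -> 'M[R]_(m, n)) (G : T -> 'M[R]_(m, p)) :
  measurable_mx F -> measurable_mx G -> measurable_mx (fun o => row_mx (F o) (G o)).
Proof.
move=> mF mG i j; rewrite -(fintype.splitK j); case: (fintype.split j) => k /=.
  by rewrite (_ : (fun o => _) = (fun o => F o i k))//; apply/funext => o; rewrite row_mxEl.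
by rewrite (_ : (fun o => _) = (fun o => G o i k))//; apply/funext => o; rewrite row_mxEr.
Qed.

Lemma measurable_stack H p n (F : 'I_H -> T -> 'M[R]_(p, n)) :
  (forall i, measurable_mx (F i)) -> measurable_mx (fun o => stack (fun i => F i o)).
Proof.
move=> mF r c; case: (mxtens_indexP r) => i a.
rewrite (_ : (fun o => _) = (fun o => F i o a c)); first exact: mF.
by apply/funext => o; rewrite stackE.
Qed.

Lemma measurable_rollout dx du H (Gy : T -> 'M[R]_dx) (Gu : T -> 'M[R]_(dx, du)) :
  measurable_mx Gy -> measurable_mx Gu -> measurable_mx (fun o => rollout H (Gy o) (Gu o)).
Proof.
move=> my mu.
have mR k : measurable_mx (fun o => Rw H (Gy o) (Gu o) k).
  elim: k => [|k IH]; first exact: measurable_mx_cst.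
  by apply: measurable_mxD; apply: measurable_mxM => //.
have := measurable_stack (fun i : 'I_H => mR i.+1).
by move=> h i j; have := h i j; congr measurable_fun; apply/funext => o; rewrite rollout_Rw.
Qed.

Lemma measurable_fnorm_sqr m n (F : T -> 'M[R]_(m, n)) : measurable_mx F ->
  measurable_fun setT (fun o => fnorm (F o) ^+ 2).
Proof.
move=> mF; rewrite (_ : (fun o => _) = (fun o => \sum_i \sum_j F o i j ^+ 2)).
  by do 2 (apply: measurable_sum => ?); apply: measurable_funX; exact: mF.
by apply/funext => o; rewrite fnorm_sqr.
Qed.

End measurable_matrices.

(** * The limits *)

Section error_limit.
Context (R : realType) d (T : measurableType d) (P : probability T R) (dx du H : nat).
Variables (A : 'M[R]_dx) (B : 'M[R]_(dx, du)).
Local Notation q := (dx + H * du)%N.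
Local Notation rtR := (rt R).

Lemma mbdm_stack b I (h : I -> nat) p n (F : 'I_H -> I -> T -> 'M[R]_(p, n)) :
  (forall i, mbdm P b h (F i)) -> mbdm P b h (fun k o => stack (fun i => F i k o)).
Proof.
move=> mF r c; case: (mxtens_indexP r) => i a.
by apply: (ubd_ext (mF i a c)) => k o; rewrite stackE.
Qed.

Lemma mbd_trace b I (h : I -> nat) n (F : I -> T -> 'M[R]_n) :
  mbdm P b h F -> mbd P b h (fun k o => \tr (F k o)).
Proof. by move=> bF; apply: ubd_sum => i _; exact: bF. Qed.

Lemma trace_rate m n (G : 'M[R]_(m, n)) (Y : nat -> T -> 'M[R]_n) (L : 'M[R]_n) :
  mbdm P true (fun=> 0%N) Y -> (forall r s, rate (fun n => ex P (fun o => Y n o r s)) (L r s)) ->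
  rate (fun n => ex P (fun o => \tr (G *m Y n o *m G^T))) (\tr (G *m L *m G^T)).
Proof.
move=> bY rY.
have E (M : 'M[R]_n) : \tr (G *m M *m G^T) = \sum_i \sum_s \sum_r G i r * G i s * M r s.
  apply: eq_bigr => i _; rewrite mxE; apply: eq_bigr => s _; rewrite mxE mulr_suml.
  by apply: eq_bigr => r _; rewrite [G^T _ _]mxE; ring.
rewrite E; apply: (rate_ext (n0 := 0) (rate_sum _ (fun i => rate_sum _ (fun s => rate_sum _ (fun r => rateZ (G i r * G i s) (rY r s)))))) => k _.
have mm r s : moms P (fun o => Y k o r s) by exact: (ubd_moms k (bY r s)).
rewrite (_ : (fun o => _) = (fun o => \sum_i \sum_s \sum_r G i r * G i s * Y k o r s)); last first.
  by apply/funext => o; rewrite E.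
rewrite ex_sum => [|i _]; last first.
  by apply: moms_sum => s _; apply: moms_sum => r _; apply: ubdZ; exact: mm.
apply: eq_bigr => i _; rewrite ex_sum => [|s _]; last first.
  by apply: moms_sum => r _; apply: ubdZ; exact: mm.
apply: eq_bigr => s _; rewrite ex_sum => [|r _]; last by apply: ubdZ; exact: mm.
by apply: eq_bigr => r _; rewrite exZ.
Qed.

(** After squaring the expansion, the cross terms and the squared remainder all carry a factor
    n^(-1/2). Here k is the number of samples lost to the horizon (H or 1), and the change of scale
    (n + k) / n tends to 1. *)
Lemma scaled_error_cvg (S Sg : 'M[R]_q) k (G : nat -> T -> 'M[R]_(H * dx, q)) n0
    (M Rem : nat -> T -> 'M[R]_(H * dx, q)) l :
  S^T = S -> S *m S = Sg ->
  (forall n, (n0 <= n)%N -> measurable_mx (G (n + k)%N)) ->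
  mbdm P true (fun=> 0%N) M -> mbdm P false id Rem ->
  (forall n, (n0 <= n)%N -> {ae P, forall o,
    Num.sqrt n%:R *: (G (n + k)%N o - rollout H A B) = M n o + rtR n *: Rem n o}) ->
  rate (fun n => ex P (fun o => \tr (M n o *m Sg *m (M n o)^T))) l ->
  scaled_error P A B S N (G N) @[N --> \oo] --> l%:E.
Proof.
move=> ST SS mG bM bR GE rM.
(* The value is set to 0 below [n0], where measurability of the estimator is not assumed. *)
pose F n o : R := if (n0 <= n)%N then n%:R * fnorm ((G (n + k)%N o - rollout H A B) *m S) ^+ 2 else 0.
have bR' : mbdm P false id M by move=> i j; apply: ubd_mbd; exact: bM.
have brt : mbd P false id (fun n (_ : T) => rtR n) by apply: ubd_mbd; exact: ubd_rt.
pose Q n o : R := \tr (M n o *m Sg *m (Rem n o)^T) + \tr (Rem n o *m Sg *m (M n o)^T) +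
  rtR n * \tr (Rem n o *m Sg *m (Rem n o)^T).
have [a [n1 [ra ha]]] : exists a n1, rate a l /\ forall n, (n1 <= n)%N -> (\int[P]_o (F n o)%:E)%E = (a n)%:E.
  apply: (@expectation_rate R d T P n0 F (fun n o => \tr (M n o *m Sg *m (M n o)^T)) Q) => //.
  - move=> n; rewrite /F; have [nn|nn] := leqP n0 n; last exact: measurable_cst.
    apply: measurable_funM => //; apply: measurable_fnorm_sqr; apply: measurable_mxM.
      by apply: measurable_mx_sub; exact: mG.
    exact: measurable_mx_cst.
  - by apply: mbd_trace; apply: mbdm_mul; [exact: mbdm_mulr|exact: mbdm_tr].
  - apply: ubdD; first apply: ubdD.
    + by apply: mbd_trace; apply: mbdm_mul; [exact: mbdm_mulr|exact: mbdm_tr].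
    + by apply: mbd_trace; apply: mbdm_mul; [exact: mbdm_mulr|exact: mbdm_tr].
    + by apply: ubdM => //; apply: mbd_trace; apply: mbdm_mul; [exact: mbdm_mulr|exact: mbdm_tr].
  move=> n nn; have := GE n nn; apply: filterS => o h; rewrite /F nn.
  have -> : n%:R * fnorm ((G (n + k)%N o - rollout H A B) *m S) ^+ 2 =
     \tr ((M n o + rtR n *: Rem n o) *m Sg *m (M n o + rtR n *: Rem n o)^T).
    rewrite -h fnorm_tr trmx_mul ST; move: (G _ _ - _) => D.
    rewrite linearZ/= -!scalemxAl -scalemxAr scalerA -expr2 sqr_sqrtr// linearZ/=.
    by rewrite -SS !mulmxA.
  rewrite /Q raddfD/= linearZ/= !mulmxDl !mulmxDr !raddfD/=.
  rewrite -!scalemxAl -!scalemxAr !linearZ/= ; ring.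
rewrite -(cvg_shiftn k); have rs := rate_cvg (rate_shift k ra).
have E n : (maxn 1 (maxn n0 n1) <= n)%N ->
    scaled_error P A B S (n + k) (G (n + k)%N) = ((n + k)%:R / n%:R * a n)%:E.
  rewrite !geq_max => /and3P[np nn0 nn1]; rewrite /scaled_error unlock.
  have := ha n nn1; rewrite /F nn0.
  under eq_integral do rewrite EFinM.
  rewrite ge0_integralZl_EFin//; last first.
  - apply/measurable_EFinP; apply: measurable_fnorm_sqr; apply: measurable_mxM.
      by apply: measurable_mx_sub; exact: mG.
    exact: measurable_mx_cst.
  - by move=> o _; rewrite lee_fin sqr_ge0.
  move=> h; rewrite EFinM -h muleA -EFinM divfK//.
  by rewrite pnatr_eq0; lia.
apply: cvg_EFin.
  by exists (maxn 1 (maxn n0 n1)) => // n /= hn; rewrite E.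
apply: cvg_trans rs; apply: near_eq_cvg.
by exists (maxn 1 (maxn n0 n1)) => // n /= hn; rewrite E.
Qed.

End error_limit.

(** * Limits of the main terms *)

Section limits.
Context (R : realType) d (T : measurableType d) (P : probability T R) (dx du H : nat).
Hypothesis H_ge1 : (1 <= H)%N.
Variables (A : 'M[R]_dx) (B : 'M[R]_(dx, du)) (Bw : 'M[R]_dx).
Variables (w : nat -> T -> 'cV[R]_dx) (u : nat -> T -> 'cV[R]_du).
Hypothesis gf : gauss_family P (ncoord w u).
Hypothesis As : spectral_radius A < 1.
Hypothesis Ac : controllable A (row_mx B Bw).
Variable Sx : 'M[R]_dx.
Hypothesis SxE : Sx = A *m Sx *m A^T + B *m B^T + Bw *m Bw^T.
Local Notation C := (row_mx B Bw).
Local Notation xs := (state A B Bw w u).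
Local Notation z := (zvec H A B Bw w u).
Local Notation q := (dx + H * du)%N.
Local Notation rtR := (rt R).
Local Notation Szz := (Sz du H Sx).
Local Notation Qzz := (Qz du H Sx).
Local Notation Gw := (toeplitz H A Bw).
Local Notation W := (Wn H A B Bw w u).

Lemma SxE_row : Sx = A *m Sx *m A^T + C *m C^T.
Proof. by rewrite tr_row_mx mul_row_col addrA. Qed.
Let SxC := SxE_row.
Let SxT : Sx^T = Sx := Sx_sym As SxC.
Let SxU : Sx \in unitmx := Sx_unit As Ac SxC.

(** The defining average has S + 1 terms, from t = 0, but is divided by S; the term at t = 0 is O(1
    / S). *)
Lemma Sigma_zE : Sigma_z P H A B Bw w u = Szz.
Proof.
apply/matrixP => i j; rewrite mxE; apply: cvg_lim => //; apply: rate_cvg.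
have m0 : moms P (fun o => z 0 o i 0 * z 0 o j 0).
  by apply: ubdM; exact: (@zvec_moms _ _ _ _ _ _ H A B Bw w u gf As).
have e t : fine 'E_P[fun o => (z t o *m (z t o)^T) i j] = ex P (fun o => z t o i 0 * z t o j 0).
  rewrite unlock /ex; congr fine; apply: eq_integral => o _.
  by rewrite mxE big_ord1 [X in _ * X]mxE.
have r1 : rate (fun n => n%:R^-1 * ex P (fun o => z 0 o i 0 * z 0 o j 0)) 0.
  exists `|ex P (fun o => z 0 o i 0 * z 0 o j 0)|, 0%N => n _.
  rewrite subr0 normrM (ger0_norm (_ : 0 <= n%:R^-1)) ?invr_ge0// mulrC.
  by rewrite ler_wpM2l ?invn_le_rt.
have r2 := zz_entry_rate gf As SxC SxU i j.
have := rateD r1 r2; rewrite add0r.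
have -> : Szz j i = Szz i j by rewrite -{1}(Sz_tr du H SxT) mxE.
move/(rate_ext (n0 := 0)); apply => n _.
rewrite [in RHS]big_nat_recl//= mulrDr e; congr (_ + _ * _).
by apply: eq_bigr => t _; rewrite e.
Qed.

Definition omega (t : nat) (o : T) : 'M[R]_(H * dx, 1) := stack (fun i : 'I_H => w (t + i)%N o).

Definition Om (n : nat) (o : T) : 'M[R]_(H * dx, q) := stack (fun i : 'I_H => W i n o).

Lemma OmE n o : nsum (fun t o => omega t.+1 o *m (z t.+1 o)^T) n o = Om n o.
Proof.
apply/matrixP => r c; case: (mxtens_indexP r) => i a; rewrite stackE /Wn /nsum [LHS]mxE [RHS]mxE.
rewrite !summxE; congr (_ * _); apply: eq_bigr => t _.
rewrite mxE [RHS]mxE; apply: eq_bigr => e _; congr (_ * _).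
by rewrite /omega stackE.
Qed.

Lemma W_ubd i : mbdm P true (fun=> 0%N) (W i).
Proof. exact: (@sqrt_bd_wz _ _ _ _ _ _ H A B Bw w u gf As i). Qed.

Lemma Om_ubd : mbdm P true (fun=> 0%N) Om.
Proof. by apply: mbdm_stack => i; exact: W_ubd. Qed.

Lemma stack_quad p (F G : 'I_H -> 'M[R]_(dx, p)) (Q : 'M[R]_p) i a j b :
  (stack F *m Q *m (stack G)^T) (mxtens_index (i, a)) (mxtens_index (j, b)) =
  (F i *m Q *m (G j)^T) a b.
Proof.
rewrite mxE [RHS]mxE; apply: eq_bigr => c _; rewrite [X in _ * X]mxE stackE [X in _ = _ * X]mxE.
by congr (_ * _); rewrite mxE [RHS]mxE; apply: eq_bigr => e _; rewrite stackE.
Qed.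

Lemma tens_entry (M : 'M[R]_H) i a j b :
  tensmx M (1%:M : 'M[R]_dx) (mxtens_index (i, a)) (mxtens_index (j, b)) = (a == b)%:R * M i j.
Proof. by rewrite mxE !mxtens_indexK/= [X in _ * X]mxE mulrC. Qed.

(** The weight [Szz] cancels one of the two inverses [Qzz], leaving the blocks W_i Qzz W_j^T, whose
    means converge by [WW_rate]. *)
Lemma ms_main_rate :
  rate (fun n => ex P (fun o => \tr ((Gw *m Om n o *m Qzz) *m Szz *m (Gw *m Om n o *m Qzz)^T)))
   (\tr (Gw *m tensmx (M_MS H A + (H * du)%:R%:M) (1%:M : 'M[R]_dx) *m Gw^T)).
Proof.
have bY : mbdm P true (fun=> 0%N) (fun n o => Om n o *m Qzz *m (Om n o)^T).
  by apply: mbdm_mul; [apply: mbdm_mulr; exact: Om_ubd|apply: mbdm_tr; exact: Om_ubd].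
have QT : Qzz^T = Qzz.
  by rewrite /Qz tr_block_mx !trmx0 trmx1 trmx_inv SxT.
have := @trace_rate _ _ _ P _ _ Gw _ (tensmx (M_MS H A + (H * du)%:R%:M) (1%:M : 'M[R]_dx)) bY.
move=> /(_ _)/(rate_ext (n0 := 0)); apply.
  move=> r s; case: (mxtens_indexP r) => i a; case: (mxtens_indexP s) => j b.
  rewrite tens_entry [X in _ * X]mxE [M_MS _ _ _ _]mxE [X in _ + X]mxE -[(H * du)%:R *+ _]mulr_natl.
  have := WW_rate H gf As SxC SxU i j a b; rewrite (_ : (i == j :> nat) = (i == j))//.
  move/(rate_ext (n0 := 0)); apply => n _; congr ex; apply/funext => o.
  by rewrite /Om stack_quad.
move=> n _; congr ex; apply/funext => o; congr mxtrace.
rewrite !trmx_mul QT !mulmxA; congr (_ *m _ *m _).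
by rewrite -[in RHS](mulmxA _ Qzz Szz) Qz_Sz// mulmx1.
Qed.

Let Qze := Qzeta du Sx.
Let Xs := Xi H A B.

(* To first order the error of block row i is the sum over j <= i of
   A^(i-j) Bw W_0 [Kmx j]. *)
Definition Kmx (j : nat) : 'M[R]_q := (Xs 0)^T *m Qze *m Xs j.

Definition Psi (n : nat) (o : T) : 'M[R]_(H * dx, q) :=
  stack (fun j : 'I_H => W 0 n o *m Kmx j).

Lemma Psi_ubd : mbdm P true (fun=> 0%N) Psi.
Proof. by apply: mbdm_stack => j; apply: mbdm_mulr; exact: W_ubd. Qed.

Lemma ss_main_rate :
  rate (fun n => ex P (fun o => \tr ((Gw *m Psi n o) *m Szz *m (Gw *m Psi n o)^T)))
   (\tr (Gw *m tensmx (M_SS H A Bw Sx + du%:R%:M) (1%:M : 'M[R]_dx) *m Gw^T)).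
Proof.
have bY : mbdm P true (fun=> 0%N) (fun n o => Psi n o *m Szz *m (Psi n o)^T).
  by apply: mbdm_mul; [apply: mbdm_mulr; exact: Psi_ubd|apply: mbdm_tr; exact: Psi_ubd].
have QT : Qze^T = Qze.
  by rewrite /Qze /Qzeta tr_block_mx !trmx0 trmx1 trmx_inv SxT.
have := @trace_rate _ _ _ P _ _ Gw _ (tensmx (M_SS H A Bw Sx + du%:R%:M) (1%:M : 'M[R]_dx)) bY.
move=> /(_ _)/(rate_ext (n0 := 0)); apply.
  move=> r s; case: (mxtens_indexP r) => i a; case: (mxtens_indexP s) => j b.
  rewrite tens_entry [X in _ * X]mxE [X in _ + X]mxE -[du%:R *+ _]mulr_natl.
  have -> : M_SS H A Bw Sx i j + (i == j)%:R * du%:R = \tr (Kmx i *m Szz *m (Kmx j)^T *m Szz).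
    rewrite -(M_SS_trace SxE SxT SxU) /Kmx !trmx_mul trmxK QT.
    (* The covariance of (x_t, u_t) cancels one [Qze] once the factors are rotated under the trace,
       which leaves the trace of [M_SS_trace]. *)
    have R1 : Qze *m (Xs 0 *m Szz *m (Xs 0)^T) = 1%:M.
      by rewrite /Xs (Xi0_Sz SxE SxT H_ge1) Qzeta_Szeta.
    transitivity (\tr (Qze *m Xs i *m Szz *m (Xs j)^T *m (Qze *m (Xs 0 *m Szz *m (Xs 0)^T)))).
      by rewrite R1 mulmx1 !mulmxA.
    transitivity (\tr ((Xs 0)^T *m (Qze *m Xs i *m Szz *m (Xs j)^T *m Qze *m Xs 0 *m Szz))).
      by rewrite [RHS]mxtrace_mulC !mulmxA.
    by rewrite !mulmxA.
  have := W0_rate gf As SxC SxU (Kmx i *m Szz *m (Kmx j)^T) a b.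
  move/(rate_ext (n0 := 0)); apply => n _; congr ex; apply/funext => o.
  by rewrite /Psi stack_quad (trmx_mul (W 0 n o)) !mulmxA.
move=> n _; congr ex; apply/funext => o; congr mxtrace.
by rewrite !trmx_mul !mulmxA.
Qed.

End limits.

(** * Asymptotic errors of the two estimators *)

Section estimators.
Context (R : realType) d (T : measurableType d) (P : probability T R) (dx du H : nat).
Hypothesis H_ge1 : (1 <= H)%N.
Variables (A : 'M[R]_dx) (B : 'M[R]_(dx, du)) (Bw : 'M[R]_dx).
Variables (w : nat -> T -> 'cV[R]_dx) (u : nat -> T -> 'cV[R]_du).
Hypothesis gf : gauss_family P (ncoord w u).
Hypothesis As : spectral_radius A < 1.
Hypothesis Ac : controllable A (row_mx B Bw).
Variable Sx : 'M[R]_dx.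
Hypothesis SxE : Sx = A *m Sx *m A^T + B *m B^T + Bw *m Bw^T.
Local Notation C := (row_mx B Bw).
Local Notation xs := (state A B Bw w u).
Local Notation z := (zvec H A B Bw w u).
Local Notation q := (dx + H * du)%N.
Local Notation rtR := (rt R).
Local Notation Szz := (Sz du H Sx).
Local Notation Qzz := (Qz du H Sx).
Local Notation Gw := (toeplitz H A Bw).
Local Notation W := (Wn H A B Bw w u).
Local Notation omg := (omega H w).
Local Notation X0 := (Xi H A B 0).
Let SxC : Sx = A *m Sx *m A^T + C *m C^T := SxE_row SxE.
Let SxT : Sx^T = Sx := Sx_sym As SxC.
Let SxU : Sx \in unitmx := Sx_unit As Ac SxC.
Variable Sh : 'M[R]_q.
Hypothesis ShP : is_psd_sqrt Sh (Sigma_z P H A B Bw w u).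

Let ShT : Sh^T = Sh. Proof. by case: ShP => -[]. Qed.

Let ShSh : Sh *m Sh = Szz.
Proof. by case: ShP => _; rewrite (Sigma_zE H gf As Ac SxE). Qed.

Lemma nsum_mul m n p r (M : 'M[R]_(m, n)) (F : nat -> T -> 'M[R]_(n, p)) (N : 'M[R]_(p, r)) k o :
  nsum (fun t o => M *m F t o *m N) k o = M *m nsum F k o *m N.
Proof. by rewrite /nsum -scalemxAr -scalemxAl mulmx_sumr mulmx_suml. Qed.

Lemma nsum_ext m n (F G : nat -> T -> 'M[R]_(m, n)) k o :
  (forall t, F t o = G t o) -> nsum F k o = nsum G k o.
Proof. by move=> FG; congr (_ *: _); apply: eq_bigr => t _. Qed.

Section multi_step.
Variable GMS : nat -> T -> 'M[R]_(H * dx, q).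
Hypothesis GMS_lsq : \forall N \near \oo, ms_estimator P A B Bw w u N (GMS N).

Lemma ms_limit : scaled_error P A B Sh N (GMS N) @[N --> \oo] -->
  (\tr (Gw *m tensmx (M_MS H A + (H * du)%:R%:M) (1%:M : 'M[R]_dx) *m Gw^T))%:E.
Proof.
have [mu [bmu [n0 mupos] muS]] := excitation H gf As Ac.
case: GMS_lsq => N0 _ hN; pose n1 := maxn n0 N0.
have hN' n : (n1 <= n)%N -> ms_estimator P A B Bw w u (n + H) (GMS (n + H)%N).
  by rewrite geq_max => /andP[_ h]; apply: hN => /=; lia.
(* With N = n + H the cost has exactly n terms. Below [n1], where nothing is known of [GMS], the
   error is replaced by 0. *)
pose Th n o : 'M[R]_(H * dx, q) := if (n1 <= n)%N then GMS (n + H)%N o - rollout H A B else 0.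
pose zeta t o : 'cV[R]_q := z t.+1 o.
pose e t o : 'cV[R]_(H * dx) := Gw *m omg t.+1 o.
have bD : sqrt_bd P (fun t o => zeta t o *m (zeta t o)^T - Szz).
  exact: (@sqrt_bd_zz _ _ _ _ _ _ H A B Bw w u gf As Sx SxC).
have eE t o : e t o *m (zeta t o)^T = Gw *m (omg t.+1 o *m (z t.+1 o)^T) *m 1%:M.
  by rewrite mulmx1 mulmxA.
have bW : sqrt_bd P (fun t o => e t o *m (zeta t o)^T).
  have b0 : sqrt_bd P (fun t o => omg t.+1 o *m (z t.+1 o)^T).
    apply: (mbdm_ext (F := Om H A B Bw w u)) => [|n o]; last by rewrite OmE.
    by apply: Om_ubd.
  by apply: (sqrt_bd_ext (sqrt_bd_mul Gw 1%:M b0)) => t o; rewrite eE.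
have mTh n : measurable_mx (Th n).
  rewrite /Th; have [nn|nn] := leqP n1 n; last exact: measurable_mx_cst.
  by apply: measurable_mx_sub; exact: (hN' n nn).1.
have Th0 n o : (n < n1)%N -> Th n o = 0 by rewrite /Th ltnNge => /negbTE ->.
have mupos' : {ae P, forall o, forall n, (n1 <= n)%N -> 0 < mu n o}.
  move: mupos; apply: filterS => o h n; rewrite geq_max => /andP[h1 _]; exact: h.
have ThE n : (n1 <= n)%N -> {ae P, forall o, Th n o *m (\sum_(0 <= t < n) zeta t o *m (zeta t o)^T) =
    \sum_(0 <= t < n) e t o *m (zeta t o)^T}.
  move=> nn; have := (hN' n nn).2; apply: filterS => o hmin.
  have := @lsq_normal R _ _ (index_iota 0 n) (fun t => future H A B Bw w u t.+1 o) (fun t => zeta t o) (GMS (n + H)%N o).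
  have hm G' : \sum_(0 <= t < n) fnorm (future H A B Bw w u t.+1 o - GMS (n + H)%N o *m zeta t o) ^+ 2 <=
     \sum_(0 <= t < n) fnorm (future H A B Bw w u t.+1 o - G' *m zeta t o) ^+ 2.
    by have := hmin G'; rewrite /ms_cost addnK !big_add1.
  move/(_ hm) => hG; rewrite /Th nn mulmxBl hG mulmx_sumr -sumrB; apply: eq_bigr => t _.
  by rewrite futureE mulmxDl mulmxA addrAC subrr add0r.
apply: (@scaled_error_cvg R d T P dx du H A B Sh Szz H GMS (maxn 1 n1)
  (fun n o => Gw *m Om H A B Bw w u n o *m Qzz) (root_rem zeta Szz Th)) => //.
- by move=> n; rewrite geq_max => /andP[_ /hN'[]].
- by apply: mbdm_mulr; apply: mbdm_mull; by apply: Om_ubd.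
- exact: (root_rem_lbd bD bW bmu mupos' muS mTh Th0 ThE).
- move=> n; rewrite geq_max => /andP[np nn].
  have := root_errE (Sz_unit du H SxU) ThE nn np; apply: filterS => o.
  rewrite /root_err {1}/Th nn => ->; congr (_ + _).
  rewrite (Sz_inv du H SxU); congr (_ *m _).
  rewrite -OmE -[RHS]mulmx1 -nsum_mul.
  by apply: nsum_ext => t; exact: eE.
- by apply: ms_main_rate.
Qed.

End multi_step.

Lemma LinD k (X Y : 'M[R]_(dx, dx + du)) h :
  Lin H A B k (X + h *: Y) = Lin H A B k X + h *: Lin H A B k Y.
Proof.
rewrite /Lin /prop scaler_sumr -big_split/=; apply: eq_bigr => l _.
by rewrite mulmxDl mulmxDr -scalemxAl -scalemxAr.
Qed.

Lemma Lin_lbd k (X : nat -> T -> 'M[R]_(dx, dx + du)) : mbdm P false id X ->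
  mbdm P false id (fun n o => Lin H A B k (X n o)).
Proof.
by move=> bX; apply: mbdm_sum => l; apply: mbdm_mull; exact: mbdm_mulr.
Qed.

Lemma Quad_lbd k (X : nat -> T -> 'M[R]_(dx, dx + du)) : mbdm P false id X ->
  mbdm P false id (fun n o => Quad H A B (rtR n) (X n o) k).
Proof.
move=> bX; have bY : mbdm P false id (fun n o => lsubmx (X n o)).
  by move=> i j; apply: (ubd_ext (bX i (lshift du j))) => n o; rewrite mxE.
have brt : mbd P false id (fun n (_ : T) => rtR n) by apply: ubd_mbd; exact: ubd_rt.
elim: k => [|k IH]; first exact: mbdm_cst.
apply: mbdmD; first apply: mbdmD.
- exact: mbdm_mull.
- by apply: mbdm_mul => //; exact: Lin_lbd.
- by apply: mbdmZ => //; exact: mbdm_mul.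
Qed.

Lemma Xi0_zvec t o : X0 *m z t o = col_mx (xs t o) (u t o).
Proof.
rewrite /Xi mul_col_mx Uk_z// addn0; congr col_mx.
by rewrite /= /zvec mul_row_col mul1mx mul0mx addr0.
Qed.

(** The rows are distinct unit vectors, so the excitation bound for z_t passes to (x_t, u_t) with
    the same mu. *)
Lemma Xi0_orth : X0 *m X0^T = 1%:M.
Proof.
rewrite /Xi tr_col_mx mul_col_row.
have -> : Uk R dx du H 0 *m (Uk R dx du H 0)^T = 1%:M.
  (* For Sx = 1 the matrix [Sz] is the identity. *)
  have := @Uk_Sz_Uk R dx du H 1%:M 0 0 H_ge1.
  by rewrite SzE -scalar_mx_block mulmx1.
rewrite /= /Uk !tr_row_mx !mul_row_col !trmx0 !trmx1 !mulmx0 !mul0mx !mulmx1 !addr0.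
by rewrite -scalar_mx_block.
Qed.

Lemma sqn_orth m n (v : 'rV[R]_m) (M : 'M[R]_(m, n)) : M *m M^T = 1%:M -> sqn (v *m M) = sqn v.
Proof.
have sqnE p (y : 'rV[R]_p) : sqn y = (y *m y^T) 0 0.
  by rewrite mxE; apply: eq_bigr => i _; rewrite mxE expr2.
by move=> MM; rewrite !sqnE trmx_mul mulmxA -(mulmxA v) MM mulmx1.
Qed.

Section single_step.
Variables (Gy : nat -> T -> 'M[R]_dx) (Gu : nat -> T -> 'M[R]_(dx, du)).
Hypothesis GyGu_lsq : \forall N \near \oo, ss_estimator P A B Bw w u N (Gy N) (Gu N).

(** Two expansions are composed: the regression error X is its main term plus n^(-1/2) times a
    remainder, and the rollout error is [Lin] of X plus n^(-1/2) times [Quad]. [Lin] of the main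
    term is [Gw] times [Psi]; the rest is of lower order. *)
Lemma ss_limit : scaled_error P A B Sh N (fun o => rollout H (Gy N o) (Gu N o)) @[N --> \oo] -->
  (\tr (Gw *m tensmx (M_SS H A Bw Sx + du%:R%:M) (1%:M : 'M[R]_dx) *m Gw^T))%:E.
Proof.
have [mu [bmu [n0 mupos] muS]] := excitation H gf As Ac.
case: GyGu_lsq => N0 _ hN; pose n1 := maxn n0 N0.
have hN' n : (n1 <= n)%N -> ss_estimator P A B Bw w u (n + 1) (Gy (n + 1)%N) (Gu (n + 1)%N).
  by rewrite geq_max => /andP[_ h]; apply: hN => /=; lia.
pose Th n o : 'M[R]_(dx, dx + du) :=
  if (n1 <= n)%N then row_mx (Gy (n + 1)%N o) (Gu (n + 1)%N o) - row_mx A B else 0.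
pose zeta t o : 'cV[R]_(dx + du) := X0 *m z t.+1 o.
pose e t o : 'cV[R]_dx := Bw *m w t.+1 o.
pose Szt := Szeta du Sx.
have bD : sqrt_bd P (fun t o => zeta t o *m (zeta t o)^T - Szt).
  have b0 := @sqrt_bd_zz _ _ _ _ _ _ H A B Bw w u gf As Sx SxC.
  apply: (sqrt_bd_ext (sqrt_bd_mul X0 X0^T b0)) => t o.
  by rewrite /Szt -(Xi0_Sz SxE SxT H_ge1) mulmxBr mulmxBl /zeta trmx_mul !mulmxA.
have eE t o : e t o *m (zeta t o)^T = Bw *m (w (t.+1 + 0)%N o *m (z t.+1 o)^T) *m X0^T.
  by rewrite addn0 /e /zeta trmx_mul !mulmxA.
have bW : sqrt_bd P (fun t o => e t o *m (zeta t o)^T).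
  have b0 := @sqrt_bd_wz _ _ _ _ _ _ H A B Bw w u gf As 0.
  by apply: (sqrt_bd_ext (sqrt_bd_mul Bw X0^T b0)) => t o; rewrite eE.
have mTh n : measurable_mx (Th n).
  rewrite /Th; have [nn|nn] := leqP n1 n; last exact: measurable_mx_cst.
  by apply: measurable_mx_sub; have [my mu' _] := hN' n nn; exact: measurable_row_mx.
have Th0 n o : (n < n1)%N -> Th n o = 0 by rewrite /Th ltnNge => /negbTE ->.
have mupos' : {ae P, forall o, forall n, (n1 <= n)%N -> 0 < mu n o}.
  move: mupos; apply: filterS => o h n; rewrite geq_max => /andP[h1 _]; exact: h.
have muS' n o (v : 'rV[R]_(dx + du)) :
    mu n o * sqn v <= (v *m (\sum_(0 <= t < n) zeta t o *m (zeta t o)^T) *m v^T) 0 0.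
  have -> : \sum_(0 <= t < n) zeta t o *m (zeta t o)^T =
      X0 *m (\sum_(0 <= t < n) z t.+1 o *m (z t.+1 o)^T) *m X0^T.
    rewrite mulmx_sumr mulmx_suml; apply: eq_bigr => t _.
    by rewrite /zeta trmx_mul !mulmxA.
  rewrite -(sqn_orth v Xi0_orth); apply: le_trans (muS n o (v *m X0)) _.
  by rewrite trmx_mul !mulmxA.
have ThE n : (n1 <= n)%N -> {ae P, forall o, Th n o *m (\sum_(0 <= t < n) zeta t o *m (zeta t o)^T) =
    \sum_(0 <= t < n) e t o *m (zeta t o)^T}.
  move=> nn; have [_ _] := hN' n nn; apply: filterS => o hmin.
  have hm G' : \sum_(0 <= t < n) fnorm (xs t.+2 o - row_mx (Gy (n + 1)%N o) (Gu (n + 1)%N o) *m zeta t o) ^+ 2 <=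
     \sum_(0 <= t < n) fnorm (xs t.+2 o - G' *m zeta t o) ^+ 2.
    have costE (G : 'M[R]_(dx, dx + du)) :
        \sum_(0 <= t < n) fnorm (xs t.+2 o - G *m zeta t o) ^+ 2 =
        \sum_(1 <= t < n + 1) fnorm (xs t.+1 o - G *m col_mx (xs t o) (u t o)) ^+ 2.
      by rewrite addn1 big_add1; apply: eq_bigr => t _; rewrite /zeta Xi0_zvec.
    rewrite !costE -[in X in _ <= X](hsubmxK G').
    exact: (hmin (lsubmx G', rsubmx G')).
  have hG := @lsq_normal R _ _ (index_iota 0 n) (fun t => xs t.+2 o) (fun t => zeta t o) _ hm.
  rewrite /Th nn mulmxBl hG mulmx_sumr -sumrB; apply: eq_bigr => t _.
  have -> : xs t.+2 o = row_mx A B *m zeta t o + e t o.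
    by rewrite /zeta Xi0_zvec mul_row_col.
  by rewrite mulmxDl -(mulmxA (row_mx A B)) [X in X - _]addrC addrK.
have bX := root_err_lbd bW bmu mupos' muS' mTh Th0 ThE.
have bRem := root_rem_lbd bD bW bmu mupos' muS' mTh Th0 ThE.
pose X := root_err Th; pose Rem := root_rem zeta Szt Th.
apply: (@scaled_error_cvg R d T P dx du H A B Sh Szz 1 (fun N o => rollout H (Gy N o) (Gu N o)) (maxn 1 n1)
  (fun n o => Gw *m Psi H A B Bw w u Sx n o)
  (fun n o => stack (fun i : 'I_H => Lin H A B i.+1 (Rem n o)) +
     stack (fun i : 'I_H => Quad H A B (rtR n) (X n o) i.+1))) => //.
- by move=> n; rewrite geq_max => /andP[_ /hN'[my mu' _]]; exact: measurable_rollout.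
- by apply: mbdm_mull; by apply: Psi_ubd.
- apply: mbdmD.
    by apply: mbdm_stack => i; exact: Lin_lbd.
  by apply: mbdm_stack => i; exact: Quad_lbd.
- move=> n; rewrite geq_max => /andP[np nn].
  have := root_errE (Szeta_unit du SxU) ThE nn np; apply: filterS => o hX.
  have sr : Num.sqrt n%:R * rtR n = 1 by exact: sqrt_rt.
  have GE : row_mx (Gy (n + 1)%N o) (Gu (n + 1)%N o) = row_mx A B + rtR n *: X n o.
    rewrite /X /root_err /Th nn scalerA [rtR n * _]mulrC sr scale1r.
    by rewrite addrC subrK.
  have GyE : Gy (n + 1)%N o = A + rtR n *: lsubmx (X n o).
    by have := congr1 lsubmx GE; rewrite row_mxKl linearD linearZ/= row_mxKl.
  have GuE : Gu (n + 1)%N o = B + rtR n *: rsubmx (X n o).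
    by have := congr1 rsubmx GE; rewrite row_mxKr linearD linearZ/= row_mxKr.
  rewrite GyE GuE !rollout_Rw.
  rewrite (@toeplitz_stack _ H _ _ _ A Bw (fun j => W 0 n o *m Kmx H A B Sx j)).
  apply/matrixP => r c; case: (mxtens_indexP r) => i a.
  rewrite [LHS]mxE [X in _ * X]mxE [X in _ * (_ + X)]mxE !stackE Rw_expand.
  have rhsE (M N K : 'M[R]_(H * dx, q)) h x y : (M + h *: (N + K)) x y = M x y + h * (N x y + K x y).
    by rewrite !mxE.
  rewrite rhsE !stackE.
  have -> : prop A i.+1 (fun l => Bw *m (W 0 n o *m Kmx H A B Sx l)) =
      Lin H A B i.+1 (X n o - rtR n *: Rem n o).
    rewrite /X hX addrK /Lin; congr prop; apply/funext => l.
    have -> : nsum (fun t o => e t o *m (zeta t o)^T) n o = Bw *m W 0 n o *m X0^T.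
      by rewrite -nsum_mul; apply: nsum_ext => t; exact: eE.
    by rewrite (Szeta_inv du SxU) /Kmx !mulmxA.
  rewrite -scaleNr LinD.
  have alg (s h x l y k : R) : s * h = 1 ->
      s * (x + h * l + h ^+ 2 * k - x) = l + - h * y + h * (y + k).
    by move=> sh; rewrite [LHS](_ : _ = s * h * l + s * h * h * k); [rewrite sh|]; ring.
  have e2 (M N : 'M[R]_(dx, q)) h x y : (M + h *: N) x y = M x y + h * N x y by rewrite !mxE.
  by rewrite !e2; exact: alg.
- by apply: ss_main_rate.
Qed.

End single_step.

End estimators.

(** * Comparison of the two limits *)

Theorem mainTheorem3 (R : realType) (d : measure_display) (T : measurableType d)
  (P : probability T R) (dx du H : nat) (H_ge1 : (1 <= H)%N)
  (A : 'M[R]_dx) (B : 'M[R]_(dx, du)) (Bw : 'M[R]_dx)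
  (A_stable : spectral_radius A < 1)
  (A_ctrl : controllable A (row_mx B Bw))
  (w : nat -> T -> 'cV[R]_dx) (u : nat -> T -> 'cV[R]_du)
  (w_iid : iid_std_gaussian P w) (u_iid : iid_std_gaussian P u)
  (wu_indep : independent_seqs P w u)
  (Sx : 'M[R]_dx)
  (SxE : Sx = A *m Sx *m A^T + B *m B^T + Bw *m Bw^T)
  (Sz_half : 'M[R]_(dx + H * du))
  (Sz_halfP : is_psd_sqrt Sz_half (Sigma_z P H A B Bw w u))
  (GMS : nat -> T -> 'M[R]_(H * dx, dx + H * du))
  (GMS_lsq : \forall N \near \oo, ms_estimator P A B Bw w u N (GMS N))
  (Gy : nat -> T -> 'M[R]_dx) (Gu : nat -> T -> 'M[R]_(dx, du))
  (GyGu_lsq : \forall N \near \oo, ss_estimator P A B Bw w u N (Gy N) (Gu N)) :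
  let GSS := fun N o => rollout H (Gy N o) (Gu N o) in
  let Gw := toeplitz H A Bw in
  let MMS := M_MS H A in
  let MSS := M_SS H A Bw Sx in
  psd (MMS - MSS) /\
  exists lMS lSS : R,
    [/\ scaled_error P A B Sz_half N (GMS N) @[N --> \oo] --> lMS%:E,
        scaled_error P A B Sz_half N (GSS N) @[N --> \oo] --> lSS%:E,
        lMS = lSS +
          \tr (Gw *m tensmx (MMS - MSS + ((H - 1) * du)%:R%:M) (1%:M : 'M[R]_dx)
               *m Gw^T)
      & lSS <= lMS].
Proof.
move=> GSS Gw MMS MSS.
have gf := noise_gauss_family w_iid u_iid wu_indep.
have SxC := SxE_row SxE.
have SxT := Sx_sym A_stable SxC.
have psdM : psd (MMS - MSS).
  by apply: M_MS_sub_M_SS_psd => //; exact: (invSx_psd A_stable A_ctrl SxC).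
split=> //.
exists (\tr (Gw *m tensmx (MMS + (H * du)%:R%:M) (1%:M : 'M[R]_dx) *m Gw^T)).
exists (\tr (Gw *m tensmx (MSS + du%:R%:M) (1%:M : 'M[R]_dx) *m Gw^T)).
(* Both limits are linear in the middle matrix, and H du = du + (H - 1) du by H >= 1. *)
have E : \tr (Gw *m tensmx (MMS + (H * du)%:R%:M) (1%:M : 'M[R]_dx) *m Gw^T) =
   \tr (Gw *m tensmx (MSS + du%:R%:M) (1%:M : 'M[R]_dx) *m Gw^T) +
   \tr (Gw *m tensmx (MMS - MSS + ((H - 1) * du)%:R%:M) (1%:M : 'M[R]_dx) *m Gw^T).
  rewrite -raddfD/= -mulmxDl -mulmxDr; congr (\tr (_ *m _ *m _)).
  apply/matrixP => r s; rewrite !mxE -mulrDl; congr (_ * _).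
  have -> : (H * du)%N = (du + (H - 1) * du)%N by rewrite -mulSn subn1 prednK.
  by rewrite natrD mulrnDl; ring.
have psdD : psd (MMS - MSS + ((H - 1) * du)%:R%:M).
  case: psdM => MT M0; split; first by rewrite linearD/= MT tr_scalar_mx.
  move=> v; rewrite mulmxDr mulmxDl mxE addr_ge0// mul_mx_scalar -scalemxAl mxE mulr_ge0//.
  by rewrite mxE sumr_ge0// => i _; rewrite mxE -expr2 sqr_ge0.
split=> //.
- exact: (@ms_limit _ _ _ _ _ _ _ H_ge1 _ _ _ _ _ gf A_stable A_ctrl _ SxE _ Sz_halfP _ GMS_lsq).
- exact: (@ss_limit _ _ _ _ _ _ _ H_ge1 _ _ _ _ _ gf A_stable A_ctrl _ SxE _ Sz_halfP _ _ GyGu_lsq).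
- by rewrite E lerDl tensmx_psd.
Qed.
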